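(* There exist numerical constants $C_1, C_2>0$ (independent of all the quantities below) such that the following holds. Let $N\in\mathbb{N}$, let $x\in\mathbb{C}^N$, let $\epsilon\in(0,1)$, let $\delta\ge 0$, and let $\Delta\subset\{1,\ldots,N\}$ with $|\Delta|=s$. Let $\Omega=\Omega'\cup\{0\}$, where $\Omega'\subset\{-\lfloor N/2\rfloor+1,\ldots,\lceil N/2\rceil\}$ consists of $m$ indices chosen uniformly at random (without replacement) with $$m\ \ge\ C_1\, s\,(1+\log(\epsilon^{-1}))\,\log(N).$$ Suppose that $y=P_\Omega Ax+\eta$, where $\|\eta\|_2\le\sqrt m\,\delta$. Then with probability exceeding $1-\epsilon$, any minimizer $\hat x$ of $$\min_{z\in\mathbb{C}^N}\|z\|_{TV}\quad\text{subject to}\quad\|P_\Omega Az-y\|_2\le\sqrt m\,\delta$$ satisfies $$\|Dx-D\hat x\|_2\le C_2\left(\delta\sqrt s+\mathcal{L}\,\frac{\|P_\Delta^\perp Dx\|_1}{\sqrt s}\right),\qquad \frac{\|x-\hat x\|_2}{\sqrt N}\le C_2\left(\delta\sqrt s+\mathcal{L}\,\|P_\Delta^\perp Dx\|_1\right),$$ where $\mathcal{L}=\log^{1/2}(m)\log(s)$.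
   Context: $\|z\|_p^p=\sum_{j=1}^N|z_j|^p$ for $z\in\mathbb{C}^N$. The discrete Fourier transform $A\in\mathbb{C}^{N\times N}$ is the (non-unitary) map $Az=\bigl(\sum_{j=1}^N z_j e^{2\pi i kj/N}\bigr)_{k=-\lfloor N/2\rfloor+1}^{\lceil N/2\rceil}$, so the entries of $Az$ are indexed by the frequencies $k$. The periodic discrete gradient is $D:\mathbb{C}^N\to\mathbb{C}^N$, $Dz=(z_j-z_{j+1})_{j=1}^N$ with $z_{N+1}:=z_1$, and $\|z\|_{TV}:=\|Dz\|_1$. For a set of indices $\Lambda$, $P_\Lambda$ is the projection that keeps the entries of a vector indexed by $\Lambda$ and sets all other entries to zero, and $P_\Lambda^\perp=I-P_\Lambda$.
   Formalization: The result is proved for s ≥ 2 (and m ≤ N, implicit in sampling without replacement): for s = 0 the bound is undefined, and for s = 1 the factor log(s) vanishes, so the claim would assert exact recovery of every x from noiseless data, which is false. *)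

(* Defs.v *)
From mathcomp Require Import all_boot all_order all_algebra.
From mathcomp Require Export complex.
From mathcomp Require Import boolp reals exp trigo.

Set Implicit Arguments.
Unset Strict Implicit.
Unset Printing Implicit Defensive.

Import Order.TTheory GRing.Theory Num.Theory.

Local Open Scope ring_scope.

(* The mathematical index j in {1, ..., N} of a signal is encoded by the
   ordinal of value j - 1. *)

Section Defs.
Variables (R : realType) (N : nat).
Implicit Types (z : 'cV[R[i]]_N) (L : {set 'I_N}).

Definition lpnorm (p : R) z : R :=
  (\sum_(j < N) ComplexField.Normc.normc (z j ord0) `^ p) `^ p^-1.

Definition cis (t : R) : R[i] := Complex (cos t) (sin t).

(* Ordinals of value 0, ..., N - 1 encode the frequencies
   - floor(N/2) + 1, ..., ceil(N/2), in this order. *)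
Definition freq (k : 'I_N) : int := k%:Z - (N./2)%:Z + 1.

Definition dft : 'M[R[i]]_N :=
  \matrix_(k, j) cis (2 * pi * (freq k)%:~R * j.+1%:R / N%:R).

Definition grad z : 'cV[R[i]]_N := \col_j (z j ord0 - z (ordS j) ord0).

Definition tvnorm z : R := lpnorm 1 (grad z).

Definition proj L z : 'cV[R[i]]_N := \col_j (if j \in L then z j ord0 else 0).

Definition proj_perp L z : 'cV[R[i]]_N := z - proj L z.

Definition freq0 : {set 'I_N} := [set k | freq k == 0].

Definition feasible (Omega : {set 'I_N}) (y : 'cV[R[i]]_N) (r : R) z : Prop :=
  lpnorm 2 (proj Omega (dft *m z) - y) <= r.

Definition tv_minimizer (Omega : {set 'I_N}) (y : 'cV[R[i]]_N) (r : R) z :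
    Prop :=
  feasible Omega y r z /\
  forall w, feasible Omega y r w -> tvnorm z <= tvnorm w.

(* Probability of E under the uniform law on the m-element subsets of 'I_N;
   meaningful for m <= N. *)
Definition unif_prob (m : nat) (E : {set 'I_N} -> Prop) : R :=
  #|[set S : {set 'I_N} | (#|S| == m) && `[< E S >]]|%:R
    / #|[set S : {set 'I_N} | #|S| == m]|%:R.

End Defs.

Arguments dft R N : clear implicits.
Arguments freq0 N : clear implicits.
Arguments unif_prob R {N} m E.

(* This factor vanishes for s = 1. *)
Definition logfactor (R : realType) (m s : nat) : R :=
  Num.sqrt (ln m%:R) * ln s%:R.
Arguments logfactor R m s : clear implicits.

(* Main.v *)
(** The proof is a two-scale compressed sensing argument for [h := D (xh - x)],
    whose Fourier coefficients on the sample are small because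
    [(F D z)_k = (1 - cis (- 2 pi k / N)) (F z)_k].

    Off [Delta]: for a fixed sign pattern [u] on [Delta], Gross' golfing scheme
    builds, with overwhelming probability, a vector [v] in the row space of the
    sampled Fourier matrix with [v ~ u] on [Delta] and [|v| <= 1/2] elsewhere.
    Pairing [h] with [v] for the sign pattern of [D x] bounds the l^1 norm of
    [h] off [Delta]. The same certificates are built for the [N] rows of the
    Fourier matrix, so that every [(F h)_k] becomes, up to an error of order
    [delta sqrt s], a bounded combination of the entries of [h] off [Delta];
    and for the [N] indicators of prefixes, whose pairings with [h] are
    differences [z_0 - z_l] of the signal. The latter give the second estimate
    in sup norm.

    For the l^2 norm of [h], an independent second sample is used: the matrix
    expressing [F h] through the part of [h] off [Delta] has bounded entries and
    is independent of that sample, so a Haviv-Regev level-set argument (Maurey's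
    empirical method at each dyadic level, plus Chernoff) bounds its full row
    average by its sampled row average, uniformly over the l^1 ball.

    All probabilities are computed for independent Bernoulli selectors; the
    favourable event is monotone in the sample, which allows the comparison with
    a uniformly random [m]-subset. *)

Require Import Defs.
From mathcomp Require Import all_boot all_order all_algebra.
From mathcomp Require Import boolp reals exp trigo.
From mathcomp Require Import ring lra.
From mathcomp Require Import topology normedtype derive realfun sequences.

Set Implicit Arguments.
Unset Strict Implicit.
Unset Printing Implicit Defensive.

Import Order.TTheory GRing.Theory Num.Theory.
Import numFieldNormedType.Exports.

Local Open Scope ring_scope.

Local Notation normc := ComplexField.Normc.normc.
Local Notation Re := complex.Re.
Local Notation Im := complex.Im.

(** * Hyperbolic functions *)

Section Hyperbolic.
Variable R : realType.
Implicit Types x y r w : R.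

(** Two obstacles shape the argument. There are [2 N + 1] certificates, so each may fail with
    probability of order [eps / N] only. With one fixed sample per golfing stage, this alone would
    ask for [s ln (N / eps)] samples in each of about [ln s] stages. Repeating a failed stage leaves
    only the total sampling time to be controlled, through an exponential moment, and the cost
    becomes additive in the number of stages. The l^2 estimate cannot come from an isometry of [F]
    on the l^1 ball, because the part of [h] on [Delta] has l^1 norm up to [sqrt s] times its l^2
    norm: an additive error of order [L^2 / s] times the square of that norm could not be absorbed.
    The matrix built from the certificates ignores [Delta], and off [Delta] the l^1 norm of [h] is
    already under control. The vector Bernstein inequality behind both samples is run on [cosh] of
    the norm, whose convexity as a function of the squared norm replaces any orthogonality or
    dimension count. *)

Definition cosh x : R := (expR x + expR (- x)) / 2.
Definition sinh x : R := (expR x - expR (- x)) / 2.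

Lemma is_derive_cosh x : is_derive x 1 cosh (sinh x).
Proof.
have -> : cosh = (fun y => 2^-1 *: (expR y + expR (- y))).
  by apply/funext => y; rewrite /cosh mulrC.
apply: is_derive_eq; rewrite /sinh /GRing.scale /=; by field.
Qed.

Lemma is_derive_sinh x : is_derive x 1 sinh (cosh x).
Proof.
have -> : sinh = (fun y => 2^-1 *: (expR y - expR (- y))).
  by apply/funext => y; rewrite /sinh mulrC.
apply: is_derive_eq; rewrite /cosh /GRing.scale /=; by field.
Qed.

Lemma derive_mvt (f df : R -> R) x y : (forall z : R, is_derive z 1 f (df z)) ->
  x <= y -> exists2 c, x <= c <= y & f y - f x = df c * (y - x).
Proof.
move=> fd xy; have [|c] := @MVT_segment R f df x y xy (fun z _ => fd z).
  apply: derivable_within_continuous => z _; exact: (@ex_derive _ _ _ _ _ _ _ (fd z)).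
by rewrite in_itv; exists c.
Qed.

Lemma cosh0 : cosh 0 = 1.
Proof. rewrite /cosh oppr0 expR0; by field. Qed.

Lemma sinh0 : sinh 0 = 0.
Proof. by rewrite /sinh oppr0 subrr mul0r. Qed.

Lemma cosh_ge1 x : 1 <= cosh x.
Proof. rewrite /cosh; have := expR_ge1Dx x; have := expR_ge1Dx (- x); lra. Qed.

Lemma sinh_le_cosh x : sinh x <= cosh x.
Proof. rewrite /cosh /sinh; have := expR_gt0 (- x); lra. Qed.

Lemma sinh_ge x : 0 <= x -> x <= sinh x.
Proof.
move=> x0; have [c _] := derive_mvt is_derive_sinh x0.
rewrite sinh0 !subr0 => ->; have := cosh_ge1 c; nra.
Qed.

Lemma sinh_ge0 x : 0 <= x -> 0 <= sinh x.
Proof. by move=> x0; exact: le_trans (sinh_ge x0). Qed.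

Lemma sinh_le_mul_cosh x : 0 <= x -> sinh x <= x * cosh x.
Proof.
move=> x0; have fd (z : R) : is_derive z 1 (fun y => y * cosh y - sinh y) (z * sinh z).
  have := is_derive_cosh z; have := is_derive_sinh z => ? ?.
  apply: is_derive_eq; rewrite /GRing.scale /=; ring.
have [c /andP[c0 _]] := derive_mvt fd x0.
rewrite sinh0 mul0r !subr0 -subr_ge0 => ->.
by rewrite mulr_ge0 // mulr_ge0 // sinh_ge0.
Qed.

Lemma coshD x y : cosh (x + y) = cosh x * cosh y + sinh x * sinh y.
Proof. rewrite /cosh /sinh opprD !expRD; by field. Qed.

Lemma sinhD x y : sinh (x + y) = sinh x * cosh y + cosh x * sinh y.
Proof. rewrite /cosh /sinh opprD !expRD; by field. Qed.

Lemma coshN x : cosh (- x) = cosh x.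
Proof. by rewrite /cosh opprK addrC. Qed.

Lemma sinhN x : sinh (- x) = - sinh x.
Proof. rewrite /sinh opprK; by field. Qed.

(** This is monotonicity of [sinh w / w], cleared of denominators because [r] may be 0; it amounts
    to convexity of [cosh] in the squared argument. *)
Lemma sinh_slope_homo r w : 0 <= r -> r <= w -> w * sinh r <= r * sinh w.
Proof.
move=> r0; rewrite -subr_ge0; have := subrKC r w; move: (w - r) => d <- d0.
rewrite sinhD; have := cosh_ge1 d; have := sinh_ge d0.
have := sinh_le_mul_cosh r0; have := sinh_ge0 r0; have := cosh_ge1 r.
move: (cosh r) (sinh r) (cosh d) (sinh d) => cr sr cd sd h1 h2 h3 h4 h5.
have : r * sr <= r * (sr * cd) by rewrite ler_wpM2l // ler_peMr.
have : d * sr <= r * (cr * sd).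
  rewrite (le_trans (ler_wpM2l d0 h3)) //; have : d * (r * cr) <= sd * (r * cr).
    rewrite ler_wpM2r // mulr_ge0 //; lra.
  by move=> /le_trans; apply; rewrite mulrC mulrA.
rewrite mulrDr mulrDl; lra.
Qed.

(** As a function of the square, [cosh] is convex and has slope [sinh r / (2 r)] at [r ^+ 2].
    Convexity enters as the sign change of [sinh c - k * c] at [r]. *)
Lemma cosh_tangent r w : 0 < r -> 0 <= w ->
  cosh r + sinh r / r / 2 * (w ^+ 2 - r ^+ 2) <= cosh w.
Proof.
move=> r0 w0; have : sinh r / r * r = sinh r by rewrite divfK // gt_eqF.
move: (sinh r / r) => k kE.
have fd (z : R) : is_derive z 1 (fun y => cosh y - (k / 2) *: y ^+ 2) (sinh z - k * z).
  have := is_derive_cosh z => ?.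
  apply: is_derive_eq; rewrite /GRing.scale /=; by field.
have H : 0 <= (cosh w - (k / 2) * w ^+ 2) - (cosh r - (k / 2) * r ^+ 2).
  have [rw|/ltW wr] := leP r w.
    have [c /andP[rc cw] ->] := derive_mvt fd rw.
    rewrite mulr_ge0 ?subr_ge0 // -(ler_pM2r r0) [k * c * r]mulrAC kE mulrC [leRHS]mulrC.
    exact: sinh_slope_homo (ltW r0) rc.
  have [c /andP[wc cr]] := derive_mvt fd wr.
  rewrite /GRing.scale /= => E.
  have : (sinh c - k * c) * (r - w) <= 0.
    rewrite mulr_le0_ge0 ?subr_ge0 // subr_le0 -(ler_pM2r r0) [k * c * r]mulrAC kE mulrC [leRHS]mulrC.
    exact: sinh_slope_homo (le_trans w0 wc) cr.
  by rewrite -E; lra.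
lra.
Qed.

Lemma cosh_ge0 x : 0 <= cosh x.
Proof. exact: le_trans (cosh_ge1 x). Qed.

(* The function [fun z => cosh (sqrt z)] is convex, hence below its chord. *)
Lemma cosh_chord a b r c : 0 <= a -> 0 <= b -> 0 <= r ->
  r ^+ 2 = a ^+ 2 + 2 * c + b ^+ 2 -> `|c| <= a * b ->
  cosh r <= cosh a * cosh b + c * (sinh a / a) * (sinh b / b).
Proof.
move=> a0 b0 r0 rE; rewrite ler_norml => /andP[c1 c2].
have [ab0|ab0] := eqVneq (a * b) 0.
  have c0 : c = 0 by lra.
  rewrite c0 !mul0r addr0.
  move/eqP: ab0; rewrite mulf_eq0 => /orP[]/eqP h.
    have -> : r = b by apply/eqP; rewrite -(@eqrXn2 _ 2) // rE c0 h; apply/eqP; ring.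
    by rewrite h cosh0 mul1r.
  have -> : r = a by apply/eqP; rewrite -(@eqrXn2 _ 2) // rE c0 h; apply/eqP; ring.
  by rewrite h cosh0 mulr1.
have abp : 0 < a * b by rewrite lt_def ab0 mulr_ge0.
have ap : 0 < a by rewrite lt_def a0 andbT; apply: contra_neq ab0 => ->; rewrite mul0r.
have bp : 0 < b by rewrite lt_def b0 andbT; apply: contra_neq ab0 => ->; rewrite mulr0.
(* The weight that makes [r ^+ 2] the convex combination of [(a + b) ^+ 2] and [(a - b) ^+ 2]. The
   tangent bounds at [r], added with weights [th] and [1 - th], give the chord. *)
pose th := (a * b + c) / (2 * (a * b)).
have th1 : 0 <= th by rewrite divr_ge0 //; lra.
have th2 : 0 <= 1 - th.
  by rewrite subr_ge0 ler_pdivrMr; lra.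
have thE : th * (2 * (a * b)) = a * b + c by rewrite divfK //; lra.
have -> : cosh a * cosh b + c * (sinh a / a) * (sinh b / b) =
   th * cosh (a + b) + (1 - th) * cosh `|a - b|.
  have -> : cosh `|a - b| = cosh (a - b).
    by case: (ger0P (a - b)) => // _; rewrite coshN.
  rewrite !coshD coshN sinhN /th; field.
  by rewrite !gt_eqF.
have [r00|rp] := eqVneq r 0.
  rewrite r00 cosh0; have := cosh_ge1 (a + b); have := cosh_ge1 `|a - b|; nra.
have {}rp : 0 < r by rewrite lt_def rp.
have t1 := @cosh_tangent r (a + b) rp (addr_ge0 a0 b0).
have t2 := @cosh_tangent r `|a - b| rp (normr_ge0 _).
rewrite real_normK ?num_real // in t2.
have := ler_wpM2l th1 t1; have := ler_wpM2l th2 t2.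
move: (sinh r / r / 2) => k.
have -> : r ^+ 2 = th * (a + b) ^+ 2 + (1 - th) * (a - b) ^+ 2.
  rewrite rE; transitivity (a ^+ 2 + 2 * (th * (2 * (a * b)) - a * b) + b ^+ 2); last by ring.
  rewrite thE; ring.
lra.
Qed.

(** Squaring [exp (x / 2) * (1 - x / 2) <= 1] bounds [exp x] by the inverse of [(1 - x / 2) ^+ 2].
    Comparison with the quadratic leaves the factor [1 - 3 x + x ^+ 2], nonnegative up to [1 / 3]:
    the source of every [3^-1] in the Bernstein bounds. *)
Lemma expR_le_quad x : 0 <= x <= 3^-1 -> expR x <= 1 + x + x ^+ 2.
Proof.
move=> /andP[x0 x3].
have h : expR x * (1 - x / 2) ^+ 2 <= 1.
  have -> : expR x = (expR (x / 2)) ^+ 2 by rewrite -expRM_natl; congr expR; by field.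
  rewrite -exprMn exprn_ile1 //.
    by rewrite mulr_ge0 ?expR_ge0 //; lra.
  rewrite -[leRHS](expRxMexpNx_1 (x / 2)) ler_wpM2l ?expR_ge0 //.
  exact: expR_ge1Dx.
have p : 0 < (1 - x / 2) ^+ 2 by rewrite exprn_gt0 //; lra.
rewrite -(ler_pM2r p) (le_trans h) //.
have -> : (1 + x + x ^+ 2) * (1 - x / 2) ^+ 2 = 1 + x ^+ 2 / 4 * (1 - 3 * x + x ^+ 2) by field.
rewrite lerDl mulr_ge0 //; first by rewrite divr_ge0 ?sqr_ge0.
have := sqr_ge0 x; lra.
Qed.

Lemma expR_le2cosh x : expR x <= 2 * cosh x.
Proof. rewrite /cosh; have := expR_gt0 (- x); lra. Qed.

Lemma coshDsinh x : cosh x + sinh x = expR x.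
Proof. rewrite /cosh /sinh; by field. Qed.

Lemma expR_half_le2 : expR 2^-1 <= 2 :> R.
Proof.
have := expR_ge1Dx (- 2^-1 : R); have := expRxMexpNx_1 (2^-1 : R); have := expR_gt0 (2^-1 : R).
move: (expR _) (expR _) => u v; nra.
Qed.

Lemma expR1_le4 : expR 1 <= 4 :> R.
Proof.
have -> : (1 : R) = 2%:R * 2^-1 by field.
rewrite expRM_natl expr2; have := expR_half_le2; have := expR_ge0 (2^-1 : R).
move: (expR _) => u; nra.
Qed.

Lemma expRN1_le_half : expR (-1) <= 2^-1 :> R.
Proof.
have := expR_ge1Dx (1 : R); have := expRxMexpNx_1 (1 : R); have := expR_gt0 (1 : R).
move: (expR _) (expR _) => a b; nra.
Qed.

Lemma one_sub_expRN (u : R) : 0 <= u <= 1 -> u / 2 <= 1 - expR (- u).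
Proof.
move=> /andP[u0 u1]; have := expR_ge1Dx u; have := expRxMexpNx_1 u; have := expR_gt0 (- u).
move: (expR u) (expR (- u)) => a b; nra.
Qed.

End Hyperbolic.

(** * Vectors, product expectations and Bernstein's inequality *)

Section FiniteVectors.
Variables (R : realType) (J : finType).
Implicit Types (x y : J -> R[i]) (z : R[i]) (a b : J -> R).

Lemma normc_ge0 z : 0 <= normc z.
Proof. by case: z => ? ?; exact: sqrtr_ge0. Qed.

Lemma normc_sqr z : normc z ^+ 2 = Re z ^+ 2 + Im z ^+ 2.
Proof. by case: z => ? ? /=; rewrite sqr_sqrtr // addr_ge0 ?sqr_ge0. Qed.

Lemma Re_sum (K : finType) (f : K -> R[i]) : Re (\sum_k f k) = \sum_k Re (f k).
Proof. by apply: (big_morph (@Re R)) => // -[? ?] [? ?]. Qed.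

Lemma Im_sum (K : finType) (f : K -> R[i]) : Im (\sum_k f k) = \sum_k Im (f k).
Proof. by apply: (big_morph (@Im R)) => // -[? ?] [? ?]. Qed.

Lemma normc_sum (K : Type) (r : seq K) (P : pred K) (f : K -> R[i]) :
  normc (\sum_(k <- r | P k) f k) <= \sum_(k <- r | P k) normc (f k).
Proof.
elim/big_rec2: _ => [|k u v _ h]; first by rewrite ComplexField.Normc.normc0.
by apply: le_trans (le_normcD _ _) _; rewrite lerD2l.
Qed.

Lemma normc_real (r : R) : normc r%:C%C = `|r|.
Proof. by rewrite /= expr0n /= addr0 sqrtr_sqr. Qed.

Lemma normc_conj z : normc z^*%C = normc z.
Proof. by case: z => ? ? /=; rewrite sqrrN. Qed.

Lemma sum_CS a b : (\sum_j a j * b j) ^+ 2 <= (\sum_j a j ^+ 2) * (\sum_j b j ^+ 2).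
Proof.
have : 0 <= \sum_i \sum_j (a i * b j - a j * b i) ^+ 2.
  by apply: sumr_ge0 => i _; apply: sumr_ge0 => j _; exact: sqr_ge0.
have -> : \sum_i \sum_j (a i * b j - a j * b i) ^+ 2 =
  \sum_i \sum_j (a i ^+ 2 * b j ^+ 2) + \sum_i \sum_j (b i ^+ 2 * a j ^+ 2)
   - 2 * \sum_i \sum_j ((a i * b i) * (a j * b j)).
  rewrite mulr_sumr -big_split -sumrB; apply: eq_bigr => i _ /=.
  rewrite mulr_sumr -big_split -sumrB; apply: eq_bigr => j _ /=; ring.
rewrite -!big_distrlr /= expr2; lra.
Qed.

Lemma sum_CS_sqrt a b : 
  `|\sum_j a j * b j| <= Num.sqrt (\sum_j a j ^+ 2) * Num.sqrt (\sum_j b j ^+ 2).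
Proof.
rewrite -sqrtrM ?sumr_ge0 // => [|j _]; last exact: sqr_ge0.
by rewrite -sqrtr_sqr ler_wsqrtr // sum_CS.
Qed.

Definition nrm2 x : R := \sum_j normc (x j) ^+ 2.
Definition nrm x : R := Num.sqrt (nrm2 x).
Definition rdot x y : R := \sum_j (Re (x j) * Re (y j) + Im (x j) * Im (y j)).

Lemma nrm2_ge0 x : 0 <= nrm2 x.
Proof. by apply: sumr_ge0 => j _; exact: sqr_ge0. Qed.

Lemma nrm_ge0 x : 0 <= nrm x.
Proof. exact: sqrtr_ge0. Qed.

Lemma sqr_nrm x : nrm x ^+ 2 = nrm2 x.
Proof. by rewrite sqr_sqrtr // nrm2_ge0. Qed.

Lemma eq_nrm x y : x =1 y -> nrm x = nrm y.
Proof. by move=> e; rewrite /nrm /nrm2; congr Num.sqrt; apply: eq_bigr => j _; rewrite e. Qed.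

Lemma nrm_le x (c : R) : 0 <= c -> (nrm x <= c) = (nrm2 x <= c ^+ 2).
Proof. by move=> c0; rewrite -sqr_nrm ler_pXn2r // ?nnegrE ?nrm_ge0. Qed.

Lemma normc_le_nrm x j : normc (x j) <= nrm x.
Proof.
rewrite -(@ler_pXn2r _ 2) ?nnegrE ?normc_ge0 ?nrm_ge0 // sqr_nrm /nrm2 (bigD1 j) //=.
by rewrite lerDl sumr_ge0 // => k _; exact: sqr_ge0.
Qed.

Lemma nrm2D x y : nrm2 (fun j => x j + y j) = nrm2 x + 2 * rdot x y + nrm2 y.
Proof.
rewrite /nrm2 /rdot mulr_sumr -!big_split; apply: eq_bigr => j _ /=.
rewrite !normc_sqr; case: (x j) => ? ?; case: (y j) => ? ? /=; ring.
Qed.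

Lemma normc_dot x y : normc (\sum_j x j * y j) <= nrm x * nrm y.
Proof.
apply: le_trans (normc_sum _ _ _) _.
under eq_bigr do rewrite ComplexField.Normc.normcM.
exact: le_trans (ler_norm _) (sum_CS_sqrt _ _).
Qed.

Lemma rdotE x y : rdot x y = Re (\sum_j x j * (y j)^*%C).
Proof.
rewrite Re_sum; apply: eq_bigr => j _; case: (x j) => ? ?; case: (y j) => ? ? /=; ring.
Qed.

Lemma nrm_conj x : nrm (fun j => (x j)^*%C) = nrm x.
Proof. by congr Num.sqrt; apply: eq_bigr => j _; rewrite normc_conj. Qed.

Lemma normr_Re z : `|Re z| <= normc z.
Proof.
rewrite -(@ler_pXn2r _ 2) ?nnegrE ?normc_ge0 // normc_sqr real_normK ?num_real //.
by rewrite lerDl sqr_ge0.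
Qed.

Lemma rdot_le x y : `|rdot x y| <= nrm x * nrm y.
Proof. by rewrite rdotE (le_trans (normr_Re _)) // -(nrm_conj y) normc_dot. Qed.

Lemma nrmD x y : nrm (fun j => x j + y j) <= nrm x + nrm y.
Proof.
rewrite nrm_le ?addr_ge0 ?nrm_ge0 // nrm2D sqrrD !sqr_nrm lerD2r lerD2l -[leRHS]mulr_natl.
by rewrite ler_wpM2l // (le_trans (ler_norm _)) // rdot_le.
Qed.

Lemma nrmZ (c : R[i]) x : nrm (fun j => c * x j) = normc c * nrm x.
Proof.
have -> : normc c = Num.sqrt (normc c ^+ 2).
  by rewrite sqrtr_sqr ger0_norm ?normc_ge0.
rewrite -sqrtrM ?sqr_ge0 //; congr Num.sqrt; rewrite /nrm2 mulr_sumr.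
by apply: eq_bigr => j _; rewrite ComplexField.Normc.normcM exprMn.
Qed.

Lemma nrmN x : nrm (fun j => - x j) = nrm x.
Proof. by congr Num.sqrt; apply: eq_bigr => j _; rewrite normcN. Qed.

Lemma rdot_sum (K : finType) (p : K -> R) x (Y : K -> J -> R[i]) :
  \sum_k p k * rdot x (Y k) = rdot x (fun j => \sum_k (p k)%:C%C * Y k j).
Proof.
rewrite /rdot; under eq_bigr do rewrite mulr_sumr.
rewrite exchange_big; apply: eq_bigr => j _ /=.
rewrite Re_sum Im_sum !mulr_sumr -big_split; apply: eq_bigr => k _ /=.
by case: (Y k j) => ? ? /=; ring.
Qed.

End FiniteVectors.

Section Hyperbolic2.
Variable R : realType.

(** The coefficient of [c] must not depend on [b] if a mean-zero [c] is to cancel. Dropping the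
    factor [sinh b / b] costs at most [sinh a * (sinh b - b)], hence at most
    [cosh a * (sinh b - b)], which turns [cosh b] into [exp b - b]. *)
Lemma cosh_chord_lin (a b r c : R) : 0 <= a -> 0 <= b -> 0 <= r ->
  r ^+ 2 = a ^+ 2 + 2 * c + b ^+ 2 -> `|c| <= a * b ->
  cosh r <= cosh a * (expR b - b) + c * (sinh a / a).
Proof.
move=> a0 b0 r0 rE cab; apply: le_trans (cosh_chord a0 b0 r0 rE cab) _.
have := sinh_ge a0; have := sinh_ge b0; have := sinh_le_cosh a.
rewrite -(coshDsinh b); move: (cosh a) (cosh b) => ca cb.
move: cab; rewrite ler_norml => /andP[c1 c2].
have [bE|bn] := eqVneq b 0.
  have -> : c = 0 by move: c1 c2; rewrite bE; lra.
  rewrite bE sinh0; lra.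
have [aE|an] := eqVneq a 0.
  have -> : c = 0 by move: c1 c2; rewrite aE; lra.
  rewrite aE sinh0 => h1 h2 h3; rewrite !mul0r !addr0.
  rewrite ler_wpM2l //; lra.
have ap : 0 < a by rewrite lt_def an.
have bp : 0 < b by rewrite lt_def bn.
have ea : sinh a / a * a = sinh a by rewrite divfK.
have eb : sinh b / b * b = sinh b by rewrite divfK.
move: (sinh a / a) (sinh b / b) ea eb => u v <- <- h1 h2 h3.
have v1 : 1 <= v by rewrite -(ler_pM2r bp); lra.
have u0 : 0 <= u by rewrite -(ler_pM2r ap); lra.
have : c * u * (v - 1) <= a * b * u * (v - 1).
  by rewrite ler_wpM2r ?ler_wpM2r // subr_ge0.
have : u * a * (b * (v - 1)) <= ca * (b * (v - 1)).
  by rewrite ler_wpM2r // mulr_ge0 // subr_ge0.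
lra.
Qed.

(** The inner product of [x] with the increment enters linearly and averages to 0, so a centred step
    costs a factor that does not depend on [x] or on the dimension. *)
Lemma pinelis_step (J K : finType) (p : K -> R) (x : J -> R[i]) (Y : K -> J -> R[i]) (l : R) :
  0 <= l -> (forall k, 0 <= p k) -> (forall j, \sum_k (p k)%:C%C * Y k j = 0) ->
  \sum_k p k * cosh (l * nrm (fun j => x j + Y k j)) <=
  cosh (l * nrm x) * \sum_k p k * (expR (l * nrm (Y k)) - l * nrm (Y k)).
Proof.
move=> l0 p0 EY; pose u := sinh (l * nrm x) / (l * nrm x).
apply: (@le_trans _ _ (\sum_k p k * (cosh (l * nrm x) * (expR (l * nrm (Y k)) - l * nrm (Y k))
    + l ^+ 2 * rdot x (Y k) * u))).
  apply: ler_sum => k _; rewrite ler_wpM2l // cosh_chord_lin ?mulr_ge0 ?nrm_ge0 //.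
    rewrite !exprMn !sqr_nrm nrm2D; ring.
  rewrite normrM ger0_norm ?sqr_ge0 // expr2 mulrACA ler_wpM2l ?mulr_ge0 //.
  exact: rdot_le.
have -> : \sum_k p k * (cosh (l * nrm x) * (expR (l * nrm (Y k)) - l * nrm (Y k))
    + l ^+ 2 * rdot x (Y k) * u) = 
  cosh (l * nrm x) * (\sum_k p k * (expR (l * nrm (Y k)) - l * nrm (Y k))) +
   l ^+ 2 * u * (\sum_k p k * rdot x (Y k)).
  rewrite !mulr_sumr -big_split; apply: eq_bigr => k _ /=; ring.
rewrite rdot_sum (_ : rdot _ _ = 0) ?mulr0 ?addr0 //.
by rewrite /rdot big1 // => j _; rewrite EY /= !mulr0 addr0.
Qed.

End Hyperbolic2.

Section ProductExpectation.
Variables (R : realType) (I T : finType) (w : I -> T -> R).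
Implicit Types (o : {ffun I -> T}) (f g : {ffun I -> T} -> R) (P Q : {ffun I -> T} -> Prop).

Definition wt o : R := \prod_i w i (o i).
Definition Ex f : R := \sum_o wt o * f o.
Definition Pr P : R := Ex (fun o => `[< P o >]%:R).
Definition upd o i a : {ffun I -> T} := [ffun k => if k == i then a else o k].

Hypothesis w0 : forall i a, 0 <= w i a.
Hypothesis w1 : forall i, \sum_a w i a = 1.

Lemma wt_ge0 o : 0 <= wt o.
Proof. exact: prodr_ge0. Qed.

Lemma eq_Ex f g : f =1 g -> Ex f = Ex g.
Proof. by move=> e; apply: eq_bigr => o _; rewrite e. Qed.

Lemma ler_Ex f g : (forall o, f o <= g o) -> Ex f <= Ex g.
Proof. by move=> h; apply: ler_sum => o _; rewrite ler_wpM2l ?wt_ge0. Qed.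

Lemma ExD f g : Ex (fun o => f o + g o) = Ex f + Ex g.
Proof. by rewrite /Ex -big_split; apply: eq_bigr => o _; rewrite mulrDr. Qed.

Lemma ExZ (c : R) f : Ex (fun o => c * f o) = c * Ex f.
Proof. by rewrite /Ex mulr_sumr; apply: eq_bigr => o _; rewrite mulrCA. Qed.

Lemma Ex_sum (K : finType) (f : K -> {ffun I -> T} -> R) :
  Ex (fun o => \sum_k f k o) = \sum_k Ex (f k).
Proof. by rewrite /Ex exchange_big; apply: eq_bigr => o _; rewrite mulr_sumr. Qed.

Lemma Ex_prod (g : I -> T -> R) :
  Ex (fun o => \prod_i g i (o i)) = \prod_i \sum_a w i a * g i a.
Proof. by rewrite bigA_distr_bigA; apply: eq_bigr => o _; rewrite -big_split. Qed.

Lemma Ex_cst (c : R) : Ex (fun=> c) = c.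
Proof.
rewrite /Ex -mulr_suml (_ : \sum_o wt o = 1) ?mul1r //.
by rewrite /wt -(bigA_distr_bigA w) big1.
Qed.

Lemma wt_upd o i a : wt (upd o i a) * w i (o i) = wt o * w i a.
Proof.
rewrite /wt (bigD1 i) //= [in RHS](bigD1 i) //= ffunE eqxx mulrAC [RHS]mulrAC.
rewrite [w i (o i) * _]mulrC; congr (_ * _).
by apply: eq_bigr => k /negbTE ki; rewrite ffunE ki.
Qed.

Lemma Ex_resample i f : Ex f = Ex (fun o => \sum_a w i a * f (upd o i a)).
Proof.
(* Exchanging the value at [i] with the fresh draw is an involution on pairs; by [wt_upd] it
   preserves their joint weight. *)
pose h (p : {ffun I -> T} * T) := (upd p.1 i p.2, p.1 i).
have hK : involutive h.
  move=> [o a]; rewrite /h /= ffunE eqxx; congr pair; apply/ffunP => k.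
  by rewrite !ffunE; case: eqP => [->|].
rewrite /Ex; under [RHS]eq_bigr do rewrite mulr_sumr.
rewrite pair_bigA /= (reindex_inj (inv_inj hK)) /=.
transitivity (\sum_(p : {ffun I -> T} * T) wt p.1 * f p.1 * w i p.2).
  rewrite -(pair_bigA _ (fun o a => wt o * f o * w i a)) /=.
  by apply: eq_bigr => o _; rewrite -mulr_sumr w1 mulr1.
apply: eq_bigr => -[o a] _ /=; rewrite mulrA wt_upd.
have -> : upd (upd o i a) i (o i) = o.
  by apply/ffunP => k; rewrite !ffunE; case: eqP => [->|].
by rewrite mulrAC.
Qed.

Lemma Pr_le1 P : Pr P <= 1.
Proof. by rewrite -(Ex_cst 1); apply: ler_Ex => o; rewrite lern1 leq_b1. Qed.

Lemma ler_Pr P Q : (forall o, P o -> Q o) -> Pr P <= Pr Q.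
Proof.
move=> h; apply: ler_Ex => o; rewrite ler_nat.
by case: (asboolP (P o)) => // p; rewrite asboolT //; exact: h.
Qed.

Lemma Pr_or P Q : Pr (fun o => P o \/ Q o) <= Pr P + Pr Q.
Proof.
rewrite /Pr -ExD; apply: ler_Ex => o; rewrite asbool_or -natrD ler_nat.
by case: `[< _ >]; case: `[< _ >].
Qed.

Lemma Pr_not P : Pr (fun o => ~ P o) = 1 - Pr P.
Proof.
apply/eqP; rewrite -subr_eq opprK -ExD -[X in _ == X](Ex_cst 1); apply/eqP.
by apply: eq_Ex => o; rewrite asbool_neg; case: `[< _ >] => /=; rewrite ?add0r ?addr0.
Qed.

Lemma Pr_false P : (forall o, ~ P o) -> Pr P = 0.
Proof. by move=> h; rewrite /Pr /Ex big1 // => o _; rewrite asboolF ?mulr0. Qed.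

Lemma Pr_exists (K : finType) (P : K -> {ffun I -> T} -> Prop) :
  Pr (fun o => exists k, P k o) <= \sum_k Pr (P k).
Proof.
rewrite /Pr -Ex_sum; apply: ler_Ex => o; case: asboolP => [[k Pk]|_].
  by rewrite (bigD1 k) //= asboolT // lerDl sumr_ge0.
by rewrite sumr_ge0.
Qed.

Lemma Pr_markov P f (c : R) : 0 < c -> (forall o, 0 <= f o) -> 
  (forall o, P o -> c <= f o) -> Pr P <= Ex f / c.
Proof.
move=> c0 f0 Pf; rewrite mulrC -ExZ; apply: ler_Ex => o.
case: asboolP => [/Pf h|_]; first by rewrite mulrC ler_pdivlMr // mul1r.
by rewrite mulr_ge0 // invr_ge0 ltW.
Qed.

Section VectorSum.
Variables (J : finType) (Y : I -> T -> J -> R[i]) (l : R).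
Hypothesis l0 : 0 <= l.
Hypothesis Y0 : forall i j, \sum_a (w i a)%:C%C * Y i a j = 0.

Lemma Ex_cosh_sum (r : seq I) : uniq r ->
  Ex (fun o => cosh (l * nrm (fun j => \sum_(i <- r) Y i (o i) j))) <=
  \prod_(i <- r) \sum_a w i a * (expR (l * nrm (Y i a)) - l * nrm (Y i a)).
Proof.
have phi0 i : 0 <= \sum_a w i a * (expR (l * nrm (Y i a)) - l * nrm (Y i a)).
  apply: sumr_ge0 => a _; rewrite mulr_ge0 // subr_ge0.
  by rewrite (le_trans _ (expR_ge1Dx _)) // lerDr.
elim: r => [_|i r IH /= /andP[ir ur]].
  rewrite big_nil -[leRHS]Ex_cst; apply: ler_Ex => o.
  rewrite (_ : nrm _ = 0) ?mulr0 ?cosh0 //; apply/eqP; rewrite sqrtr_eq0.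
  rewrite /nrm2 big1 // => j _; by rewrite big_nil ComplexField.Normc.normc0 expr0n.
rewrite (Ex_resample i) big_cons; apply: (le_trans _ (ler_wpM2l (phi0 i) (IH ur))).
rewrite -ExZ; apply: ler_Ex => o; rewrite mulrC.
apply: le_trans (pinelis_step _ l0 (w0 i) (Y0 i)).
apply: ler_sum => a _; rewrite ler_wpM2l // le_eqVlt; apply/orP; left; apply/eqP.
congr (cosh (_ * _)); apply: eq_nrm => j; rewrite big_cons ffunE eqxx addrC; congr (_ + _).
rewrite big_seq [RHS]big_seq; apply: eq_bigr => k kr; rewrite ffunE.
by case: eqP kr ir => // -> ->.
Qed.

(* Bernstein's inequality for vectors, after Pinelis. *)
Lemma Pr_nrm_sum (V t : R) : (forall i a, l * nrm (Y i a) <= 3^-1) ->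
  \sum_i \sum_a w i a * nrm2 (Y i a) <= V ->
  Pr (fun o => t <= nrm (fun j => \sum_i Y i (o i) j)) <= 2 * expR (l ^+ 2 * V - l * t).
Proof.
move=> lY YV.
apply: le_trans (@Pr_markov _ (fun o => 2 * cosh (l * nrm (fun j =>
  \sum_i Y i (o i) j))) (expR (l * t)) _ _ _) _.
- exact: expR_gt0.
- by move=> o; rewrite mulr_ge0 ?cosh_ge0.
- move=> o h; rewrite (le_trans _ (expR_le2cosh _)) // ler_expR ler_wpM2l //.
rewrite ExZ expRB mulrA ler_wpM2r ?invr_ge0 ?expR_ge0 // ler_wpM2l //.
apply: le_trans (Ex_cosh_sum (index_enum_uniq I)) _.
apply: (@le_trans _ _ (\prod_i expR (l ^+ 2 * \sum_a w i a * nrm2 (Y i a)))); last first.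
  by rewrite -expR_sum ler_expR -mulr_sumr ler_wpM2l ?sqr_ge0.
apply: ler_prod => i _; rewrite sumr_ge0 => /= [|a _]; last first.
  by rewrite mulr_ge0 // subr_ge0 (le_trans _ (expR_ge1Dx _)) // lerDr.
apply: le_trans (expR_ge1Dx _).
apply: (@le_trans _ _ (\sum_a w i a * (1 + l ^+ 2 * nrm2 (Y i a)))).
  apply: ler_sum => a _; rewrite ler_wpM2l // -sqr_nrm -exprMn lerBlDr.
  by rewrite addrAC expR_le_quad // mulr_ge0 ?nrm_ge0 // lY.
under [leLHS]eq_bigr do rewrite mulrDr mulr1 mulrCA.
by rewrite big_split /= w1 -mulr_sumr.
Qed.

End VectorSum.
End ProductExpectation.

(** * Bernoulli subsets versus uniform subsets *)

Section BernoulliSets.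
Variables (R : realType) (N : nat).
Implicit Types (x y c : R) (o : {ffun 'I_N -> bool}) (S B : {set 'I_N}) (E : {set 'I_N} -> Prop).

(* Each index is excluded with probability [x], independently, so that the
   union of independent [bern x] and [bern y] sets is a [bern (x * y)] set. *)
Definition bern x (k : 'I_N) (b : bool) : R := if b then 1 - x else x.
Definition bset o : {set 'I_N} := [set k | o k].
Definition PB x E : R := Pr (bern x) (fun o => E (bset o)).

Lemma bern_ge0 x : 0 <= x <= 1 -> forall k b, 0 <= bern x k b.
Proof. by move=> /andP[x0 x1] k [] //=; rewrite subr_ge0. Qed.

Lemma bern_sum1 x k : \sum_b bern x k b = 1.
Proof. by rewrite big_bool /= subrK. Qed.

Lemma Ex_bern_union x y (f : {set 'I_N} -> R) :
  Ex (bern (x * y)) (fun o => f (bset o)) =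
  Ex (bern x) (fun o => Ex (bern y) (fun o' => f (bset o :|: bset o'))).
Proof.
(* The joint weight of two independent selectors, restricted to [b] being their disjunction. Its sum
   over [b1] and [b2] is the weight for [x * y]; its product over [k] vanishes unless [o] is the
   union. *)
pose F k b b1 b2 := bern x k b1 * (bern y k b2 * (b == b1 || b2)%:R).
transitivity (\sum_o f (bset o) * \sum_(o1 : {ffun 'I_N -> bool}) \sum_(o2 : {ffun 'I_N ->
  bool}) \prod_k F k (o k) (o1 k) (o2 k)).
  apply: eq_bigr => o _; rewrite mulrC; congr (_ * _).
  under [RHS]eq_bigr => o1 _ do rewrite -(bigA_distr_bigA (fun k b2 => F k (o k) (o1 k) b2)).
  rewrite -(bigA_distr_bigA (fun k b1 => \sum_b2 F k (o k) b1 b2)); apply: eq_bigr => k _.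
  by rewrite !big_bool /F /=; case: (o k) => /=; ring.
under eq_bigr do rewrite mulr_sumr; rewrite exchange_big; apply: eq_bigr => o1 _ /=.
under eq_bigr do rewrite mulr_sumr; rewrite exchange_big mulr_sumr; apply: eq_bigr => o2 _ /=.
rewrite (bigD1 [ffun k => o1 k || o2 k]) //= [X in _ + X]big1 ?addr0 => [|o oN].
  rewrite [X in _ * X](_ : _ = wt (bern x) o1 * wt (bern y) o2); last first.
    by rewrite /wt -big_split; apply: eq_bigr => k _; rewrite /F ffunE eqxx mulr1.
  rewrite mulrC -mulrA; congr (_ * (_ * f _)).
  by apply/setP => k; rewrite !inE ffunE.
suff -> : \prod_k F k (o k) (o1 k) (o2 k) = 0 by rewrite mulr0.
have /forallPn[k /negbTE ok] : ~~ [forall k, o k == o1 k || o2 k].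
  apply: contraNN oN => /forallP h; apply/eqP/ffunP => k; rewrite ffunE; exact/eqP.
by rewrite (bigD1 k) //= /F ok !mulr0 mul0r.
Qed.

Lemma PB_le1 x E : 0 <= x <= 1 -> PB x E <= 1.
Proof. by move=> hx; apply: Pr_le1 => *; [exact: bern_ge0|exact: bern_sum1]. Qed.

Lemma ler_PB x E E' : 0 <= x <= 1 -> (forall S, E S -> E' S) -> PB x E <= PB x E'.
Proof. by move=> hx h; apply: ler_Pr => [|o]; [exact: bern_ge0|exact: h]. Qed.

Lemma PB_union x y E A c1 c2 : 0 <= x <= 1 -> 0 <= c1 -> 0 <= c2 ->
  (forall S, A S -> PB y (fun S' => E (S :|: S')) <= c1) ->
  (forall S, ~ A S -> PB y (fun S' => E (S :|: S')) <= c2) ->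
  PB (x * y) E <= c1 * PB x A + c2.
Proof.
move=> hx c10 c20 h1 h2; rewrite {1}/PB /Pr (Ex_bern_union _ _ (fun S => `[< E S >]%:R)).
rewrite -(Ex_cst (bern_sum1 x) c2) -ExZ -ExD; apply: ler_Ex => [|o]; first exact: bern_ge0.
case: (asboolP (A (bset o))) => [/h1|/h2]; rewrite ?mulr1 ?mulr0 ?add0r // => h.
by rewrite (le_trans h) // lerDl.
Qed.

Lemma Ex_bern_exp x (a : R) B :
  Ex (bern x) (fun o => a ^+ #|bset o :&: B|) = (x + (1 - x) * a) ^+ #|B|.
Proof.
transitivity (Ex (bern x) (fun o => \prod_k (if o k && (k \in B) then a else 1))).
  apply: eq_Ex => o; rewrite -big_mkcond /= prodr_const; congr (_ ^+ _).
  by apply: eq_card => k; rewrite !inE.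
rewrite (Ex_prod (bern x) (fun k b => if b && (k \in B) then a else 1)).
transitivity (\prod_(k : 'I_N) if k \in B then x + (1 - x) * a else 1).
  by apply: eq_bigr => k _; rewrite big_bool /=; case: ifP => _; ring.
by rewrite -big_mkcond prodr_const.
Qed.

(** Chernoff with base 2: the mean of [2 ^ #|S|] is at most [exp (m / 4)], and
    [2 ^ m >= exp (m / 2)]. *)
Lemma PB_card_gt x m : 0 <= x <= 1 -> N%:R * (1 - x) <= m%:R / 4 ->
  PB x (fun S : {set 'I_N} => (m < #|S|)%N) <= expR (- (m%:R / 4)).
Proof.
move=> hx Nx; have b0 := bern_ge0 hx.
rewrite /PB; apply: le_trans (Pr_markov b0 (f := fun o => 2 ^+ #|bset o :&: setT|) (c :=
  2 ^+ m) _ _ _) _.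
- by rewrite exprn_gt0.
- by move=> o; rewrite exprn_ge0.
- by move=> o h; rewrite setIT ler_eXn2l ?ltr1n // ltnW.
rewrite Ex_bern_exp cardsT card_ord ler_pdivrMr ?exprn_gt0 //.
apply: (@le_trans _ _ (expR (1 - x) ^+ N)).
  rewrite lerXn2r ?nnegrE ?expR_ge0 //; first by case/andP: hx; lra.
  by rewrite (le_trans _ (expR_ge1Dx _)) //; lra.
rewrite -expRM_natl; apply: (@le_trans _ _ (expR (- (m%:R / 4)) * expR (m%:R * 2^-1))).
  rewrite -expRD ler_expR; lra.
rewrite ler_wpM2l ?expR_ge0 // expRM_natl lerXn2r ?nnegrE ?expR_ge0 //.
exact: expR_half_le2.
Qed.

(** Chernoff with base [exp (-1) <= 1 / 2]. The slack [c] is additive, so the tail is the same for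
    every [B], small or large, as a union bound over many sets requires. *)
Lemma PB_card_lower x B c : 0 <= x <= 1 ->
  PB x (fun S => #|S :&: B|%:R + c <= (1 - x) * #|B|%:R / 2) <= expR (- c).
Proof.
move=> hx; have b0 := bern_ge0 hx; pose a : R := expR (-1).
pose d : R := (1 - x) * #|B|%:R / 2 - c.
have aE n : a ^+ n = expR (- n%:R) by rewrite -expRM_natl mulrN1.
rewrite /PB; apply: le_trans (Pr_markov b0 (f := fun o => a ^+ #|bset o :&: B|) (c :=
  expR (- d)) _ _ _) _.
- exact: expR_gt0.
- by move=> o; rewrite exprn_ge0 // expR_ge0.
- by move=> o h; rewrite aE ler_expR lerN2 /d; lra.
rewrite Ex_bern_exp ler_pdivrMr ?expR_gt0 // -expRD.
have a2 : a <= 2^-1 := expRN1_le_half R.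
have /andP[x0 x1] := hx.
apply: (@le_trans _ _ (expR (- (1 - x) / 2) ^+ #|B|)).
  rewrite lerXn2r ?nnegrE ?expR_ge0 //.
    by rewrite addr_ge0 // mulr_ge0 ?expR_ge0 // subr_ge0.
  by rewrite (le_trans _ (expR_ge1Dx _)) //; nra.
rewrite -expRM_natl ler_expR /d; lra.
Qed.

Definition levelset (j : nat) E : {set {set 'I_N}} := [set S : {set 'I_N} | (#|S| == j) && `[< E S >]].

(** The local LYM inequality: pairs of a [j]-set in [E] and a point outside it inject into pairs of
    a [j.+1]-set in [E] and a point inside it. So the density of an up-set among the [j]-sets is
    nondecreasing in [j], which is [levelset_homo]. *)
Lemma levelset_local (j : nat) E : (forall S S' : {set 'I_N}, S \subset S' -> E S -> E S') ->
  (#|levelset j E| * (N - j) <= #|levelset j.+1 E| * j.+1)%N.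
Proof.
move=> Emon.
pose P := [set p : {set 'I_N} * 'I_N | (p.1 \in levelset j E) && (p.2 \notin p.1)].
pose Q := [set p : {set 'I_N} * 'I_N | (p.1 \in levelset j.+1 E) && (p.2 \in p.1)].
have cardP : #|P| = (#|levelset j E| * (N - j))%N.
  rewrite -sum1_card (eq_bigl (fun p : {set 'I_N} * 'I_N =>
    (p.1 \in levelset j E) && (p.2 \notin p.1))) => [|p]; last by rewrite inE.
  rewrite -(pair_big_dep (fun S : {set 'I_N} => S \in levelset j E) (fun (S : {set 'I_N}) k =>
    k \notin S) (fun _ _ => 1%N)) /=.
  rewrite -sum_nat_const; apply: eq_bigr => S; rewrite inE => /andP[/eqP cS _].
  rewrite (eq_bigl (fun k => k \in ~: S)) => [|k]; last by rewrite !inE.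
  by rewrite sum1_card cardsCs setCK card_ord cS.
have cardQ : #|Q| = (#|levelset j.+1 E| * j.+1)%N.
  rewrite -sum1_card (eq_bigl (fun p : {set 'I_N} * 'I_N =>
    (p.1 \in levelset j.+1 E) && (p.2 \in p.1))) => [|p]; last by rewrite inE.
  rewrite -(pair_big_dep (fun S : {set 'I_N} => S \in levelset j.+1 E) (fun (S : {set 'I_N}) k =>
    k \in S) (fun _ _ => 1%N)) /=.
  rewrite -sum_nat_const; apply: eq_bigr => S; rewrite inE => /andP[/eqP cS _].
  by rewrite sum1_card cS.
rewrite -cardP -cardQ -(card_in_imset (f := fun p : {set 'I_N} * 'I_N => (p.2 |: p.1, p.2))).
  apply/subset_leq_card/subsetP => _ /imsetP[[S k] /[!inE]/= /andP[/andP[/eqP cS ES] kS] ->] /=.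
  rewrite !inE eqxx /= andbT cardsU1 kS cS add1n eqxx /=.
  by apply/asboolP; move/asboolP: ES; apply: Emon; exact: subsetUr.
move=> [S k] [S' k'] /[!inE]/= /andP[_ kS] /andP[_ kS'] [e1 e2]; subst k'.
congr pair; apply/setP => i; move/setP/(_ i): e1; rewrite !inE.
by case: eqP => [-> _|//]; rewrite (negbTE kS) (negbTE kS').
Qed.

Lemma levelset_homo (j m : nat) E : (forall S S' : {set 'I_N}, S \subset S' -> E S -> E S') ->
  (j <= m <= N)%N -> (#|levelset j E| * 'C(N, m) <= #|levelset m E| * 'C(N, j))%N.
Proof.
move=> Emon /andP[jm mN]; elim: m jm mN => [|m IH]; first by rewrite leqn0 => /eqP->.
rewrite leq_eqVlt => /predU1P[->//|]; rewrite ltnS => jm mN.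
have {}IH := IH jm (ltnW mN).
have h := levelset_local m Emon.
have bE := mul_bin_left N m.
have Cp : (0 < 'C(N, m))%N by rewrite bin_gt0 ltnW.
rewrite -(leq_pmul2r (m := m.+1)) // -(leq_pmul2r Cp).
have -> : (#|levelset j E| * 'C(N, m.+1) * m.+1 * 'C(N, m) = 
  (#|levelset j E| * 'C(N, m)) * (m.+1 * 'C(N, m.+1)))%N by ring.
rewrite bE; apply: leq_trans (leq_mul IH (leqnn _)) _.
have -> : (#|levelset m E| * 'C(N, j) * ((N - m) * 'C(N, m)) = 
  (#|levelset m E| * (N - m)) * ('C(N, j) * 'C(N, m)))%N by ring.
apply: leq_trans (leq_mul h (leqnn _)) _; apply: eq_leq; ring.
Qed.

Lemma wt_bern x o : wt (bern x) o = x ^+ (N - #|bset o|) * (1 - x) ^+ #|bset o|.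
Proof.
rewrite /wt (bigID (fun k => k \in bset o)) /= mulrC; congr (_ * _).
  transitivity (\prod_(k in ~: bset o) x).
    by apply: eq_big => k; rewrite !inE // => /negbTE->.
  by rewrite prodr_const cardsCs setCK card_ord.
transitivity (\prod_(k in bset o) (1 - x)); last by rewrite prodr_const.
by apply: eq_bigr => k; rewrite inE /bern => ->.
Qed.

Lemma Ex_bset x (f : {set 'I_N} -> R) : Ex (bern x) (fun o => f (bset o)) =
  \sum_(S : {set 'I_N}) x ^+ (N - #|S|) * (1 - x) ^+ #|S| * f S.
Proof.
rewrite (reindex bset) /=; first by apply: eq_bigr => o _; rewrite wt_bern.
exists (fun S : {set 'I_N} => [ffun k => k \in S]) => [o _|S _].
  by apply/ffunP => k; rewrite ffunE inE.
by apply/setP => k; rewrite inE ffunE.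
Qed.

Lemma Ex_levelset x (m : nat) E :
  Ex (bern x) (fun o => ((#|bset o| <= m)%N && `[< E (bset o) >])%:R) =
  \sum_(j < m.+1) x ^+ (N - j) * (1 - x) ^+ j * #|levelset j E|%:R.
Proof.
rewrite (Ex_bset x (fun S : {set 'I_N} => ((#|S| <= m)%N && `[< E S >])%:R)).
under eq_bigr => S _ do rewrite mulr_natr mulrb.
rewrite -big_mkcond /= (partition_big (fun S : {set 'I_N} => inord #|S| : 'I_m.+1) predT) //=.
apply: eq_bigr => j _; rewrite mulr_natr -sumr_const; apply: eq_big =>
  [S|S /andP[/andP[Sm _] /eqP<-]].
  rewrite inE -andbA andbCA [RHS]andbC; congr andb.
  apply/andP/eqP => [[Sm /eqP<-]|Sj]; first by rewrite inordK // ltnS.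
  split; first by rewrite Sj -ltnS.
  by apply/eqP/val_inj; rewrite Sj /= inordK.
by rewrite inordK.
Qed.

(** Conditioned on its size [j], a Bernoulli set is uniform among the [j]-sets. For [j <= m] an
    up-set is then no likelier than under the uniform [m]-set. *)
Lemma unif_prob_ge x (m : nat) E : 0 <= x <= 1 -> (m <= N)%N ->
  (forall S S' : {set 'I_N}, S \subset S' -> E S -> E S') ->
  1 - PB x (fun S => ~ E S) - PB x (fun S : {set 'I_N} => (m < #|S|)%N) <= unif_prob R m E.
Proof.
move=> hx mN Emon; have b0 := bern_ge0 hx; have b1 := bern_sum1 x.
have -> : 1 - PB x (fun S => ~ E S) = PB x E.
  by rewrite /PB (Pr_not b1 (fun o => E (bset o))) subKr.
apply: (@le_trans _ _ (Ex (bern x) (fun o => ((#|bset o| <= m)%N && `[< E (bset o) >])%:R))).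
  rewrite lerBlDr -ExD; apply: ler_Ex => // o; rewrite -natrD ler_nat.
  have -> : `[< (m < #|bset o|)%N >] = (m < #|bset o|)%N by apply/asboolP/idP.
  by case: `[< _ >]; case: leqP.
have Cm : 0 < 'C(N, m)%:R :> R by rewrite ltr0n bin_gt0.
have -> : unif_prob R m E = #|levelset m E|%:R / 'C(N, m)%:R.
  by rewrite /unif_prob card_draws card_ord.
have g0 (j : nat) : 0 <= x ^+ (N - j) * (1 - x) ^+ j.
  by case/andP: hx => ? ?; rewrite mulr_ge0 ?exprn_ge0 ?subr_ge0.
rewrite Ex_levelset; apply: (@le_trans _ _ (#|levelset m E|%:R / 'C(N, m)%:R *
    \sum_(j < m.+1) x ^+ (N - j) * (1 - x) ^+ j * #|levelset j (fun=> True)|%:R)).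
  rewrite mulr_sumr; apply: ler_sum => j _; rewrite mulrCA ler_wpM2l // mulrAC ler_pdivlMr //.
  have -> : #|levelset j (fun=> True)| = 'C(N, j).
    rewrite -[in RHS](card_ord N) -card_draws; apply: eq_card => S.
    by rewrite !inE asboolT // andbT.
  rewrite -!natrM ler_nat; apply: levelset_homo => //; by rewrite -ltnS ltn_ord.
rewrite -Ex_levelset ler_piMr ?divr_ge0 //.
rewrite -[leRHS](Ex_cst b1 1); apply: ler_Ex => // o; by rewrite lern1 leq_b1.
Qed.

Lemma ler_unif_prob (m : nat) E E' : (forall S, E S -> E' S) -> unif_prob R m E <= unif_prob R m E'.
Proof.
move=> h; rewrite /unif_prob ler_wpM2r ?invr_ge0 // ler_nat subset_leq_card //.
apply/subsetP => S; rewrite !inE => /andP[-> /asboolP/h ES].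
by apply/asboolP.
Qed.

End BernoulliSets.

(** * Golfing *)

Section Golfing.
Variables (R : realType) (N : nat).
Implicit Types (x t l rho c : R) (q w : 'I_N -> R[i]) (S : {set 'I_N}) (k : 'I_N).

Lemma normc_sqr_C (z : R[i]) : (normc z ^+ 2)%:C%C = z * z^*%C.
Proof.
case: z => a b; rewrite normc_sqr /=; apply/eqP; rewrite eq_complex /=.
by apply/andP; split; apply/eqP; ring.
Qed.

Lemma PB_nrm_sum (J : finType) (z : 'I_N -> J -> R[i]) x l t (V : R) :
  0 <= x <= 1 -> 0 <= l -> (forall k, l * nrm (z k) <= 3^-1) ->
  (1 - x) * \sum_k nrm2 (z k) <= V ->
  PB x (fun S => t <= nrm (fun j => \sum_(k in S) z k j - (1 - x)%:C%C * \sum_k z k j)) <=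
  2 * expR (l ^+ 2 * V - l * t).
Proof.
move=> hx l0 hz hV; have /andP[x0 x1] := hx.
(* The centred selector: at most 1 in modulus, with variance [x * (1 - x)], of which only the upper
   bound [1 - x] is kept. *)
pose cf (b : bool) : R := b%:R - (1 - x).
pose Y (k : 'I_N) (b : bool) (j : J) := (cf b)%:C%C * z k j.
have YE k b : nrm (Y k b) = `|cf b| * nrm (z k) by rewrite /Y nrmZ normc_real.
have cf1 b : `|cf b| <= 1 by case: b; rewrite /cf ler_norml /=; apply/andP; split; lra.
apply: (@le_trans _ _ (Pr (bern x) (fun o => t <= nrm (fun j => \sum_k Y k (o k) j)))).
- apply: ler_Pr => [|o]; first exact: bern_ge0.
  suff -> : nrm (fun j => \sum_(k in bset o) z k j - (1 - x)%:C%C * \sum_k z k j) =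
            nrm (fun j => \sum_k Y k (o k) j) by [].
  apply: eq_nrm => j; rewrite big_mkcond mulr_sumr -sumrB; apply: eq_bigr => k _.
  by rewrite inE /Y /cf; case: (o k); rewrite rmorphB /=; ring.
apply: (Pr_nrm_sum (bern_ge0 hx) (bern_sum1 x)) => //.
- move=> k j; transitivity ((((1 - x) * cf true + x * cf false)%:C)%C * z k j).
    by rewrite big_bool /Y /=; ring.
  have -> : (1 - x) * cf true + x * cf false = 0 by rewrite /cf /=; ring.
  by rewrite rmorph0 mul0r.
- move=> k b; rewrite YE; apply: le_trans (hz k); rewrite ler_wpM2l //.
  by rewrite ler_piMl ?nrm_ge0.
- apply: le_trans hV; rewrite mulr_sumr; apply: ler_sum => k _.
  rewrite big_bool -!sqr_nrm !YE !exprMn !real_normK ?num_real // /bern /cf /=.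
  rewrite -subr_ge0 (_ : _ - _ = (1 - x) ^+ 2 * nrm (z k) ^+ 2); last by ring.
  by rewrite mulr_ge0 ?sqr_ge0.
Qed.

Variable F : 'I_N -> 'I_N -> R[i].
Hypothesis F1 : forall k j, normc (F k j) = 1.
Hypothesis Forth : forall i j, \sum_k (F k i)^*%C * F k j = (i == j)%:R * N%:R.

Definition fwd q k : R[i] := \sum_j F k j * q j.
Definition adj w j : R[i] := \sum_k (F k j)^*%C * w k.

Lemma adj_fwd q j : adj (fwd q) j = N%:R * q j.
Proof.
rewrite /adj /fwd; under eq_bigr do rewrite mulr_sumr.
rewrite exchange_big /= (bigD1 j) //= [X in _ + X]big1 => [|i ij]; last first.
  by under eq_bigr do rewrite mulrA; rewrite -mulr_suml Forth eq_sym (negbTE ij) !mul0r.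
by under eq_bigr do rewrite mulrA; rewrite -mulr_suml Forth eqxx mul1r addr0.
Qed.

Lemma adj_dot q w : \sum_k fwd q k * (w k)^*%C = \sum_j q j * (adj w j)^*%C.
Proof.
rewrite /fwd /adj; under eq_bigr do rewrite mulr_suml.
rewrite exchange_big; apply: eq_bigr => j _ /=.
rewrite rmorph_sum mulr_sumr; apply: eq_bigr => k _ /=.
by rewrite rmorphM /= conjcK; ring.
Qed.

Lemma parseval q : nrm2 (fwd q) = N%:R * nrm2 q.
Proof.
apply: (@complexI R); rewrite rmorphM rmorph_nat /nrm2 !rmorph_sum mulr_sumr /=.
under eq_bigr do rewrite normc_sqr_C.
rewrite adj_dot; apply: eq_bigr => j _; rewrite adj_fwd normc_sqr_C rmorphM /= conjc_nat; ring.
Qed.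

Section Stage.
Variables (Delta : {set 'I_N}) (q : 'I_N -> R[i]) (rho x : R).
Local Notation s := (#|Delta|%:R : R).
Hypothesis qD : forall j, j \notin Delta -> q j = 0.
Hypothesis rho0 : 0 < rho.
Hypothesis q_rho : nrm q <= rho.
Hypothesis x01 : 0 <= x < 1.
Hypothesis s0 : (0 < #|Delta|)%N.
Hypothesis N0 : (0 < N)%N.
Let n : R := (1 - x) * N%:R.

Let n0 : 0 < n.
Proof. by case/andP: x01 => _ x1; rewrite mulr_gt0 ?subr_gt0 ?ltr0n. Qed.

Let sp : 0 < s. Proof. by rewrite ltr0n. Qed.

Lemma fwd_bound k : normc (fwd q k) <= Num.sqrt s * rho.
Proof.
have -> : fwd q k = \sum_j (if j \in Delta then F k j else 0) * q j.
  by apply: eq_bigr => j _; case: ifP => // /negbT/qD->; rewrite !mulr0.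
apply: le_trans (normc_dot _ _) _; rewrite ler_pM ?nrm_ge0 //.
rewrite ler_wsqrtr // /nrm2 -sum1_card natr_sum [leRHS]big_mkcond ler_sum // => j _.
by case: ifP => _; rewrite ?F1 ?expr1n // ComplexField.Normc.normc0 expr0n.
Qed.

(** Division by the mean sample size [n] makes [adj] of this vector an unbiased estimate of [q]; see
    [mean_block]. *)
Definition block_weight S k : R[i] := if k \in S then (n^-1)%:C%C * fwd q k else 0.

Lemma adj_block S j : adj (block_weight S) j = \sum_(k in S) (F k j)^*%C * ((n^-1)%:C%C * fwd q k).
Proof. by rewrite /adj [RHS]big_mkcond; apply: eq_bigr => k _; rewrite /block_weight; case: ifP;
  rewrite ?mulr0. Qed.

Let mean_block j : (1 - x)%:C%C * \sum_k (F k j)^*%C * ((n^-1)%:C%C * fwd q k) = q j.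
Proof.
rewrite (_ : \sum_k _ = (n^-1)%:C%C * (N%:R * q j)); last first.
  by rewrite -adj_fwd mulr_sumr; apply: eq_bigr => k _; ring.
transitivity (((1 - x) * n^-1 * N%:R)%:C%C * q j); first by ring.
by rewrite mulrAC mulfV ?gt_eqF // rmorph1 mul1r.
Qed.

Definition residual w j : R[i] := if j \in Delta then q j - adj w j else 0.

Lemma block_residual :
  PB x (fun S => rho / 4 <= nrm (residual (block_weight S))) <= 2 * expR (- (n / (64 * s))).
Proof.
have /andP[x0 x1] := x01; have hx : 0 <= x <= 1 by rewrite x0 ltW.
pose z k j := if j \in Delta then (F k j)^*%C * ((n^-1)%:C%C * fwd q k) else 0.
have z2 k : nrm2 (z k) = s * (n^-2 * normc (fwd q k) ^+ 2).
  rewrite /nrm2 mulr_natl -sumr_const [RHS]big_mkcond; apply: eq_bigr => j _.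
  rewrite /z; case: ifP => _; last by rewrite ComplexField.Normc.normc0 expr0n.
  rewrite !ComplexField.Normc.normcM normc_conj F1 normc_real ger0_norm ?invr_ge0 ?(ltW n0) //.
  by rewrite mul1r exprMn exprVn.
(* The minimiser of [l^2 V - l rho / 4] for [V = s rho^2 / n], the variance given by Parseval. A
   summand has norm at most [s rho / n], and [l] times this is [1 / 8]. *)
pose l := n / (8 * s * rho).
have lp : 0 < l by rewrite divr_gt0 // mulr_gt0 // mulr_gt0.
have -> : - (n / (64 * s)) = l ^+ 2 * (s * rho ^+ 2 / n) - l * (rho / 4).
  by rewrite /l; field; rewrite !gt_eqF.
apply: le_trans (@PB_nrm_sum _ z x l (rho / 4) _ hx _ _ _).
- apply: ler_PB => // S h; apply: le_trans h _.
  rewrite -[leRHS]nrmN le_eqVlt; apply/orP; left; apply/eqP.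
  apply: eq_nrm => j; rewrite /residual /z; case: ifP => _;
    last by rewrite !big1 // mulr0 subr0 oppr0.
  by rewrite adj_block mean_block opprB.
- exact: ltW.
- move=> k; apply: (@le_trans _ _ (l * (s * rho / n))).
    have srn : 0 <= s * rho / n by rewrite ltW // divr_gt0 // mulr_gt0.
    rewrite ler_wpM2l ?(ltW lp) // nrm_le // z2.
    have -> : (s * rho / n) ^+ 2 = s * (n^-2 * (s * rho ^+ 2)) by field; rewrite gt_eqF.
    rewrite ler_wpM2l ?(ltW sp) // ler_wpM2l ?invr_ge0 ?exprn_ge0 ?(ltW n0) //.
    rewrite -(sqr_sqrtr (ltW sp)) -exprMn.
    by rewrite lerXn2r ?nnegrE ?normc_ge0 ?fwd_bound // mulr_ge0 ?sqrtr_ge0 ?ltW.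
  by rewrite /l (_ : _ * _ = 8^-1); [lra | field; rewrite !gt_eqF].
under eq_bigr do rewrite z2; rewrite -!mulr_sumr -/(nrm2 (fwd q)) parseval.
rewrite [leLHS](_ : _ = (s / n) * nrm2 q); last first.
  by rewrite /n; field; rewrite !gt_eqF ?ltr0n // subr_gt0.
rewrite mulrAC ler_wpM2r ?invr_ge0 ?(ltW n0) // ler_wpM2l ?(ltW sp) //.
by rewrite -nrm_le ?(ltW rho0).
Qed.

(** A single entry has variance [rho^2 / n], less by the factor [s] than the whole residual on
    [Delta]. The parameters [l] and [t] stay free because the threshold off [Delta] follows another
    scale than [rho]. *)
Lemma block_off j l t : j \notin Delta -> 0 <= l -> l * (Num.sqrt s * rho / n) <= 3^-1 ->
  PB x (fun S => t <= normc (adj (block_weight S) j)) <= 2 * expR (l ^+ 2 * (rho ^+ 2 / n) - l * t).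
Proof.
move=> jD l0 hl; have /andP[x0 x1] := x01; have hx : 0 <= x <= 1 by rewrite x0 ltW.
pose z k (_ : unit) := (F k j)^*%C * ((n^-1)%:C%C * fwd q k).
have nrm1 (y : unit -> R[i]) : nrm y = normc (y tt).
  by rewrite /nrm /nrm2 (big_pred1 tt) => [|[]] //; rewrite sqrtr_sqr ger0_norm // normc_ge0.
have zE k : nrm (z k) = n^-1 * normc (fwd q k).
  rewrite nrm1 /z !ComplexField.Normc.normcM normc_conj F1 normc_real mul1r.
  by rewrite ger0_norm // invr_ge0 ltW.
apply: le_trans (@PB_nrm_sum _ z x l t _ hx l0 _ _).
- apply: ler_PB => // S; rewrite nrm1 /z mean_block qD // subr0 adj_block //.
- move=> k; apply: le_trans hl; rewrite ler_wpM2l // zE mulrC ler_wpM2r ?invr_ge0 ?(ltW n0) //.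
  exact: fwd_bound.
under eq_bigr do rewrite -sqr_nrm zE exprMn; rewrite -mulr_sumr -/(nrm2 (fwd q)) parseval.
rewrite [leLHS](_ : _ = nrm2 q / n); last first.
  by rewrite /n; field; rewrite !gt_eqF ?ltr0n // subr_gt0.
by rewrite ler_wpM2r ?invr_ge0 ?(ltW n0) // -nrm_le ?(ltW rho0).
Qed.

(** The squared norm of the weight is the pairing of [q] with its estimate, divided by [n]. The
    estimate is [q] minus the residual on [Delta], whence [1 + 1 / 4]. *)
Lemma block_weight_nrm S : nrm (residual (block_weight S)) <= rho / 4 ->
  nrm2 (block_weight S) <= 5 / 4 * rho ^+ 2 / n.
Proof.
move=> hres.
have wE : nrm2 (block_weight S) = n^-1 * rdot q (adj (block_weight S)).
  rewrite /nrm2 rdotE -adj_dot Re_sum mulr_sumr; apply: eq_bigr => k _.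
  rewrite normc_sqr /block_weight; case: ifP => _; last by rewrite conjc0 mulr0 /=; ring.
  by case: (fwd q k) => a b /=; ring.
have rE : rdot q (adj (block_weight S)) = nrm2 q - rdot q (residual (block_weight S)).
  rewrite /rdot /nrm2 -sumrB; apply: eq_bigr => j _; rewrite normc_sqr /residual.
  case: ifP => [_|/negbT/qD ->]; last by rewrite /=; ring.
  by case: (q j) => ? ?; case: (adj _ _) => ? ? /=; ring.
rewrite wE rE mulrC ler_wpM2r ?invr_ge0 ?(ltW n0) //.
have h1 : nrm2 q <= rho ^+ 2 by rewrite -nrm_le ?(ltW rho0).
have h2 : `|rdot q (residual (block_weight S))| <= rho * (rho / 4).
  by rewrite (le_trans (rdot_le _ _)) // ler_pM ?nrm_ge0.
move: h2; rewrite ler_norml => /andP[h2 _]; move: h1 h2; rewrite expr2.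
move: (nrm2 q) (rdot _ _) => a b; lra.
Qed.

End Stage.
End Golfing.

(** * Golfing recursion with repeated stages *)

Section Recursion.
Variables (R : realType) (N : nat) (F : 'I_N -> 'I_N -> R[i]).
Hypothesis F1 : forall k j, normc (F k j) = 1.
Hypothesis Forth : forall i j, \sum_k (F k i)^*%C * F k j = (i == j)%:R * N%:R.
Variables (Delta : {set 'I_N}) (m gam : R).
Local Notation s := (#|Delta|%:R : R).
Implicit Types (q w : 'I_N -> R[i]) (S : {set 'I_N}) (p d : nat) (T : R).

(* The bounds on [adj F w] and [w] are what the stages from [p] on may add up to. *)
Definition cert p q S := exists w,
  [/\ forall k, k \notin S -> w k = 0,
      nrm (residual F Delta q w) <= gam,
      forall j, j \notin Delta -> normc (adj F w j) <= 2^-1 ^+ p / 2 &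
      nrm w <= 26 * 2^-1 ^+ p * Num.sqrt (s / m)].

Lemma cert_mono p q S S' : S \subset S' -> cert p q S -> cert p q S'.
Proof.
move=> /subsetP sub [w [h1 h2 h3 h4]]; exists w; split => // k kS'.
by apply: h1; apply: contra kS'; exact: sub.
Qed.

Hypothesis s0 : (0 < #|Delta|)%N.
Hypothesis N0 : (0 < N)%N.
Hypothesis m0 : 0 < m.
Hypothesis gam0 : 0 < gam.

Let Np : 0 < N%:R :> R. Proof. by rewrite ltr0n. Qed.
Let sp : 0 < s. Proof. by rewrite ltr0n. Qed.

(** Exponential form, because exclusion probabilities multiply under unions, so that sampling times
    add. *)
Definition excl T : R := expR (- (T / N%:R)).
(** The geometric part pays for the [N] entries off [Delta]: the residual shrinks by 4 per stage
    while the allowance off [Delta] only halves, so half the time still gives the same tail. The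
    constant part keeps the contraction on [Delta] likely however small the first part is. *)
Definition stime p : R := m / 64 * 2^-1 ^+ p + 512 * s.
Fixpoint budget p d : R := if d is d'.+1 then 2 * stime p + budget p.+1 d' else 0.

Lemma half_exp_gt0 p : 0 < (2^-1 : R) ^+ p.
Proof. by rewrite exprn_gt0 // invr_gt0. Qed.

Lemma half_exp_le1 p : (2^-1 : R) ^+ p <= 1.
Proof. by rewrite exprn_ile1 // ?invr_ge0 // invf_le1 // ler1n. Qed.

Lemma stime_gt0 p : 0 < stime p.
Proof. by rewrite addr_gt0 // mulr_gt0 ?divr_gt0 ?half_exp_gt0. Qed.

Lemma budget_le p d : budget p d <= m / 16 * 2^-1 ^+ p + 1024 * s * d%:R.
Proof.
elim: d p => [|d IH] p /=.
  by rewrite mulr0 addr0 mulr_ge0 ?divr_ge0 ?ltW // half_exp_gt0.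
have := IH p.+1; rewrite exprS /stime -(natr1 d); lra.
Qed.

Lemma excl_in T : 0 <= T -> 0 <= excl T <= 1.
Proof. by move=> T0; rewrite expR_ge0 -expR0 ler_expR oppr_le0 divr_ge0 // ltW. Qed.

Lemma exclD T T' : excl (T + T') = excl T * excl T'.
Proof. by rewrite /excl mulrDl opprD expRD. Qed.

Lemma excl_half T : 0 < T <= N%:R -> T / 2 <= (1 - excl T) * N%:R.
Proof.
move=> /andP[T0 TN]; set u := T / N%:R.
have u0 : 0 < u by rewrite divr_gt0.
have u1 : u <= 1 by rewrite ler_pdivrMr // mul1r.
have TE : T = u * N%:R by rewrite divfK // gt_eqF.
rewrite /excl -/u {1}TE mulrAC ler_pM2r //.
by apply: one_sub_expRN; rewrite (ltW u0).
Qed.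

Definition stage_ok p q S := let x := excl (stime p) in
  nrm (residual F Delta q (block_weight F q x S)) <= (4^-1 ^+ p * Num.sqrt s) / 4 /\
  forall j, j \notin Delta -> normc (adj F (block_weight F q x S) j) <= 2^-1 ^+ p / 4.

Lemma stage_cert p q S S' : stime p <= N%:R ->
  (forall j, j \notin Delta -> q j = 0) -> nrm q <= 4^-1 ^+ p * Num.sqrt s ->
  stage_ok p q S ->
  cert p.+1 (residual F Delta q (block_weight F q (excl (stime p)) S)) S' -> cert p q (S :|: S').
Proof.
move=> TN qD qr [ok1 ok2] [w [w1 w2 w3 w4]].
set x := excl _ in ok1 ok2 w2 *; set v := block_weight F q x S in ok1 ok2 w2 *.
have x01 : 0 <= x < 1.
  rewrite expR_ge0 -expR0 ltr_expR oppr_lt0 divr_gt0 ?stime_gt0 //.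
have adjD j : adj F (fun k => v k + w k) j = adj F v j + adj F w j.
  by rewrite /adj -big_split; apply: eq_bigr => k _; rewrite mulrDr.
exists (fun k => v k + w k); split.
- move=> k; rewrite inE negb_or => /andP[kS kS'].
  by rewrite /v /block_weight (negbTE kS) w1 // addr0.
- rewrite (@eq_nrm _ _ _ (residual F Delta (residual F Delta q v) w)) // => j.
  by rewrite /residual adjD; case: ifP => // _; rewrite opprD addrA.
- move=> j jD; rewrite adjD (le_trans (le_normcD _ _)) //.
  have := ok2 j jD; have := w3 j jD; rewrite exprS; lra.
apply: le_trans (nrmD _ _) _.
(* The bounds close up geometrically: [13 + 26 / 2 = 26]. Since [n >= m 2^-p / 128], the square of
   13 has to exceed [5 / 4 * 128 = 160]. *)
suff h : nrm v <= 13 * 2^-1 ^+ p * Num.sqrt (s / m).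
  by move: w4 h; rewrite exprS; lra.
have rp : 0 < 4^-1 ^+ p * Num.sqrt s by rewrite mulr_gt0 ?exprn_gt0 ?sqrtr_gt0 ?invr_gt0.
have h2 := block_weight_nrm qD rp qr x01 N0 ok1.
rewrite nrm_le; last by rewrite mulr_ge0 ?sqrtr_ge0 // mulr_ge0 // ltW // half_exp_gt0.
apply: le_trans h2 _.
have nT : m / 128 * 2^-1 ^+ p <= (1 - x) * N%:R.
  have := @excl_half (stime p); rewrite stime_gt0 TN => /(_ isT); rewrite -/x.
  move=> h; apply: le_trans h; rewrite /stime; have := sp; lra.
have mp : 0 < m / 128 * 2^-1 ^+ p by rewrite mulr_gt0 ?half_exp_gt0 ?divr_gt0.
rewrite ler_pdivrMr ?(lt_le_trans mp) //.
rewrite !exprMn !sqr_sqrtr ?divr_ge0 ?(ltW sp) ?(ltW m0) //.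
apply: (@le_trans _ _ ((13 ^+ 2 * (2^-1 ^+ p) ^+ 2 * (s / m)) * (m / 128 * 2^-1 ^+ p))); last first.
  by rewrite ler_wpM2l // mulr_ge0 ?divr_ge0 ?(ltW sp) ?(ltW m0) // mulr_ge0 ?sqr_ge0.
have -> : (4^-1 : R) ^+ p = (2^-1 ^+ p) ^+ 2.
  by rewrite -exprM mulnC exprM; congr (_ ^+ _); field.
rewrite [leRHS](_ : _ = 169 / 128 * s * (2^-1 ^+ p) ^+ 3); last by field; rewrite gt_eqF.
have := half_exp_gt0 p; have := half_exp_le1 p; move: (2^-1 ^+ p) => h h1 h0.
rewrite [leLHS](_ : _ = 5 / 4 * s * (h ^+ 3 * h)); last by ring.
have : h ^+ 3 * h <= h ^+ 3 by rewrite ler_piMr // exprn_ge0 // ltW.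
have : 0 <= h ^+ 3 by rewrite exprn_ge0 // ltW.
move: (h ^+ 3) (h ^+ 3 * h) => a b a0 ba.
have : s * b <= s * a by rewrite ler_wpM2l // ltW.
have : 0 <= s * a by rewrite mulr_ge0 // ltW.
lra.
Qed.

(** A failure wastes the time of one stage, which costs a factor [exp u] in the recursion. The tails
    are [2 exp (- 4 u)] with [u >= 1], and [2 N exp (- m / (16384 s) - u)]; multiplied by [exp u],
    each is at most [1 / 4]. *)
Lemma stage_fail p q : stime p <= N%:R ->
  (forall j, j \notin Delta -> q j = 0) -> nrm q <= 4^-1 ^+ p * Num.sqrt s ->
  2 * N%:R * expR (- (m / (64 * s) / 256)) <= 4^-1 ->
  PB (excl (stime p)) (fun S => ~ stage_ok p q S) * expR (stime p / (512 * s)) <= 2^-1.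
Proof.
move=> TN qD qr NE; set x := excl _; set n := (1 - x) * N%:R; set u := stime p / _.
have x01 : 0 <= x < 1.
  rewrite expR_ge0 -expR0 ltr_expR oppr_lt0 divr_gt0 ?stime_gt0 //.
have hx : 0 <= x <= 1 by case/andP: x01 => -> /ltW->.
have nT : stime p / 2 <= n by apply: excl_half; rewrite stime_gt0.
have n0 : 0 < n by apply: lt_le_trans nT; rewrite divr_gt0 // stime_gt0.
set rho := 4^-1 ^+ p * Num.sqrt s in qr *.
have rp : 0 < rho by rewrite mulr_gt0 ?exprn_gt0 ?sqrtr_gt0 ?invr_gt0.
have h2 := half_exp_gt0 p.
have e4 : (4^-1 : R) ^+ p = (2^-1 ^+ p) ^+ 2.
  by rewrite -exprM mulnC exprM; congr (_ ^+ _); field.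
have hR : PB x (fun S => rho / 4 <= nrm (residual F Delta q (block_weight F q x S))) <=
  2 * expR (- (4 * u)).
  apply: le_trans (block_residual F1 Forth qD rp qr x01 s0 N0) _.
  rewrite ler_wpM2l // ler_expR lerN2 /u -/n ler_pdivlMr ?mulr_gt0 //.
  rewrite [leLHS](_ : _ = stime p / 2) //; field; by rewrite gt_eqF.
have hO j : j \notin Delta -> PB x (fun S => 2^-1 ^+ p / 4 <=
  normc (adj F (block_weight F q x S) j)) <=
    2 * expR (- (m / (64 * s) / 256) - u).
  (* Here [l] is set by the size constraint, where it gives [1 / 8], and not by optimisation. The
     exponent becomes [n / (64 s) - n / (32 s h)], and the division by [h] makes up for the factor
     [h] in the time of stage [p]. *)
  move=> jD; pose h := (2^-1 : R) ^+ p; pose l := n / (8 * s * h ^+ 2).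
  have sqs : Num.sqrt s ^+ 2 = s by rewrite sqr_sqrtr // ltW.
  have hp : 0 < h := h2.
  have lp : 0 < l by apply: divr_gt0 => //; apply: mulr_gt0; [exact: mulr_gt0|exact: exprn_gt0].
  apply: le_trans (block_off F1 Forth qD rp qr x01 N0 (2^-1 ^+ p / 4) jD (ltW lp) _) _.
    rewrite -/n [leLHS](_ : _ = 8^-1); first by lra.
    transitivity (Num.sqrt s ^+ 2 / (8 * s)); last by rewrite sqs; field; rewrite gt_eqF.
    by rewrite /l /rho e4 -/h; field; rewrite !gt_eqF.
  rewrite ler_wpM2l // ler_expR -/n -/h.
  rewrite [leLHS](_ : _ = n / (64 * s) - (n / (32 * s)) / h); last first.
    have -> : rho ^+ 2 = h ^+ 4 * s by rewrite /rho e4 -/h exprMn sqs -exprM.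
    by rewrite /l; field; rewrite !gt_eqF.
  have hi : 1 <= h^-1 by rewrite invf_ge1 ?half_exp_le1.
  have nh : stime p / (64 * s) <= n / (32 * s).
    rewrite ler_pdivlMr ?mulr_gt0 // [leLHS](_ : _ = stime p / 2) //.
    by field; rewrite gt_eqF.
  have uE : u = m / 64 / s * h / 512 + 1.
    by rewrite /u /stime -/h; field; rewrite gt_eqF.
  have h1 : h <= 1 := half_exp_le1 p.
  have k0 : 0 <= m / 64 / s by rewrite !divr_ge0 ?ltW.
  have n1 : n / (64 * s) = n / (32 * s) / 2 by field; rewrite gt_eqF.
  have n2 : m / 64 / s * h / 64 + 8 <= n / (32 * s).
    apply: le_trans nh; rewrite le_eqVlt; apply/orP; left; apply/eqP.
    by rewrite /stime -/h; field; rewrite gt_eqF.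
  rewrite uE n1 (_ : m / (64 * s) = m / 64 / s); last by field; rewrite gt_eqF.
  have : (m / 64 / s * h / 64 + 8) / h <= n / (32 * s) / h by rewrite ler_wpM2r // invr_ge0 ltW.
  have -> : (m / 64 / s * h / 64 + 8) / h = m / 64 / s / 64 + 8 / h by field; rewrite !gt_eqF.
  have : n / (32 * s) <= n / (32 * s) / h by rewrite ler_peMr // ltW // divr_gt0 // mulr_gt0.
  have : m / 64 / s * h <= m / 64 / s by rewrite ler_piMr.
  lra.
have hF : PB x (fun S => ~ stage_ok p q S) <= 2 * expR (- (4 * u)) + N%:R * (2 * expR (- (m / (64 * s) / 256) - u)).
  apply: (@le_trans _ _ (PB x (fun S => rho / 4 <= nrm (residual F Delta q (block_weight F q x S)) \/
     exists j, j \notin Delta /\ 2^-1 ^+ p / 4 <= normc (adj F (block_weight F q x S) j)))).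
    apply: ler_PB => // S nok; apply: contrapT => /not_orP[/negP + h].
    rewrite -ltNge => /ltW ok1; apply: nok; split => // j jD.
    by rewrite leNgt; apply/negP => /ltW h'; apply: h; exists j.
  apply: le_trans (Pr_or (bern_ge0 hx) _ _) _; apply: lerD => //.
  apply: le_trans (Pr_exists (bern_ge0 hx) _) _.
  apply: (@le_trans _ _ (\sum_(j < N) 2 * expR (- (m / (64 * s) / 256) - u))); last first.
    by rewrite sumr_const card_ord [leRHS]mulr_natl.
  apply: ler_sum => j _.
  have [jD|/hO h] := boolP (j \in Delta); last first.
    by apply: le_trans h; apply: ler_Pr => [|o []//]; exact: bern_ge0.
  by rewrite Pr_false ?mulr_ge0 ?expR_ge0 // => o [/negP].
have u1 : 1 <= u.
  rewrite /u ler_pdivlMr ?mulr_gt0 // mul1r /stime lerDr mulr_ge0 ?ltW ?divr_gt0 //.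
apply: le_trans (ler_wpM2r (expR_ge0 _) hF) _.
have eA : expR (- (m / (64 * s) / 256) - u) * expR u = expR (- (m / (64 * s) / 256)).
  by rewrite -expRD subrK.
have eB : expR (- (4 * u)) * expR u = expR (- (4 * u) + u) by rewrite expRD.
have -> (a b c e : R) : (2 * a + e * (2 * b)) * c = 2 * (a * c) + e * (2 * (b * c)) by ring.
rewrite eA eB.
have e3 : expR (- (4 * u) + u) <= 8^-1.
  apply: (@le_trans _ _ (expR (- 1) ^+ 3)).
    by rewrite -expRM_natl ler_expR; lra.
  have := expRN1_le_half R.
  have := expR_ge0 (-1 : R); move: (expR (-1)) => a a0 a2.
  have -> : 8^-1 = 2^-1 ^+ 3 :> R by field.
  by rewrite lerXn2r ?nnegrE ?invr_ge0.
move: NE e3; move: (N%:R : R) (expR (- (4 * u) + u)) (expR (- (m / (64 * s) / 256))) => a b e; lra.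
Qed.

(* A failed stage is retried with fresh samples. [budget] counts each remaining
   stage twice, so a success gains a factor 2 on the bound, which pays for the
   sum over the two outcomes. *)
Lemma golfing_rec d p q T : (forall p', stime p' <= N%:R) ->
  2 * N%:R * expR (- (m / (64 * s) / 256)) <= 4^-1 ->
  (forall j, j \notin Delta -> q j = 0) -> nrm q <= 4^-1 ^+ p * Num.sqrt s ->
  4^-1 ^+ (p + d) * Num.sqrt s <= gam -> 0 <= T ->
  PB (excl T) (fun S => ~ cert p q S) <= expR ((budget p d - T) / (512 * s)).
Proof.
move=> TN NE; elim: d p q T => [|d IHd] p q T qD qr hg T0.
  rewrite /PB Pr_false ?expR_ge0 // => o; apply.
  exists (fun=> 0); have a0 j : adj F (fun=> 0) j = 0 by rewrite /adj big1 // => k _; rewrite mulr0.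
  split => //.
  - apply: le_trans hg; rewrite addn0; apply: le_trans qr; rewrite nrm_le ?nrm_ge0 // sqr_nrm.
    apply: ler_sum => j _; rewrite /residual a0 subr0; case: ifP => // _.
    by rewrite ComplexField.Normc.normc0 expr0n sqr_ge0.
  - by move=> j _; rewrite a0 ComplexField.Normc.normc0 divr_ge0 // ltW // half_exp_gt0.
  rewrite /nrm /nrm2 big1 => [|k _]; last by rewrite ComplexField.Normc.normc0 expr0n.
  by rewrite sqrtr0 mulr_ge0 ?sqrtr_ge0 // mulr_ge0 // ltW // half_exp_gt0.
(* A retry leaves [p] and [d] unchanged and only consumes time, so an inner induction runs on the
   number of stages that [T] can pay for. *)
have [k Tk] : exists k : nat, T <= k%:R * stime p.
  exists (Num.truncn (T / stime p)).+1; rewrite -ler_pdivrMr ?stime_gt0 //.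
  by rewrite ltW // truncnS_gt.
have b0 p' d' : 0 <= budget p' d'.
  by elim: d' p' => //= d' IH p'; rewrite addr_ge0 // mulr_ge0 // ltW // stime_gt0.
elim: k q T qD qr T0 Tk => [|k IHk] q T qD qr T0 Tk.
  apply: le_trans (PB_le1 _ (excl_in T0)) _; rewrite -[leLHS]expR0 ler_expR; apply: divr_ge0;
    last by rewrite ltW // mulr_gt0.
  have := b0 p d.+1; move: Tk; rewrite mul0r; lra.
(* With no time for a full stage the budget exceeds [T], and the claimed bound is at least 1. *)
have [Tp|/ltW Tp] := leP T (stime p).
  apply: le_trans (PB_le1 _ (excl_in T0)) _; rewrite -[leLHS]expR0 ler_expR; apply: divr_ge0;
    last by rewrite ltW // mulr_gt0.
  have := b0 p.+1 d; have := stime_gt0 p; rewrite /=; lra.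
set T' := T - stime p; have T'0 : 0 <= T' by rewrite subr_ge0.
have -> : excl T = excl (stime p) * excl T' by rewrite -exclD addrC subrK.
set B := (budget p d.+1 - T) / _; set u := stime p / (512 * s).
have hf := stage_fail (TN p) qD qr NE.
apply: le_trans (@PB_union _ _ _ _ _ (fun S => ~ stage_ok p q S) (expR (B + u)) (expR (B - u)) _ _ _ _ _) _.
- exact: excl_in (ltW (stime_gt0 p)).
- exact: expR_ge0.
- exact: expR_ge0.
- move=> S _; apply: (@le_trans _ _ (PB (excl T') (fun S' => ~ cert p q S'))).
    apply: ler_PB => [|S' h c]; first exact: excl_in.
    by apply: h; apply: cert_mono c; exact: subsetUr.
  have -> : B + u = (budget p d.+1 - T') / (512 * s) by rewrite /B /u -mulrDl /T'; congr (_ / _);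
    ring.
  apply: IHk => //; move: Tk; rewrite /T' -natr1; lra.
- move=> S /contrapT ok.
  apply: (@le_trans _ _ (PB (excl T') (fun S' => ~ cert p.+1 (residual F Delta q (block_weight F q (excl (stime p)) S)) S'))).
    apply: ler_PB => [|S' h c]; first exact: excl_in.
    by apply: h; apply: stage_cert.
  have -> : B - u = (budget p.+1 d - T') / (512 * s).
    rewrite /B /u -mulrBl /T'; congr (_ / _); rewrite /=; ring.
  apply: IHd => //.
  + by move=> j jD; rewrite /residual (negbTE jD).
  + apply: le_trans ok.1 _; rewrite exprS; lra.
  by rewrite addSnnS.
have u1 : expR (- u) <= 2^-1.
  have : 1 <= u.
    rewrite /u ler_pdivlMr ?mulr_gt0 // mul1r /stime lerDr mulr_ge0 ?ltW ?divr_gt0 ?half_exp_gt0 //.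
  have := expR_ge1Dx u; have := expRxMexpNx_1 u; have := expR_gt0 u.
  move: (expR _) (expR _) => a b; nra.
rewrite !expRD -mulrA -mulrDr ler_piMr ?expR_ge0 //.
move: hf; rewrite -/u mulrC; lra.
Qed.

End Recursion.

(** * Lower isometry from a random sample of rows *)

Section Maurey.
Variables (R : realType) (N : nat) (M : 'I_N -> 'I_N -> R[i]).
Hypothesis M1 : forall k j, normc (M k j) <= 1.
Implicit Types (b : 'I_N -> R[i]) (S : {set 'I_N}).

(* [(j, im, neg)] stands for [2 * phase * M _ j] with phase 1, -1, 'i or -'i. *)
Definition atom : finType := option ('I_N * bool * bool).

Definition apply_mx b k : R[i] := \sum_j M k j * b j.

Definition atom_val (a : atom) k : R[i] :=
  if a is Some (j, im, neg) then
    (if neg then -1 else 1) * (if im then 'i else 1)%C * (2 * M k j)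
  else 0.

(** The halving, undone by the factor 2 in [atom_val], pays for [|Re z| + |Im z| <= 2 |z|]; the
    coefficients then sum to at most 1, and the null atom receives the remaining mass. *)
Definition atom_coef b (p : 'I_N * bool * bool) : R :=
  let: (j, im, neg) := p in
  let r := if im then Im (b j) else Re (b j) in Num.max (if neg then - r else r) 0 / 2.

Definition atom_wt b (a : atom) : R :=
  if a is Some p then atom_coef b p else 1 - \sum_p atom_coef b p.

Lemma atom_coef_ge0 b p : 0 <= atom_coef b p.
Proof. by case: p => [[j im] neg]; rewrite /= divr_ge0 // le_max lexx orbT. Qed.

Lemma max_pos_neg (r : R) : Num.max r 0 + Num.max (- r) 0 = `|r|.
Proof.
rewrite maxEle [in X in _ + X]maxEle; case: (lerP r 0) => h; case: (lerP (- r) 0) => h'.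
- rewrite ler0_norm //; lra.
- rewrite ler0_norm //; lra.
- rewrite gtr0_norm //; lra.
lra.
Qed.

Lemma max_pos_sub (r : R) : Num.max r 0 - Num.max (- r) 0 = r.
Proof.
rewrite maxEle [in X in _ - X]maxEle; case: (lerP r 0) => h; case: (lerP (- r) 0) => h'; lra.
Qed.

Lemma normr_Im (z : R[i]) : `|Im z| <= normc z.
Proof.
rewrite -(@ler_pXn2r _ 2) ?nnegrE ?normc_ge0 // normc_sqr real_normK ?num_real //.
by rewrite lerDr sqr_ge0.
Qed.

Lemma sum_atom (V : nmodType) (f : 'I_N * bool * bool -> V) :
  \sum_p f p = \sum_j (f (j, true, true) + f (j, true, false) + (f (j, false, true) + f (j, false, false))).
Proof.
transitivity (\sum_p \sum_c f (p, c)).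
  by rewrite pair_bigA; apply: eq_bigr => -[].
transitivity (\sum_j \sum_i \sum_c f (j, i, c)).
  by rewrite (pair_bigA _ (fun j i => \sum_c f (j, i, c))); apply: eq_bigr => -[].
by apply: eq_bigr => j _; rewrite !big_bool.
Qed.

Lemma sum_atom_coef b : \sum_j normc (b j) <= 1 -> \sum_p atom_coef b p <= 1.
Proof.
move=> b1; apply: le_trans b1; rewrite sum_atom; apply: ler_sum => j _ /=.
have := normr_Re (b j); have := normr_Im (b j).
have := max_pos_neg (Im (b j)); have := max_pos_neg (Re (b j)).
move: (Num.max (- Re _) _) (Num.max (Re _) _) (Num.max (- Im _) _) (Num.max (Im _) _) => ? ? ? ?.
move: `|Re _| `|Im _| => ? ?; lra.
Qed.

Lemma atom_wt_ge0 b : \sum_j normc (b j) <= 1 -> forall a, 0 <= atom_wt b a.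
Proof. by move=> b1 [p|] /=; rewrite ?atom_coef_ge0 // subr_ge0 sum_atom_coef. Qed.

Lemma big_option (V : nmodType) (K : finType) (f : option K -> V) :
  \sum_a f a = f None + \sum_k f (Some k).
Proof.
rewrite (bigD1 None) //=; congr (_ + _); rewrite (reindex_omap Some id) => [|[a|] //].
by apply: eq_bigl => k; rewrite /= eqxx.
Qed.

Lemma atom_wt_sum1 b : \sum_a atom_wt b a = 1.
Proof. by rewrite big_option /= subrK. Qed.

Lemma atom_mean b k : \sum_a (atom_wt b a)%:C%C * atom_val a k = apply_mx b k.
Proof.
rewrite big_option /= mulr0 add0r sum_atom; apply: eq_bigr => j _ /=.
rewrite [X in _ = _ * X](_ : b j = (Num.max (Re (b j)) 0 - Num.max (- Re (b j)) 0)%:C%C +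
   'i%C * (Num.max (Im (b j)) 0 - Num.max (- Im (b j)) 0)%:C%C); last first.
  by rewrite !max_pos_sub -complexE.
move: (Num.max (- Re _) _) (Num.max (Re _) _) (Num.max (- Im _) _) (Num.max (Im _) _) => u v w y.
case: (M k j) => c d; apply/eqP; rewrite eq_complex /=; apply/andP.
by split; apply/eqP; field.
Qed.

Lemma atom_val_le2 a k : normc (atom_val a k) <= 2.
Proof.
case: a => [[[j im] neg]|]; last by rewrite /atom_val ComplexField.Normc.normc0.
rewrite /atom_val !ComplexField.Normc.normcM.
have -> : normc ((if neg then -1 else 1) : R[i]) = 1.
  by case: neg; rewrite ?normcN /= expr0n expr1n addr0 sqrtr1.
have -> : normc ((if im then 'i else 1)%C : R[i]) = 1.
  by case: im; rewrite /= expr0n expr1n ?addr0 ?add0r sqrtr1.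
rewrite !mul1r -[2 : R[i]](rmorph_nat (real_complex R)) normc_real normr_nat.
by rewrite ler_piMr.
Qed.

Lemma apply_mx_le1 b k : \sum_j normc (b j) <= 1 -> normc (apply_mx b k) <= 1.
Proof.
move=> b1; apply: le_trans b1; apply: le_trans (normc_sum _ _ _) _.
by apply: ler_sum => j _; rewrite ComplexField.Normc.normcM ler_piMl ?normc_ge0.
Qed.

Definition empirical Q (o : {ffun 'I_Q -> atom}) k : R[i] := (Q%:R^-1)%:C%C * \sum_i atom_val (o i) k.

Lemma Pr_empirical Q b k (a : R) : (0 < Q)%N -> \sum_j normc (b j) <= 1 -> 0 <= a <= 1 ->
  Pr (fun=> atom_wt b) (fun o : {ffun 'I_Q -> atom} => a <= normc (empirical o k - apply_mx b k)) <=
  2 * expR (- (Q%:R * a ^+ 2 / 36)).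
Proof.
move=> Q0 b1 /andP[a0 a1]; have w0 := atom_wt_ge0 b1.
have Qp : 0 < Q%:R :> R by rewrite ltr0n.
pose Y (i : 'I_Q) (c : atom) (_ : unit) := atom_val c k - apply_mx b k.
have nrm1 (y : unit -> R[i]) : nrm y = normc (y tt).
  by rewrite /nrm /nrm2 (big_pred1 tt) => [|[]] //; rewrite sqrtr_sqr ger0_norm // normc_ge0.
have Y3 i c : nrm (Y i c) <= 3.
  rewrite nrm1 (le_trans (le_normcD _ _)) // normcN.
  have := atom_val_le2 c k; have := apply_mx_le1 k b1; move: (normc _) (normc _) => ? ?; lra.
(* [a / 18] minimises [l^2 V - l t] for [t = Q a] and [V = 9 Q], where 9 is the square of the bound
   3 on a centred atom. *)
have -> : - (Q%:R * a ^+ 2 / 36) = (a / 18) ^+ 2 * (Q%:R * 9) - a / 18 * (Q%:R * a) by field.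
apply: le_trans (Pr_nrm_sum (w := fun=> atom_wt b) (fun _ => w0) (fun _ => atom_wt_sum1 b) (Y :=
  Y) _ _ _ _ _).
- apply: ler_Pr => [//|o]; rewrite nrm1 /Y.
  have -> : empirical o k - apply_mx b k = (Q%:R^-1)%:C%C * \sum_i (atom_val (o i) k - apply_mx b k).
    rewrite sumrB mulrBr sumr_const card_ord; congr (_ - _).
    have e : (Q%:R^-1)%:C%C * Q%:R = 1 :> R[i].
      by rewrite -[X in _ * X](rmorph_nat (real_complex R)) -rmorphM /= mulVf ?gt_eqF.
    by rewrite -[apply_mx b k *+ Q]mulr_natl mulrA e mul1r.
  by rewrite ComplexField.Normc.normcM normc_real ger0_norm ?invr_ge0 // mulrC ler_pdivlMr // mulrC.
- by rewrite divr_ge0.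
- move=> i j; rewrite /Y; under eq_bigr do rewrite mulrBr.
  by rewrite sumrB atom_mean -mulr_suml -rmorph_sum atom_wt_sum1 rmorph1 mul1r subrr.
- by move=> i c; have := Y3 i c; have := nrm_ge0 (Y i c); move: (nrm _) => y; nra.
apply: (@le_trans _ _ (\sum_(i < Q) 9)); last by rewrite sumr_const card_ord mulr_natl.
apply: ler_sum => i _; apply: (@le_trans _ _ (\sum_c atom_wt b c * 9)).
  apply: ler_sum => c _; rewrite ler_wpM2l //.
  have -> : 9 = 3 ^+ 2 :> R by ring.
  by rewrite -nrm_le.
by rewrite -mulr_suml atom_wt_sum1 mul1r.
Qed.

(** Accuracy is demanded on all the sampled rows but only outside a fraction [1 / m] of the full set
    of rows. The number of draws therefore grows with [ln m] instead of [ln N], which is where the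
    [ln m] in the final factor originates. *)
Lemma maurey Q b S (m : nat) (a : R) : (0 < Q)%N -> (0 < N)%N -> (0 < m)%N ->
  \sum_j normc (b j) <= 1 ->
  0 <= a <= 1 -> (#|S| <= m)%N -> 2 * expR (- (Q%:R * a ^+ 2 / 36)) * (2 * m%:R) < 1 ->
  exists o : {ffun 'I_Q -> atom},
   (forall k, k \in S -> normc (empirical o k - apply_mx b k) < a) /\
   #|[set k | a <= normc (empirical o k - apply_mx b k)]|%:R <= N%:R / m%:R :> R.
Proof.
move=> Q0 N0 m0 b1 a01 Sm small; set e := 2 * expR _ in small.
have Np : 0 < N%:R :> R by rewrite ltr0n.
have mp : 0 < m%:R :> R by rewrite ltr0n.
have w0 := atom_wt_ge0 b1; have w1 := atom_wt_sum1 b.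
pose bad (o : {ffun 'I_Q -> atom}) k := a <= normc (empirical o k - apply_mx b k).
(* Exceptions in [S] weigh at least 1, so a mean below 1 yields a draw without any. *)
pose phi (o : {ffun 'I_Q -> atom}) : R := \sum_k ((k \in S)%:R + m%:R / N%:R) * `[< bad o k >]%:R.
have phiE : Ex (fun=> atom_wt b) phi < 1.
  rewrite /phi Ex_sum; under eq_bigr do rewrite ExZ.
  apply: le_lt_trans small; apply: (@le_trans _ _ (\sum_k ((k \in S)%:R + m%:R / N%:R) * e)).
    apply: ler_sum => k _; rewrite ler_wpM2l ?addr_ge0 ?divr_ge0 //; exact: Pr_empirical.
  rewrite -mulr_suml mulrC ler_wpM2l ?mulr_ge0 ?expR_ge0 // big_split /= sumr_const card_ord.
  rewrite -[_ *+ N]mulr_natr divfK ?gt_eqF // -natr_sum -big_mkcond sum1_card /=.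
  have : #|S|%:R <= m%:R :> R by rewrite ler_nat.
  lra.
have [o ho] : exists o, phi o < 1.
  apply: contrapT => no; have : 1 <= Ex (fun=> atom_wt b) phi.
    rewrite -[leLHS](Ex_cst (w := fun (_ : 'I_Q) => atom_wt b) (fun _ => w1) 1); apply: ler_Ex =>
      [//|o].
    by rewrite leNgt; apply/negP => h; apply: no; exists o.
  by rewrite leNgt phiE.
have term0 k : 0 <= ((k \in S)%:R + m%:R / N%:R) * `[< bad o k >]%:R :> R by rewrite mulr_ge0 ?addr_ge0 ?divr_ge0.
exists o; split => [k kS|].
  rewrite ltNge; apply/negP => bk; move: ho; rewrite /phi (bigD1 k) //= kS asboolT // mulr1.
  apply/negP; rewrite -leNgt -addrA lerDl addr_ge0 ?divr_ge0 ?sumr_ge0 //.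
apply: (@le_trans _ _ (N%:R / m%:R * phi o)); last by rewrite ler_piMr ?divr_ge0 // ltW.
rewrite /phi mulr_sumr -sum1_card natr_sum big_mkcond; apply: ler_sum => k _.
rewrite inE -/(bad o k); case: ifP => [bk|_]; last by rewrite asboolF // !mulr0.
have e1 : N%:R / m%:R * (m%:R / N%:R) = 1 :> R by field; rewrite !gt_eqF.
by rewrite asboolT // mulr1 mulrDr e1 lerDr mulr_ge0 // divr_ge0.
Qed.

End Maurey.

(** * Layer sums over powers of 4 *)

Section Levels.
Variable R : realType.

Lemma geo4_le (t : nat) : \sum_(i < t) (4^-1 : R) ^+ i <= 4 / 3.
Proof.
elim: t => [|t IH]; first by rewrite big_ord0; lra.
rewrite big_ord_recl expr0; under eq_bigr do rewrite exprS.
rewrite -mulr_sumr; lra.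
Qed.

(** The levels below [z] form a geometric series dominated by the largest. This direction recovers
    the sampled energy from its level sets. *)
Lemma level_sum_le (t : nat) (z : R) : 0 <= z ->
  \sum_(i < t) 4^-1 ^+ i * (4^-1 ^+ i < z)%R%:R <= 4 / 3 * z.
Proof.
elim: t z => [|t IH] z z0; first by rewrite big_ord0; lra.
have [z1|z1] := ltP 1 z.
  apply: le_trans (_ : \sum_(i < t.+1) (4^-1 : R) ^+ i <= _).
    by apply: ler_sum => i _; rewrite ler_piMr ?exprn_ge0 ?invr_ge0 // lern1 leq_b1.
  have := geo4_le t.+1; lra.
rewrite big_ord_recl expr0 ltNge z1 mulr0 add0r.
have := IH (4 * z) _; rewrite mulr_ge0 // => /(_ isT) h.
have -> : \sum_(i < t) (4^-1 : R) ^+ (lift ord0 i) * (4^-1 ^+ (lift ord0 i) < z)%R%:R =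
  4^-1 * \sum_(i < t) (4^-1 : R) ^+ i * (4^-1 ^+ i < 4 * z)%R%:R.
  rewrite mulr_sumr; apply: eq_bigr => i _; rewrite lift0 exprS mulrA; congr (_ * _%:R).
  by rewrite -[in RHS]ltr_pdivrMl // ?invrK.
lra.
Qed.

(** Either [y] is below the last level, or it lies in some band from [4^-(i+1)] to [4^-i], whose
    upper end is counted. This direction bounds the full energy by its level sets. *)
Lemma level_lower (t : nat) (y : R) : 0 <= y <= 1 ->
  y <= 4^-1 ^+ t + \sum_(i < t) 4^-1 ^+ i * (4^-1 ^+ i.+1 < y)%R%:R.
Proof.
move=> /andP[y0 y1]; elim: t => [|t IH]; first by rewrite big_ord0 expr0 addr0.
have s0 : 0 <= \sum_(i < t) (4^-1 : R) ^+ i * (4^-1 ^+ i.+1 < y)%R%:R.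
  by apply: sumr_ge0 => i _; rewrite mulr_ge0 // exprn_ge0 // invr_ge0.
have p0 : 0 <= (4^-1 : R) ^+ t.+1 by rewrite exprn_ge0 // invr_ge0.
by rewrite big_ord_recr /=; case: ltP => h /=; lra.
Qed.

End Levels.

(** * Lower isometry by a union bound over level sets *)

Section HavivRegev.
Variables (R : realType) (N : nat) (M : 'I_N -> 'I_N -> R[i]).
Hypothesis M1 : forall k j, normc (M k j) <= 1.
Hypothesis N0 : (0 < N)%N.
Implicit Types (b : 'I_N -> R[i]) (S : {set 'I_N}).

(* 43 bounds 8 * 16 / 3: a factor 8 at each level times the geometric sum over
   the levels. *)
Definition lower_isometry (n eta : R) S := forall b, \sum_j normc (b j) <= 1 ->
  (\sum_k normc (apply_mx M b k) ^+ 2) / N%:R <=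
  43 * (\sum_(k in S) normc (apply_mx M b k) ^+ 2) / n + eta.

(** It depends on the draw alone, so at each level there are finitely many such sets. With an error
    below a quarter of the level, the cut at [3 / 4] contains every row above the level and lies
    above half of it. *)
Definition big_set Q (o : {ffun 'I_Q -> atom N}) (i : nat) : {set 'I_N} :=
  [set k | 3 / 4 * (2^-1 : R) ^+ i.+1 < normc (empirical M o k)].

(** [576 = 36 * 16]: the accuracy is a quarter of the level and Maurey's exponent carries [1 / 36].
    The argument [8 m] brings the first moment down to at most [1 / 2]. *)
Definition net_size (m : nat) (i : nat) : nat := (Num.truncn (576 * 4 ^+ i.+1 * ln (8 * m%:R : R))).+1.

(** The slack grows like [4 ^ i] because the logarithm of the number of draws does. Weighted by the
    level it costs the same at every [i], so the error is linear in the number [t] of levels. *)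
Definition net_event (x c : R) (m t : nat) S := forall (i : 'I_t) (o : {ffun 'I_(net_size m i) ->
  atom N}),
  (1 - x) * #|big_set o i|%:R / 2 < #|S :&: big_set o i|%:R + c * 4 ^+ i.+1.

Lemma lower_isometry_of_net (x c : R) (m t : nat) S : x < 1 -> 0 <= c -> (0 < m)%N -> (#|S| <= m)%N ->
  net_event x c m t S ->
  lower_isometry ((1 - x) * N%:R) (4^-1 ^+ t + 4 * t%:R * (2 * c / ((1 - x) * N%:R) + m%:R^-1)) S.
Proof.
move=> x1 c0 m0 Sm net b b1; set n := (1 - x) * N%:R.
have Np : 0 < N%:R :> R by rewrite ltr0n.
have mp : 0 < m%:R :> R by rewrite ltr0n.
have np : 0 < n by rewrite mulr_gt0 // subr_gt0.
pose y k := normc (apply_mx M b k) ^+ 2.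
have y01 k : 0 <= y k <= 1.
  by rewrite sqr_ge0 exprn_ile1 ?normc_ge0 //; exact: apply_mx_le1.
(* From the level set of [b] to the big set of a draw, up to [N / m] exceptional rows; then to its
   sampled part by [net]; then back to [b] at half the threshold, hence a quarter of the squared
   level. *)
have level (i : 'I_t) : \sum_k (4^-1 ^+ i.+1 < y k)%R%:R / N%:R <=
   2 / n * (\sum_(k in S) (4^-1 ^+ i.+1 / 4 < y k)%R%:R) + 2 * c * 4 ^+ i.+1 / n + m%:R^-1 :> R.
  pose th : R := 2^-1 ^+ i.+1; pose a := th / 4.
  have th0 : 0 < th by rewrite exprn_gt0 ?invr_gt0.
  have th1 : th <= 1 by rewrite exprn_ile1 ?invr_ge0 // invf_le1 // ler1n.
  have th2 : 4^-1 ^+ i.+1 = th ^+ 2 by rewrite -exprM mulnC exprM; congr (_ ^+ _); field.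
  have p4 : 0 < 4 ^+ i.+1 :> R by rewrite exprn_gt0.
  have small : 2 * expR (- ((net_size m i)%:R * a ^+ 2 / 36)) * (2 * m%:R) < 1.
    have Qle : 576 * 4 ^+ i.+1 * ln (8 * m%:R : R) <= (net_size m i)%:R.
      by rewrite ltW // truncnS_gt.
    have : ln (8 * m%:R) <= (net_size m i)%:R * a ^+ 2 / 36.
      rewrite (_ : a ^+ 2 = 4^-1 ^+ i.+1 / 16); last by rewrite /a th2; field.
      rewrite exprVn [leRHS](_ : _ = (net_size m i)%:R / (576 * 4 ^+ i.+1)); last first.
        by move: (4 ^+ i.+1 : R) p4 => e e0; field; rewrite gt_eqF.
      by rewrite ler_pdivlMr ?mulr_gt0 // mulrC.
    rewrite -ler_expR lnK ?posrE ?mulr_gt0 // expRN.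
    set e := expR _ => he; have e0 : 0 < e by apply: lt_le_trans he; rewrite mulr_gt0.
    rewrite mulrAC -ltr_pdivlMr ?invr_gt0 // invrK mul1r; move: mp; lra.
  have a01 : 0 <= a <= 1 by rewrite /a; apply/andP; split; lra.
  have [o [oS oN]] := maurey M1 (ltn0Sn _) N0 m0 b1 a01 Sm small.
  have gt2 (u v : R) : 0 <= u -> 0 <= v -> (u ^+ 2 < v ^+ 2) = (u < v) by move=> u0 v0;
    rewrite ltr_pXn2r.
  pose A := [set k | 4^-1 ^+ i.+1 < y k].
  have tri k : normc (empirical M o k) <= normc (empirical M o k - apply_mx M b k) + normc (apply_mx M b k).
    by rewrite -[X in normc X](subrK (apply_mx M b k)) le_normcD.
  have tri' k : normc (apply_mx M b k) <= normc (empirical M o k - apply_mx M b k) + normc (empirical M o k).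
    rewrite -[X in X + _]normcN opprB -[X in normc X](subrK (empirical M o k)) le_normcD //.
  have sub1 : A \subset big_set o i :|: [set k | a <= normc (empirical M o k - apply_mx M b k)].
    apply/subsetP => k; rewrite !inE th2 gt2 ?normc_ge0 ?(ltW th0) // => h.
    case: (lerP a) => ha; rewrite ?orbT // orbF -/th.
    have := tri' k; rewrite /a in ha; lra.
  have cardA : \sum_k (4^-1 ^+ i.+1 < y k)%R%:R <= #|big_set o i|%:R + N%:R / m%:R :> R.
    rewrite -natr_sum -big_mkcond sum1_card; apply: (@le_trans _ _ #|A|%:R).
      by rewrite ler_nat; apply: eq_leq; apply: eq_card => k; rewrite inE.
    apply: le_trans (_ : (#|big_set o i| + #|[set k | a <=
      normc (empirical M o k - apply_mx M b k)]|)%:R <= _).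
      by rewrite ler_nat (leq_trans (subset_leq_card sub1)) // leq_card_setU.
    by rewrite natrD lerD2l.
  have sub2 : #|S :&: big_set o i|%:R <= \sum_(k in S) (4^-1 ^+ i.+1 / 4 < y k)%R%:R :> R.
    rewrite -natr_sum ler_nat -big_mkcondr sum1_card; apply: subset_leq_card.
    apply/subsetP => k; rewrite !inE => /andP[kS h]; rewrite unfold_in /= kS th2.
    rewrite (_ : th ^+ 2 / 4 = (th / 2) ^+ 2); last by field.
    rewrite gt2 ?normc_ge0 ?divr_ge0 ?(ltW th0) //.
    have := tri k; have := oS k kS; rewrite /a; move: h; rewrite -/th; lra.
  have := net i o; move: cardA sub2; rewrite -mulr_suml.
  move: (\sum_k _) (\sum_(k in S) _) (#|S :&: _|%:R) (#|big_set o i|%:R) => u v B1 B2 h1 h2 h3.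
  move: (4 ^+ i.+1 : R) h3 => e h3; rewrite ler_pdivrMr //.
  have -> : (2 / n * v + 2 * c * e / n + m%:R^-1) * N%:R = 2 * (v + c * e) / (1 - x) + N%:R / m%:R.
    by rewrite /n; field; rewrite !gt_eqF ?subr_gt0.
  apply: le_trans h1 _; rewrite lerD2r ler_pdivlMr ?subr_gt0 //; lra.
apply: (@le_trans _ _ (\sum_k (4^-1 ^+ t + \sum_(i < t) 4^-1 ^+ i * (4^-1 ^+ i.+1 < y k)%R%:R) / N%:R)).
  by rewrite mulr_suml; apply: ler_sum => k _; rewrite ler_wpM2r ?invr_ge0 //;
    exact: level_lower (y01 k).
under eq_bigr do rewrite mulrDl; rewrite big_split /= -mulr_suml sumr_const card_ord.
rewrite -[_ *+ N]mulr_natr mulfK ?gt_eqF //.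
rewrite [leRHS]addrC -addrA lerD2l.
under eq_bigr do rewrite mulr_suml; rewrite exchange_big /=.
(* The 8 is the 2 lost to the Chernoff bound times the 4 from passing from [4^-i] to [4^-(i+1)]. *)
apply: (@le_trans _ _ (\sum_(i < t) (8 / n * (4^-1 ^+ i.+1 * \sum_(k in S) (4^-1 ^+ i.+1 / 4 < y k)%R%:R)
   + 4 * (2 * c / n + m%:R^-1)))).
  apply: ler_sum => i _; under eq_bigr do rewrite -mulrA; rewrite -mulr_sumr.
  apply: le_trans (ler_wpM2l _ (level i)) _; first by rewrite exprn_ge0 // invr_ge0.
  move: (\sum_(k in S) _) => u; rewrite !exprVn !exprS !invfM.
  have e1 : 1 <= 4 ^+ i :> R by rewrite exprn_ege1 // ler1n.
  have e0 := lt_le_trans ltr01 e1; move: (4 ^+ i : R) e1 e0 => e e1 e0.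
  rewrite -subr_ge0 [leRHS](_ : _ = m%:R^-1 * (4 - e^-1)); last by field; rewrite !gt_eqF ?subr_gt0.
  by rewrite mulr_ge0 ?invr_ge0 // subr_ge0 (@le_trans _ _ 1) ?invf_le1 // ler1n.
rewrite big_split /= sumr_const card_ord -[_ *+ t]mulr_natl -mulr_sumr addrC.
rewrite (_ : t%:R * _ = 4 * t%:R * (2 * c / n + m%:R^-1)); last by ring.
rewrite lerD2l.
have -> : \sum_(i < t) 4^-1 ^+ i.+1 * \sum_(k in S) (4^-1 ^+ i.+1 / 4 < y k)%R%:R =
  \sum_(k in S) \sum_(i < t) 4^-1 ^+ i.+1 * (4^-1 ^+ i.+1 / 4 < y k)%R%:R :> R.
  by rewrite exchange_big; apply: eq_bigr => i _; rewrite mulr_sumr.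
rewrite (_ : 43 * _ / n = 8 / n * (\sum_(k in S) 43 / 8 * y k)); last first.
  by rewrite -mulr_sumr; field; rewrite gt_eqF.
rewrite ler_wpM2l ?divr_ge0 ?(ltW np) //; apply: ler_sum => k _.
have /andP[y0 y1] := y01 k.
have := @level_sum_le R t (16 * y k); rewrite mulr_ge0 // => /(_ isT).
have -> : \sum_(i < t) 4^-1 ^+ i.+1 * (4^-1 ^+ i.+1 / 4 < y k)%R%:R =
   4^-1 * \sum_(i < t) 4^-1 ^+ i * (4^-1 ^+ i < 16 * y k)%R%:R :> R.
  rewrite mulr_sumr; apply: eq_bigr => i _; rewrite exprS mulrA; congr (_ * _%:R).
  by congr nat_of_bool; rewrite -[in RHS]ltr_pdivrMl //; congr (_ < _); field.
lra.
Qed.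

Lemma card_atoms Q : #|{ffun 'I_Q -> atom N}| = ((4 * N).+1 ^ Q)%N.
Proof. by rewrite card_ffun card_option !card_prod card_ord card_bool card_ord -mulnA mulnC. Qed.

Lemma PB_net_event (x c kap : R) (m t : nat) : 0 <= x <= 1 -> (0 < m)%N -> 0 <= kap ->
  577 * ln (8 * m%:R) * ln (4 * N%:R + 1) + kap <= c ->
  PB x (fun S => ~ net_event x c m t S) <= t%:R * expR (- kap).
Proof.
move=> hx m0 kap0 hc.
have b0 := @bern_ge0 R N x hx.
apply: (@le_trans _ _ (PB x (fun S => exists i : 'I_t, exists o : {ffun 'I_(net_size m i) -> atom N},
   #|S :&: big_set o i|%:R + c * 4 ^+ i.+1 <= (1 - x) * #|big_set o i|%:R / 2))).
  apply: ler_PB => // S nS; apply: contrapT => h; apply: nS => i o; rewrite ltNge; apply/negP => h'.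
  by apply: h; exists i; exists o.
apply: le_trans (Pr_exists b0 _) _.
apply: (@le_trans _ _ (\sum_(i < t) expR (- kap))); last by rewrite sumr_const card_ord mulr_natl.
apply: ler_sum => i _; apply: le_trans (Pr_exists b0 _) _.
apply: (@le_trans _ _ (\sum_(o : {ffun 'I_(net_size m i) -> atom N}) expR (- (c * 4 ^+ i.+1)))).
  by apply: ler_sum => o _; exact: PB_card_lower.
rewrite sumr_const card_atoms -[_ *+ _]mulr_natl.
have l4 : 0 < 4 * N%:R + 1 :> R by rewrite ltr_wpDl // mulr_ge0.
have -> : ((4 * N).+1 ^ net_size m i)%:R = expR ((net_size m i)%:R * ln (4 * N%:R + 1)) :> R.
  by rewrite expRM_natl lnK ?posrE // natrX -natr1 natrM.
rewrite -expRD ler_expR.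
have e1 : 1 <= 4 ^+ i.+1 :> R by rewrite exprn_ege1 // ler1n.
have L1 : 1 <= ln (8 * m%:R) :> R.
  rewrite -ler_expR lnK ?posrE ?mulr_gt0 ?ltr0n //.
  apply: le_trans (expR1_le4 R) _; have : 1 <= m%:R :> R by rewrite ler1n.
  by move: (m%:R : R) => e; lra.
have lN : 0 <= ln (4 * N%:R + 1) :> R by rewrite ln_ge0 // lerDr mulr_ge0.
(* [577 = 576 + 1]: rounding up costs at most 1, and [4 ^ i.+1 * ln (8 m)] is at least 1. *)
have Q1 : (net_size m i)%:R <= 577 * 4 ^+ i.+1 * ln (8 * m%:R) :> R.
  rewrite /net_size -natr1; have : (Num.truncn (576 * 4 ^+ i.+1 * ln (8 * m%:R : R)))%:R <=
    576 * 4 ^+ i.+1 * ln (8 * m%:R) :> R.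
    by rewrite truncn_le // mulr_ge0 ?mulr_ge0 ?exprn_ge0 // (le_trans _ L1).
  have : 1 <= 4 ^+ i.+1 * ln (8 * m%:R) :> R by rewrite mulr_ege1.
  move: (4 ^+ i.+1 : R) (ln _) => a e; lra.
have : (net_size m i)%:R * ln (4 * N%:R + 1) <= 577 * 4 ^+ i.+1 * ln (8 * m%:R) * ln (4 * N%:R + 1) :> R.
  by rewrite ler_wpM2r.
have : (577 * ln (8 * m%:R) * ln (4 * N%:R + 1) + kap) * 4 ^+ i.+1 <= c * 4 ^+ i.+1.
  by rewrite ler_wpM2r // (le_trans _ e1).
have : kap <= kap * 4 ^+ i.+1 by rewrite ler_peMr.
lra.
Qed.

End HavivRegev.

(** * The discrete Fourier transform *)

Section Dft.
Variables (R : realType) (N : nat).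
Hypothesis N0 : (0 < N)%N.
Implicit Types (z : 'cV[R[i]]_N) (k j : 'I_N).

Lemma cisD (a b : R) : cis (a + b) = cis a * cis b.
Proof.
apply/eqP; rewrite eq_complex /= cosD sinD.
by apply/andP; split; apply/eqP; ring.
Qed.

Lemma cis0 : cis (0 : R) = 1.
Proof. by rewrite /cis cos0 sin0. Qed.

Lemma cis_conj (a : R) : (cis a)^*%C = cis (- a).
Proof. by rewrite /cis cosN sinN. Qed.

Lemma cis_norm (a : R) : normc (cis a) = 1.
Proof. by rewrite /= cos2Dsin2 sqrtr1. Qed.

Lemma cisMn (a : R) n : cis (n%:R * a) = cis a ^+ n.
Proof.
elim: n => [|n IH]; first by rewrite mul0r cis0.
by rewrite exprS -IH -cisD; congr cis; rewrite -natr1; ring.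
Qed.

Lemma cis_2pi : cis (2 * pi : R) = 1.
Proof. by rewrite mulr_natl /cis cos2pi sin2pi. Qed.

Lemma cis_2piz (n : int) : cis (2 * pi * n%:~R : R) = 1.
Proof.
case: n => n; first by rewrite mulrC cisMn cis_2pi expr1n.
rewrite NegzE rmorphN mulrN -cis_conj mulrC cisMn cis_2pi expr1n; exact: conjc1.
Qed.

Lemma cis_neq1 (a : R) : 0 < a < 2 * pi -> cis a != 1.
Proof.
move=> /andP[a0 a1]; apply/eqP => -[] /= h _.
have : 0 < sin (a / 2) by apply: sin_gt0_pi; apply/andP; split; lra.
have := cos2Dsin2 (a / 2); have := cos_mulr2n (a / 2).
have -> : a / 2 *+ 2 = a by rewrite -mulr_natr; field.
rewrite h [X in X - 1]mulr2n => h1 h2 h3; nra.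
Qed.

Let Np : 0 < N%:R :> R. Proof. by rewrite ltr0n. Qed.

Lemma dft_norm k j : normc (dft R N k j) = 1.
Proof. by rewrite mxE cis_norm. Qed.

Lemma dft_orth i j : \sum_k (dft R N k i)^*%C * dft R N k j = (i == j)%:R * N%:R.
Proof.
have [<-|ij] := eqVneq i j.
  rewrite mul1r; under eq_bigr => k _ do rewrite mulrC -normc_sqr_C dft_norm expr1n.
  by rewrite sumr_const card_ord.
rewrite mul0r; pose th : R := 2 * pi * (j%:R - i%:R) / N%:R; pose z := cis th.
(* A geometric sum of an [N]-th root of unity; the prefactor accounts for the frequencies starting
   at [1 - floor (N / 2)]. *)
have -> : \sum_k (dft R N k i)^*%C * dft R N k j = cis ((1 - (N./2)%:R) * th) * \sum_(k < N) z ^+ k.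
  rewrite mulr_sumr; apply: eq_bigr => k _; rewrite !mxE cis_conj -cisD /z -cisMn -cisD; congr cis.
  rewrite /freq /th rmorphD rmorphB /= -!natr1; field; by rewrite gt_eqF.
have zN : z ^+ N = 1.
  rewrite /z -cisMn /th -(cis_2piz (j%:Z - i%:Z)); congr cis.
  rewrite rmorphB /=; field; by rewrite gt_eqF.
have key (u : R) : 0 < u < N%:R -> cis (2 * pi * u / N%:R) != 1.
  move=> /andP[u0 u1]; apply: cis_neq1; have pi0 : 0 < 2 * pi :> R by rewrite mulr_gt0 // pi_gt0.
  rewrite divr_gt0 ?(mulr_gt0 pi0 u0) //= ltr_pdivrMr //.
  by rewrite ltr_pM2l.
have iN : i%:R < N%:R :> R by rewrite ltr_nat.
have jN : j%:R < N%:R :> R by rewrite ltr_nat.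
have i0 : 0 <= i%:R :> R by [].
have j0 : 0 <= j%:R :> R by [].
have z1 : z != 1.
  have [ji|ji] := ltP (i%:R : R) j%:R; first by apply: key; apply/andP; split; lra.
  have {ji}ij' : (j%:R : R) < i%:R by rewrite lt_neqAle ji andbT eqr_nat eq_sym.
  suff : cis (- th) != 1 by apply: contra => /eqP zz; rewrite -cis_conj -/z zz conjc1.
  have -> : - th = 2 * pi * (i%:R - j%:R) / N%:R by rewrite /th; field; rewrite gt_eqF.
  by apply: key; apply/andP; split; lra.
have : (z - 1) * \sum_(k < N) z ^+ k = 0 by rewrite -subrX1 zN subrr.
by move/eqP; rewrite mulf_eq0 subr_eq0 (negbTE z1) /= => /eqP->; rewrite mulr0.
Qed.

Lemma mulmx_dft z k : (dft R N *m z) k ord0 = fwd (dft R N) (fun j => z j ord0) k.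
Proof. by rewrite mxE. Qed.

Lemma dft_shift k j : dft R N k (ordS j) = cis (2 * pi * (freq k)%:~R / N%:R) * dft R N k j.
Proof.
rewrite !mxE -cisD /=; have := ltn_ord j; rewrite leq_eqVlt => /predU1P[jN|jN].
  (* At the last index the successor wraps to 0, and the exponents differ by an integer multiple of
     [2 pi]. *)
  rewrite jN modnn -[LHS]mulr1 -(cis_2piz (freq k)) -cisD; congr cis.
  by field; rewrite gt_eqF.
rewrite modn_small //; congr cis; rewrite -[j.+2%:R]natr1; field; by rewrite gt_eqF.
Qed.

Lemma dft_grad z k : normc (fwd (dft R N) (fun j => grad z j ord0) k) <=
  2 * normc (fwd (dft R N) (fun j => z j ord0) k).
Proof.
pose om := cis (2 * pi * (freq k)%:~R / N%:R) : R[i].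
have om1 : om^*%C * om = 1 by rewrite mulrC -normc_sqr_C cis_norm expr1n.
have -> : fwd (dft R N) (fun j => grad z j ord0) k =
   fwd (dft R N) (fun j => z j ord0) k - om^*%C * fwd (dft R N) (fun j => z j ord0) k.
  rewrite {1}/fwd; under eq_bigr do rewrite [grad z _ _]mxE mulrBr.
  rewrite sumrB; congr (_ - _); rewrite mulr_sumr [RHS](reindex_inj (@ordS_inj N)).
  by apply: eq_bigr => j _ /=; rewrite dft_shift !mulrA om1 mul1r.
apply: le_trans (le_normcD _ _) _; rewrite normcN ComplexField.Normc.normcM normc_conj cis_norm mul1r.
by rewrite mulr_natl.
Qed.

Lemma lpnorm2E z : lpnorm 2 z = nrm (fun j => z j ord0).
Proof.
rewrite /lpnorm /nrm /nrm2 -powR12_sqrt; last by apply: sumr_ge0 => j _; rewrite sqr_ge0.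
by congr (_ `^ _); apply: eq_bigr => j _; rewrite powR_mulrn ?normc_ge0.
Qed.

Lemma lpnorm1E z : lpnorm 1 z = \sum_j normc (z j ord0).
Proof.
rewrite /lpnorm invr1 powRr1; last by apply: sumr_ge0 => j _; exact: powR_ge0.
by apply: eq_bigr => j _; rewrite powRr1 ?normc_ge0.
Qed.

End Dft.

(** * From certificates to the error bounds *)

Section DualCertificates.
Variables (R : realType) (N : nat) (F : 'I_N -> 'I_N -> R[i]).
Hypothesis F1 : forall k j, normc (F k j) = 1.
Variable (Delta : {set 'I_N}).
Implicit Types (u w h d : 'I_N -> R[i]) (S : {set 'I_N}).

(** Where [d j] vanishes, the convention that the inverse of 0 is 0 yields the value 0. *)
Definition sign_pattern d j : R[i] := if j \in Delta then ((normc (d j))^-1)%:C%C * d j else 0.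
(** The conjugate cancels the one taken in the pairing with [h], which then gives the part of
    [fwd F h k] carried by [Delta]. *)
Definition freq_pattern (k j : 'I_N) : R[i] := if j \in Delta then (F k j)^*%C else 0.
Definition prefix_pattern (l j : 'I_N) : R[i] := if (j \in Delta) && (j < l)%N then 1 else 0.

Definition is_cert (m gam : R) u S w :=
  [/\ forall k, k \notin S -> w k = 0, nrm (residual F Delta u w) <= gam,
      forall j, j \notin Delta -> normc (adj F w j) <= 2^-1 &
      nrm w <= 26 * Num.sqrt (#|Delta|%:R / m)].

(* Pairing [h] with the [k]-th certificate expresses [fwd F h k], up to a
   small error, through the entries of [h] outside [Delta] only. *)
Definition dual_mx (w : 'I_N -> 'I_N -> R[i]) (k j : 'I_N) : R[i] :=
  if j \in Delta then 0 else (F k j - (adj F (w k) j)^*%C) / 2.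

Definition on_set S h k : R[i] := if k \in S then h k else 0.

(** On [Delta], [u] is [adj F w] plus the residual, so the left side is the pairing of [h] with
    [adj F w], up to the residual. Moved to the frequency side, that pairing sees [fwd F h] on [S]
    only. *)
Lemma cert_split (m gam : R) u S w h : (forall j, j \notin Delta -> u j = 0) -> is_cert m gam u S w ->
  normc (\sum_j (u j)^*%C * h j + \sum_(j | j \notin Delta) (adj F w j)^*%C * h j) <=
  nrm w * nrm (on_set S (fwd F h)) + gam * nrm h.
Proof.
move=> uD [w1 w2 w3 w4].
have -> : \sum_j (u j)^*%C * h j + \sum_(j | j \notin Delta) (adj F w j)^*%C * h j =
   \sum_j h j * (adj F w j)^*%C + \sum_j (residual F Delta u w j)^*%C * h j.
  rewrite [X in _ + X = _]big_mkcond -!big_split; apply: eq_bigr => j _ /=; rewrite /residual.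
  have [jD|jD] := boolP (j \in Delta).
    by rewrite [X in _ + X = _]/= rmorphB /=; ring.
  by rewrite [X in _ + X = _]/= uD // conjc0; ring.
apply: le_trans (le_normcD _ _) _; apply: lerD.
  rewrite -adj_dot (eq_bigr (fun k => (w k)^*%C * on_set S (fwd F h) k)) => [|k _].
    by apply: le_trans (normc_dot _ _) _; rewrite nrm_conj.
  by rewrite /on_set mulrC; case: ifPn => // /w1 ->; rewrite conjc0 !mul0r.
apply: le_trans (normc_dot _ _) _; rewrite nrm_conj ler_wpM2r ?nrm_ge0 //.
Qed.

Lemma cert_test (m gam : R) u S w h : (forall j, j \notin Delta -> u j = 0) -> is_cert m gam u S w ->
  normc (\sum_j (u j)^*%C * h j) <=
  nrm w * nrm (on_set S (fwd F h)) + gam * nrm h + 2^-1 * \sum_(j | j \notin Delta) normc (h j).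
Proof.
move=> uD wc; have := cert_split h uD wc; case: wc => _ _ w3 _.
set a := \sum_j _; set b := \sum_(j | _) _ * _ => ab.
have -> : a = (a + b) - b by rewrite addrK.
apply: le_trans (le_normcD _ _) _; rewrite normcN lerD //.
apply: le_trans (normc_sum _ _ _) _; rewrite mulr_sumr; apply: ler_sum => j jD.
by rewrite ComplexField.Normc.normcM normc_conj ler_wpM2r ?normc_ge0 // w3.
Qed.

(** On [Delta] the modulus of [d + h] is bounded below by its subgradient at [d], elsewhere by
    [|h| - |d|]. *)
Lemma sign_cone d h : \sum_j normc (d j + h j) <= \sum_j normc (d j) ->
  \sum_(j | j \notin Delta) normc (h j) <=
  2 * \sum_(j | j \notin Delta) normc (d j) + normc (\sum_j (sign_pattern d j)^*%C * h j).
Proof.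
set A := \sum_j (sign_pattern d j)^*%C * h j => hd.
have : - Re A <= normc A by have := normr_Re A; rewrite ler_norml => /andP[]; lra.
suff : \sum_(j | j \notin Delta) normc (h j) + Re A <=
  2 * \sum_(j | j \notin Delta) normc (d j) by lra.
have : \sum_j normc (d j) + Re A + \sum_(j | j \notin Delta) (normc (h j) - 2 * normc (d j)) <=
  \sum_j normc (d j + h j).
  rewrite /A Re_sum [X in _ + X]big_mkcond -!big_split /=; apply: ler_sum => j _.
  rewrite /sign_pattern; have [jD|jD] := boolP (j \in Delta); last first.
    rewrite conjc0 mul0r [Re 0]/= addr0.
    have e : d j + h j - d j = h j by rewrite addrAC subrr add0r.
    have := le_normcD (d j + h j) (- d j); rewrite e normcN.
    rewrite /=; lra.
  rewrite addr0.
  have [d0|d0] := eqVneq (normc (d j)) 0.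
    by rewrite d0 invr0 mul0r conjc0 mul0r add0r normc_ge0.
  have dp : 0 < normc (d j) by rewrite lt_def d0 normc_ge0.
  have -> : normc (d j) + Re ((((normc (d j))^-1)%:C%C * d j)^*%C * h j) =
     Re ((((normc (d j))^-1)%:C%C * d j)^*%C * (d j + h j)).
    rewrite mulrDr raddfD /=; congr (_ + _).
    have := normc_sqr (d j); case: (d j) dp => a b /=; set n := Num.sqrt _ => n0 nE.
    have -> : (n^-1 * a - 0 * b) * a - - (n^-1 * b + 0 * a) * b = n^-1 * (a ^+ 2 + b ^+ 2) by ring.
    by rewrite -nE expr2 mulrA mulVf ?mul1r // gt_eqF.
  apply: le_trans (ler_norm _) _; apply: le_trans (normr_Re _) _.
  rewrite !ComplexField.Normc.normcM normc_conj ComplexField.Normc.normcM normc_real.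
  by rewrite ger0_norm ?invr_ge0 ?normc_ge0 // mulVf // mul1r.
rewrite sumrB -mulr_sumr; lra.
Qed.

Lemma fwd_dual_mx (m gam : R) S (w : 'I_N -> 'I_N -> R[i]) h k : is_cert m gam (freq_pattern k) S (w k) ->
  normc (fwd F h k - 2 * apply_mx (dual_mx w) h k) <=
  nrm (w k) * nrm (on_set S (fwd F h)) + gam * nrm h.
Proof.
have uD j : j \notin Delta -> freq_pattern k j = 0 by rewrite /freq_pattern => /negbTE->.
move=> /(cert_split h uD); apply: le_trans; rewrite le_eqVlt; apply/orP; left; apply/eqP.
congr normc; rewrite /fwd /apply_mx mulr_sumr -sumrB [X in _ = _ + X]big_mkcond -big_split.
apply: eq_bigr => j _; rewrite /dual_mx /freq_pattern; have [jD|jD] := boolP (j \in Delta).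
  by rewrite conjcK /=; ring.
by rewrite conjc0 /=; field.
Qed.

Lemma dual_mx_le1 (m gam : R) S (w : 'I_N -> 'I_N -> R[i]) : (forall k, is_cert m gam (freq_pattern k) S (w k)) ->
  forall k j, normc (dual_mx w k j) <= 1.
Proof.
move=> wc k j; rewrite /dual_mx; case: ifPn => jD; first by rewrite ComplexField.Normc.normc0.
have [_ _ /(_ j jD) h _] := wc k.
rewrite ComplexField.Normc.normcM -(rmorph_nat (real_complex R)) -fmorphV normc_real ger0_norm ?invr_ge0 //.
have := le_normcD (F k j) (- (adj F (w k) j)^*%C); rewrite normcN normc_conj F1.
move: h; lra.
Qed.

Lemma apply_dual_mx_le (m gam : R) S (w : 'I_N -> 'I_N ->
  R[i]) h k : (forall k, is_cert m gam (freq_pattern k) S (w k)) ->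
  normc (2 * apply_mx (dual_mx w) h k) <= 3 / 2 * \sum_(j | j \notin Delta) normc (h j).
Proof.
move=> wc; rewrite /apply_mx mulr_sumr; apply: le_trans (normc_sum _ _ _) _.
rewrite mulr_sumr [leRHS]big_mkcond; apply: ler_sum => j _; rewrite /dual_mx.
case: (boolP (j \in Delta)) => jD /=; first by rewrite mul0r mulr0 ComplexField.Normc.normc0.
have [_ _ /(_ j jD) hw _] := wc k.
have -> : 2 * ((F k j - (adj F (w k) j)^*%C) / 2 * h j) =
  (F k j - (adj F (w k) j)^*%C) * h j by field.
rewrite ComplexField.Normc.normcM ler_wpM2r ?normc_ge0 //.
have := le_normcD (F k j) (- (adj F (w k) j)^*%C); rewrite normcN normc_conj F1; lra.
Qed.

End DualCertificates.

(** * Deterministic error bounds on a good sample *)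

Section Recovery.
Variables (R : realType) (N : nat).
Hypothesis N0 : (0 < N)%N.
Variables (Delta : {set 'I_N}) (x : 'cV[R[i]]_N) (m : nat) (delta n etac : R).
Local Notation F := (dft R N).
Local Notation s := (#|Delta|%:R : R).
Local Notation gam := (1024^-1 : R).
Local Notation coords z := (fun j => z j ord0).

(** Both subsamples are existential and the size cap concerns [S2] alone, so the event is monotone
    in [S]. *)
Definition good (S : {set 'I_N}) :=
  exists (S1 S2 : {set 'I_N}) (w0 : 'I_N -> R[i]) (wF wP : 'I_N -> 'I_N -> R[i]),
  [/\ S1 \subset S, S2 \subset S, (#|S2| <= m)%N &
   [/\ is_cert F Delta m%:R gam (sign_pattern Delta (coords (grad x))) S1 w0,
       forall k, is_cert F Delta m%:R gam (freq_pattern F Delta k) S1 (wF k),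
       forall l, is_cert F Delta m%:R gam (prefix_pattern R Delta l) S1 (wP l) &
       lower_isometry (dual_mx F Delta wF) n etac S2]].

Lemma good_mono (S S' : {set 'I_N}) : S \subset S' -> good S -> good S'.
Proof.
move=> sub [S1 [S2 [w0 [wF [wP [h1 h2 h3 h4]]]]]]; exists S1, S2, w0, wF, wP.
by split => //; exact: subset_trans sub.
Qed.

Lemma on_set_proj (S : {set 'I_N}) (z : 'cV[R[i]]_N) : coords (proj S z) =1 on_set S (coords z).
Proof. by move=> j; rewrite mxE. Qed.

Lemma colD (u v : 'cV[R[i]]_N) j : (u + v) j ord0 = u j ord0 + v j ord0.
Proof. by rewrite mxE. Qed.

Lemma colB (u v : 'cV[R[i]]_N) j : (u - v) j ord0 = u j ord0 - v j ord0.
Proof. by rewrite !mxE. Qed.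

Lemma on_set_le (S S' : {set 'I_N}) (h : 'I_N -> R[i]) : S \subset S' -> nrm (on_set S h) <=
  nrm (on_set S' h).
Proof.
move=> /subsetP sub; rewrite nrm_le ?nrm_ge0 // sqr_nrm; apply: ler_sum => k _; rewrite /on_set.
have [/sub ->//|_] := boolP (k \in S); rewrite ComplexField.Normc.normc0 expr0n; exact: sqr_ge0.
Qed.

Section Minimizer.
Variables (S : {set 'I_N}) (eta xh : 'cV[R[i]]_N).
Hypothesis m0 : (0 < m)%N.
Hypothesis mN : (m <= N)%N.
Hypothesis s1 : (0 < #|Delta|)%N.
Hypothesis delta0 : 0 <= delta.
Hypothesis goodS : good S.
Let Omega := S :|: freq0 N.
Let y := proj Omega (F *m x) + eta.
Hypothesis eta_le : lpnorm 2 eta <= Num.sqrt m%:R * delta.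
Hypothesis min : tv_minimizer Omega y (Num.sqrt m%:R * delta) xh.

Let z := xh - x.
Let h := coords (grad z).
Let H : R := nrm h.
Let B : R := \sum_(j | j \notin Delta) normc (h j).
Let sigma : R := \sum_(j | j \notin Delta) normc (grad x j ord0).
Let e : R := Num.sqrt s * delta.

Let mp : 0 < m%:R :> R. Proof. by rewrite ltr0n. Qed.
Let sp : 0 < s. Proof. by rewrite ltr0n. Qed.
Let Np : 0 < N%:R :> R. Proof. by rewrite ltr0n. Qed.
Let e0 : 0 <= e. Proof. by rewrite mulr_ge0 ?sqrtr_ge0. Qed.
Let sig0 : 0 <= sigma. Proof. by apply: sumr_ge0 => j _; exact: normc_ge0. Qed.
Let B0 : 0 <= B. Proof. by apply: sumr_ge0 => j _; exact: normc_ge0. Qed.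
Let H0 : 0 <= H. Proof. exact: nrm_ge0. Qed.

Let gradz j : h j = grad xh j ord0 - grad x j ord0.
Proof. rewrite /h /z !mxE; ring. Qed.

Let fwd_z_le : nrm (on_set Omega (fwd F (coords z))) <= 2 * (Num.sqrt m%:R * delta).
Proof.
have [feas _] := min; move: feas eta_le; rewrite /feasible !lpnorm2E => f1 f2.
have -> : nrm (on_set Omega (fwd F (coords z))) =
  nrm (fun j => (proj Omega (F *m xh) - y) j ord0 + eta j ord0).
  apply: eq_nrm => k; rewrite /y colB colD !on_set_proj /on_set; case: ifP => _; last by ring.
  rewrite !mulmx_dft opprD addrA subrK /fwd -sumrB; apply: eq_bigr => j _.
  by rewrite /z colB; ring.
apply: le_trans (nrmD _ _) _; lra.
Qed.

Let fwd_h_le (S' : {set 'I_N}) : S' \subset Omega ->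
  nrm (on_set S' (fwd F h)) <= 4 * (Num.sqrt m%:R * delta).
Proof.
move=> sub; apply: le_trans (on_set_le _ sub) _.
have -> : 4 * (Num.sqrt m%:R * delta) = 2 * (2 * (Num.sqrt m%:R * delta)) by ring.
apply: le_trans (_ : 2 * nrm (on_set Omega (fwd F (coords z))) <= _); last by rewrite ler_wpM2l.
rewrite nrm_le ?mulr_ge0 ?nrm_ge0 // exprMn sqr_nrm /nrm2 mulr_sumr; apply: ler_sum => k _.
rewrite /on_set; case: ifP => _; last by rewrite ComplexField.Normc.normc0 expr0n mulr0.
rewrite -exprMn lerXn2r ?nnegrE ?mulr_ge0 ?normc_ge0 //; exact: dft_grad.
Qed.

(** The factors [sqrt m] cancel: the data constraints leave [4 sqrt m delta] on the sample, and
    [26 * 4 = 104]. *)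
Let noise_le (S' : {set 'I_N}) (w : 'I_N -> R[i]) : S' \subset S -> nrm w <=
  26 * Num.sqrt (s / m%:R) ->
  nrm w * nrm (on_set S' (fwd F h)) <= 104 * e.
Proof.
move=> sub wle; have sub' : S' \subset Omega by apply: subset_trans sub (subsetUl _ _).
apply: le_trans (ler_pM (nrm_ge0 _) (nrm_ge0 _) wle (fwd_h_le sub')) _.
rewrite sqrtrM ?ler0n // sqrtrV ?ler0n // /e.
have sm : 0 < Num.sqrt m%:R :> R by rewrite sqrtr_gt0.
rewrite le_eqVlt; apply/orP; left; apply/eqP; field; by rewrite gt_eqF.
Qed.

Let tv_le : \sum_j normc (grad x j ord0 + h j) <= \sum_j normc (grad x j ord0).
Proof.
have [_ /(_ x)] := min; rewrite /tvnorm !lpnorm1E => tv.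
rewrite (eq_bigr (fun j => normc (grad xh j ord0))) => [|j _]; last by rewrite gradz subrKC.
apply: tv; rewrite /feasible lpnorm2E (@eq_nrm _ _ _ (fun j => - eta j ord0)).
  by rewrite nrmN -lpnorm2E.
by move=> k; rewrite /y colB colD; ring.
Qed.

Let H_le_sup (c : R) : 0 <= c -> (forall k, normc (fwd F h k) <= c) -> H <= c.
Proof.
move=> c0 hc; rewrite nrm_le // -(ler_pM2l Np) -(parseval (dft_orth R N0)).
apply: le_trans (_ : \sum_(k < N) c ^+ 2 <= _); last by rewrite sumr_const card_ord mulr_natl.
by apply: ler_sum => k _; rewrite lerXn2r ?nnegrE ?normc_ge0.
Qed.

(** Two coupled inequalities: the sign certificate bounds [B] by [sigma], [e], [gam * H] and
    [B / 2], while the frequency certificates bound every [fwd F h k], hence [H] by Parseval,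
    through [B]. Smallness of [gam] solves the system. The middle bound is what [prefix_le] uses. *)
Lemma tail_and_error_le :
  B <= 5 * sigma + 210 * e /\ 104 * e + gam * H + 3 / 2 * B <= 8 * sigma + 430 * e /\ H <=
    8 * sigma + 430 * e.
Proof.
have [S1 [S2 [w0 [wF [wP [sub1 _ _ [c0 cF _ _]]]]]]] := goodS.
have BE : B <= 2 * sigma + (104 * e + gam * H + 2^-1 * B).
  apply: le_trans (@sign_cone _ _ Delta (coords (grad x)) h tv_le) _; rewrite lerD2l.
  apply: le_trans (cert_test _ _ c0) _; first by move=> j; rewrite /sign_pattern => /negbTE->.
  by rewrite !lerD2r noise_le //; case: c0.
have HE : H <= 3 / 2 * B + (104 * e + gam * H).
  apply: H_le_sup => [|k]; first by have := H0; have := B0; have := e0; lra.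
  have -> : fwd F h k = 2 * apply_mx (dual_mx F Delta wF) h k + (fwd F h k - 2 * apply_mx (dual_mx F Delta wF) h k).
    by rewrite addrC subrK.
  apply: le_trans (le_normcD _ _) _; apply: lerD.
    by apply: apply_dual_mx_le cF; exact: dft_norm.
  by apply: le_trans (fwd_dual_mx h (cF k)) _; rewrite lerD2r noise_le //; case: (cF k).
move: BE HE B0 e0 sig0 H0; rewrite -/B; move: B H e sigma => ? ? ? ?; lra.
Qed.

Lemma prefix_le (l : 'I_N) : normc (z (Ordinal N0) ord0 - z l ord0) <= 8 * sigma + 430 * e.
Proof.
have [S1 [S2 [w0 [wF [wP [sub1 _ _ [_ _ cP _]]]]]]] := goodS.
have [_ [le2 _]] := tail_and_error_le.
have tele (q : nat) (qN : (q < N)%N) : \sum_(j < N | (j < q)%N) h j =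
  z (Ordinal N0) ord0 - z (Ordinal qN) ord0.
  elim: q qN => [|q IH] qN.
    by rewrite big_pred0 // (_ : Ordinal qN = Ordinal N0) ?subrr //; exact: val_inj.
  have qN' := ltnW qN; rewrite (bigD1 (Ordinal qN')) //=.
  rewrite (eq_bigl (fun j : 'I_N => (j < q)%N)) => [|j]; last first.
    by rewrite -val_eqE /= ltnS ltn_neqAle andbC.
  rewrite (IH qN') /h mxE (_ : ordS (Ordinal qN') = Ordinal qN); first by ring.
  by apply: val_inj; rewrite /= modn_small.
have -> : z (Ordinal N0) ord0 - z l ord0 = \sum_(j < N | (j < l)%N) h j.
  by rewrite (tele l (ltn_ord l)); congr (_ - z _ _); exact: val_inj.
rewrite (bigID (fun j => j \in Delta)) /=.
have -> : \sum_(j < N | (j < l)%N && (j \in Delta)) h j =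
  \sum_j (prefix_pattern R Delta l j)^*%C * h j.
  rewrite big_mkcond; apply: eq_bigr => j _; rewrite /prefix_pattern andbC.
  by case: ifP => _; rewrite ?conjc1 ?conjc0 ?mul1r ?mul0r.
(* [3 / 2] times [B]: one half from the certificate off [Delta], the whole from the entries of the
   prefix off [Delta]. *)
apply: le_trans (le_normcD _ _) _; apply: le_trans le2.
have h1 : normc (\sum_j (prefix_pattern R Delta l j)^*%C * h j) <= 104 * e + gam * H + 2^-1 * B.
  apply: le_trans (cert_test _ _ (cP l)) _.
    by move=> j; rewrite /prefix_pattern => /negbTE->.
  by rewrite !lerD2r noise_le //; case: (cP l).
have h2 : normc (\sum_(j < N | (j < l)%N && (j \notin Delta)) h j) <= B.
  apply: le_trans (normc_sum _ _ _) _; rewrite /B big_mkcond [leRHS]big_mkcond; apply: ler_sum => j _.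
  by case: (j < l)%N => //=; case: ifP => // _; exact: normc_ge0.
move: h1 h2; lra.
Qed.

Lemma signal_le : (1 < N)%N -> lpnorm 2 (x - xh) / Num.sqrt N%:R <= 16 * sigma + 862 * e.
Proof.
move=> N1; set X := 8 * sigma + 430 * e.
have X0 : 0 <= X by have := sig0; have := e0; rewrite /X; lra.
(* The ordinal that encodes frequency 0. It fixes the mean of [z], while [prefix_le] bounds the
   differences of its entries. *)
have k0N : (N./2.-1 < N)%N by apply: leq_ltn_trans (leq_pred _) _; rewrite -divn2 ltn_Pdiv.
pose k0 := Ordinal k0N.
have fk0 : freq k0 = 0.
  rewrite /freq /= -subn1 -subzn ?half_gt0 //; ring.
have d2 : normc (\sum_j z j ord0) <= 2 * (Num.sqrt m%:R * delta).
  have -> : \sum_j z j ord0 = on_set Omega (fwd F (coords z)) k0.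
    rewrite /on_set inE [k0 \in freq0 N]inE fk0 eqxx orbT /fwd; apply: eq_bigr => j _.
    by rewrite [F _ _]mxE fk0 mulr0z mulr0 !mul0r cis0 mul1r.
  exact: le_trans (normc_le_nrm (on_set Omega (fwd F (coords z))) k0) fwd_z_le.
have sN : Num.sqrt m%:R <= N%:R :> R.
  rewrite -[leRHS](ger0_norm (ler0n R N)) -sqrtr_sqr ler_wsqrtr // -natrX ler_nat (leq_trans mN) //.
  by rewrite expnS expn1 leq_pmulr.
have de : delta <= e by rewrite /e ler_peMl // -[leLHS]sqrtr1 ler_wsqrtr // ler1n.
have z0 : normc (z (Ordinal N0) ord0) <= X + 2 * e.
  have zE : N%:R * z (Ordinal N0) ord0 = \sum_j z j ord0 + \sum_j (z (Ordinal N0) ord0 - z j ord0).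
    by rewrite sumrB sumr_const card_ord mulr_natl addrC subrK.
  have nE : normc (N%:R * z (Ordinal N0) ord0) = N%:R * normc (z (Ordinal N0) ord0).
    by rewrite ComplexField.Normc.normcM -(rmorph_nat (real_complex R)) normc_real normr_nat.
  have t1 : normc (\sum_j (z (Ordinal N0) ord0 - z j ord0)) <= N%:R * X.
    apply: le_trans (normc_sum _ _ _) _; apply: (@le_trans _ _ (\sum_(j < N) X)).
      by apply: ler_sum => j _; exact: prefix_le.
    by rewrite sumr_const card_ord mulr_natl.
  have t2 : 2 * (Num.sqrt m%:R * delta) <= N%:R * (2 * e).
    have : Num.sqrt m%:R * delta <= N%:R * e by rewrite ler_pM ?sqrtr_ge0.
    lra.
  rewrite -(ler_pM2l Np) -nE zE mulrDr; apply: le_trans (le_normcD _ _) _.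
  by move: t1 t2 d2; lra.
have zl j : normc (z j ord0) <= 2 * X + 2 * e.
  have -> : z j ord0 = z (Ordinal N0) ord0 - (z (Ordinal N0) ord0 - z j ord0) by rewrite opprB addrC subrK.
  apply: le_trans (le_normcD _ _) _; rewrite normcN; have := prefix_le j; rewrite -/X; lra.
have -> : 16 * sigma + 862 * e = 2 * X + 2 * e by rewrite /X; ring.
rewrite ler_pdivrMr ?sqrtr_gt0 // lpnorm2E (@eq_nrm _ _ _ (fun j => - z j ord0)) => [|j]; last first.
  by rewrite /z !mxE; ring.
rewrite nrmN nrm_le; last by rewrite mulr_ge0 ?sqrtr_ge0 //; have := e0; lra.
rewrite exprMn sqr_sqrtr //; apply: (@le_trans _ _ (\sum_(j < N) (2 * X + 2 * e) ^+ 2)); last first.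
  by rewrite sumr_const card_ord mulr_natr.
apply: ler_sum => j _.
by rewrite lerXn2r ?nnegrE ?normc_ge0 //; have := e0; lra.
Qed.

(** [fwd F h] is [2 * apply_mx M h] up to [rho] in every row. On the sample [fwd F h] is small by
    the constraints, so [apply_mx M h] is too; the isometry extends this to all rows, and Parseval
    returns to [h]. *)
Lemma gradient_sqr_le : 0 < n -> m%:R <= 16 * n -> 0 <= etac ->
  H ^+ 2 <= (100 * (80 * e)) ^+ 2 + 9 * etac * B ^+ 2.
Proof.
move=> np mn eta0; have [S1 [S2 [w0 [wF [wP [sub1 sub2 S2m [_ cF _ iso]]]]]]] := goodS.
pose M := dual_mx F Delta wF; set rho := 104 * e + gam * H.
have rho0 : 0 <= rho by have := H0; have := e0; rewrite /rho; lra.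
have diff k : normc (fwd F h k - 2 * apply_mx M h k) <= rho.
  by apply: le_trans (fwd_dual_mx h (cF k)) _; rewrite lerD2r noise_le //; case: (cF k).
have sq_le (a b c : R) : 0 <= a -> 0 <= b -> a <= b + c -> a ^+ 2 <= 2 * b ^+ 2 + 2 * c ^+ 2.
  move=> a0 b0 abc; have : a ^+ 2 <= (b + c) ^+ 2 by rewrite lerXn2r ?nnegrE // (le_trans a0).
  have := sqr_ge0 (b - c); lra.
have n2 (u : R[i]) : normc (2 * u) = 2 * normc u.
  by rewrite ComplexField.Normc.normcM -(rmorph_nat (real_complex R)) normc_real normr_nat.
have up k : normc (fwd F h k) ^+ 2 <= 8 * normc (apply_mx M h k) ^+ 2 + 2 * rho ^+ 2.
  have := sq_le _ (normc (2 * apply_mx M h k)) rho (normc_ge0 (fwd F h k)) (normc_ge0 _).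
  rewrite n2 exprMn => h1; apply: le_trans (h1 _) _; last lra.
  rewrite -n2; have := le_normcD (fwd F h k - 2 * apply_mx M h k) (2 * apply_mx M h k).
  rewrite subrK; have := diff k; lra.
have down k : normc (apply_mx M h k) ^+ 2 <= 2^-1 * (normc (fwd F h k) ^+ 2 + rho ^+ 2).
  have := sq_le _ (normc (fwd F h k)) rho (normc_ge0 (2 * apply_mx M h k)) (normc_ge0 _).
  rewrite n2 exprMn => h1; have := h1 _; rewrite -n2 => h2.
  suff : normc (2 * apply_mx M h k) <= normc (fwd F h k) + rho by move/h2; lra.
  have := le_normcD (fwd F h k) (- (fwd F h k - 2 * apply_mx M h k)).
  rewrite normcN opprB addrC subrK; have := diff k; lra.
have isoB : (\sum_k normc (apply_mx M h k) ^+ 2) / N%:R <=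
   43 * (\sum_(k in S2) normc (apply_mx M h k) ^+ 2) / n + etac * B ^+ 2.
  (* The columns of [M] in [Delta] vanish, so [h] may be cut off there. The isometry is then applied
     to [b / B], the case [B = 0] being separate. *)
  pose b j := if j \in Delta then 0 else h j.
  have bE k : apply_mx M b k = apply_mx M h k.
    by apply: eq_bigr => j _; rewrite /M /dual_mx /b; case: ifP => // _; rewrite !mul0r.
  have bB : \sum_j normc (b j) = B.
    rewrite /B [RHS]big_mkcond; apply: eq_bigr => j _; rewrite /b.
    by have [jD|jD] := boolP (j \in Delta); rewrite ?ComplexField.Normc.normc0.
  have [BZ|Bn] := eqVneq B 0.
    have b00 j : b j = 0.
      apply/ComplexField.Normc.eq0_normc/eqP; move: BZ; rewrite -bB => /eqP.
      by rewrite psumr_eq0 => [/allP/(_ j)|i _]; [rewrite mem_index_enum =>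
        /(_ isT) | exact: normc_ge0].
    have z00 k : normc (apply_mx M h k) ^+ 2 = 0.
      rewrite -bE /apply_mx big1 => [|j _]; last by rewrite b00 mulr0.
      by rewrite ComplexField.Normc.normc0 expr0n.
    by rewrite BZ !big1 ?mul0r ?mulr0 ?mul0r ?expr0n ?mulr0 ?addr0.
  have Bp : 0 < B by rewrite lt_def Bn.
  pose c := (B^-1)%:C%C : R[i].
  have nc : normc c = B^-1 by rewrite normc_real ger0_norm // invr_ge0 ltW.
  have := iso (fun j => c * b j) _; rewrite (_ : \sum_j _ = 1); last first.
    under eq_bigr do rewrite ComplexField.Normc.normcM nc.
    by rewrite -mulr_sumr bB mulVf.
  move=> /(_ (lexx _)).
  have cE k : normc (apply_mx M (fun j => c * b j) k) ^+ 2 = B^-1 ^+ 2 * normc (apply_mx M h k) ^+ 2.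
    rewrite -exprMn -nc -ComplexField.Normc.normcM -bE /apply_mx mulr_sumr; congr (normc _ ^+ 2).
    by apply: eq_bigr => j _; ring.
  rewrite -/M; under eq_bigr do rewrite cE; rewrite -mulr_sumr.
  under [in X in _ <= X]eq_bigr do rewrite cE; rewrite -mulr_sumr.
  have BB : 0 < B ^+ 2 by rewrite exprn_gt0.
  rewrite -(ler_pM2l BB) exprVn.
  set u := \sum_k _; set v := \sum_(k in S2) _.
  have -> : B ^+ 2 * ((B ^+ 2)^-1 * u / N%:R) = u / N%:R by field; rewrite !gt_eqF.
  by have -> : B ^+ 2 * (43 * ((B ^+ 2)^-1 * v) / n + etac) =
    43 * v / n + etac * B ^+ 2 by field; rewrite !gt_eqF.
have S2sum : \sum_(k in S2) normc (apply_mx M h k) ^+ 2 <=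
  2^-1 * (16 * m%:R * delta ^+ 2 + m%:R * rho ^+ 2).
  apply: le_trans (_ : \sum_(k in S2) 2^-1 * (normc (fwd F h k) ^+ 2 + rho ^+ 2) <= _).
    by apply: ler_sum => k _; exact: down.
  rewrite -mulr_sumr ler_wpM2l ?invr_ge0 // big_split /= sumr_const; apply: lerD.
    have subO : S2 \subset Omega by apply: subset_trans sub2 (subsetUl _ _).
    have := fwd_h_le subO; rewrite nrm_le; last by rewrite !mulr_ge0 ?sqrtr_ge0.
    rewrite !exprMn sqr_sqrtr // => h1; apply: le_trans (le_trans _ h1) _; last lra.
    rewrite /nrm2 big_mkcond; apply: ler_sum => k _; rewrite /on_set.
    by case: ifP => _; rewrite ?ComplexField.Normc.normc0 ?expr0n.
  by rewrite -[leLHS]mulr_natl ler_wpM2r ?sqr_ge0 // ler_nat.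
have HN : H ^+ 2 <= 8 * ((\sum_k normc (apply_mx M h k) ^+ 2) / N%:R) + 2 * rho ^+ 2.
  rewrite -(ler_pM2l Np) sqr_nrm -(parseval (dft_orth R N0)).
  apply: le_trans (_ : \sum_k (8 * normc (apply_mx M h k) ^+ 2 + 2 * rho ^+ 2) <= _).
    by apply: ler_sum => k _; exact: up.
  rewrite big_split /= sumr_const card_ord -mulr_sumr -mulr_natl.
  rewrite le_eqVlt; apply/orP; left; apply/eqP; field; by rewrite gt_eqF.
have S2n : 43 * (\sum_(k in S2) normc (apply_mx M h k) ^+ 2) / n <=
  344 * (16 * delta ^+ 2 + rho ^+ 2).
  rewrite ler_pdivrMr //; have dr : 0 <= 16 * delta ^+ 2 + rho ^+ 2 by rewrite addr_ge0 ?mulr_ge0 ?sqr_ge0.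
  have : m%:R * (16 * delta ^+ 2 + rho ^+ 2) <= 16 * n * (16 * delta ^+ 2 + rho ^+ 2) by rewrite ler_wpM2r.
  move: S2sum; lra.
have de : delta ^+ 2 <= e ^+ 2.
  by rewrite lerXn2r ?nnegrE // /e ler_peMl // -[leLHS]sqrtr1 ler_wsqrtr // ler1n.
have rhoE : rho ^+ 2 <= 2 * (104 * e) ^+ 2 + 2 * (gam * H) ^+ 2.
  by apply: sq_le => //; rewrite mulr_ge0.
(* The right side contains [H ^+ 2] with coefficient [2 * (8 * 344 + 2) / 1024 ^ 2], below
   [1 / 100]. Absorbing it turns the 8 before [etac] into 9. *)
move: HN isoB S2n de rhoE; rewrite !exprMn; have := sqr_ge0 H; have := sqr_ge0 e.
have : 0 <= etac * B ^+ 2 by rewrite mulr_ge0 ?sqr_ge0.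
move: (_ / N%:R) (_ / n) (rho ^+ 2) (H ^+ 2) (e ^+ 2) (delta ^+ 2).
move=> a1 a2 a3 a4 a5 a6; rewrite -mulrA; move: (etac * B ^+ 2) => a7; lra.
Qed.

End Minimizer.
End Recovery.

(** * Probability of success *)

Section Numerics.
Variable R : realType.

Lemma mul_expRN_le (a X eps : R) : 0 < a -> 0 < eps -> ln (8 * a) + ln eps^-1 <= X ->
  a * expR (- X) <= eps / 8.
Proof.
move=> a0 e0 h; have a8 : 0 < 8 * a by rewrite mulr_gt0.
have : expR (- X) <= expR (- (ln (8 * a) + ln eps^-1)) by rewrite ler_expR lerN2.
rewrite opprD expRD !expRN !lnK ?posrE ?invr_gt0 // invrK => h1.
apply: le_trans (ler_wpM2l (ltW a0) h1) _.
by rewrite le_eqVlt; apply/orP; left; apply/eqP; field; rewrite gt_eqF.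
Qed.

Lemma ln2_ge_half : 2^-1 <= ln 2 :> R.
Proof. by rewrite -ler_expR lnK ?posrE // expR_half_le2. Qed.

Lemma ln_pow2M (c : nat) (a : R) : 2 <= a -> ln (2 ^+ c * a) <= c.+1%:R * ln a.
Proof.
move=> a2; have a0 : 0 < a by apply: lt_le_trans a2.
rewrite lnM ?posrE ?exprn_gt0 // lnXn // -[ln 2 *+ c]mulr_natl -(natr1 c) mulrDl mul1r lerD2r.
by rewrite ler_wpM2l // ler_ln ?posrE.
Qed.

End Numerics.

Section SuccessProbability.
Variables (R : realType) (N : nat) (Delta : {set 'I_N}) (m : nat) (eps : R).
Local Notation s := (#|Delta|%:R : R).
Hypothesis s2 : (2 <= #|Delta|)%N.
Hypothesis mN : (m <= N)%N.
Hypothesis eps01 : 0 < eps < 1.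
Hypothesis m_large : 1000 * 1000 * s * (1 + ln eps^-1) * ln N%:R <= m%:R.

Let lam : R := (1 + ln eps^-1) * ln N%:R.
Let L : R := logfactor R m #|Delta|.

Let N2 : (2 <= N)%N.
Proof. by apply: leq_trans s2 _; rewrite -[leqRHS]card_ord max_card. Qed.

Let N0 : (0 < N)%N. Proof. exact: ltnW. Qed.
Let s0 : (0 < #|Delta|)%N. Proof. exact: ltnW. Qed.
Let eps0 : 0 < eps. Proof. by case/andP: eps01. Qed.
Let s2R : 2 <= s. Proof. by rewrite ler_nat. Qed.
Let N2R : 2 <= N%:R :> R. Proof. by rewrite ler_nat. Qed.
Let lne0 : 0 <= ln eps^-1.
Proof. by case/andP: eps01 => e0 e1; rewrite ln_ge0 // invf_ge1 // ltW. Qed.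
Let lnN : 2^-1 <= ln N%:R :> R.
Proof. by rewrite (le_trans (ln2_ge_half R)) // ler_ln ?posrE ?ltr0n. Qed.
Let lam_lnN : ln N%:R <= lam.
Proof. by rewrite /lam ler_peMl ?lerDl //; have := lnN; lra. Qed.
Let lam_lne : ln eps^-1 <= 2 * lam.
Proof. rewrite /lam; move: lne0 lnN; move: (ln _) (ln _) => a b; nra. Qed.
Let lam_half : 2^-1 <= lam. Proof. exact: le_trans lam_lnN. Qed.
Let ms : 1000 * 1000 * (s * lam) <= m%:R.
Proof. by rewrite /lam !mulrA. Qed.
Let slam : 1 <= s * lam.
Proof. by move: s2R lam_half; move: (s) lam => a b; nra. Qed.
Let m_big : 1000 * 1000 <= m%:R :> R. Proof. by move: ms slam; lra. Qed.
Let m0 : (0 < m)%N. Proof. by rewrite -(ltr0n R); apply: lt_le_trans m_big; rewrite mulr_gt0. Qed.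
Let m2 : 2 <= m%:R :> R. Proof. by move: m_big; lra. Qed.
Let lnm1 : 1 <= ln m%:R :> R.
Proof.
rewrite -ler_expR lnK ?posrE ?ltr0n //; apply: le_trans (expR1_le4 R) _.
by move: m_big; lra.
Qed.
Let lns : 2^-1 <= ln s.
Proof. by rewrite (le_trans (ln2_ge_half R)) // ler_ln ?posrE ?ltr0n. Qed.
Let lns_lnN : ln s <= ln N%:R.
Proof. by rewrite ler_ln ?posrE ?ltr0n // ler_nat -[leqRHS]card_ord max_card. Qed.

Let tl := trunc_log 4 #|Delta|.
Let tl_ln : tl%:R <= ln s.
Proof.
have /andP[h _] := trunc_log_bounds (isT : 1 < 4)%N s0.
apply: (@le_trans _ _ (ln (4 ^ tl)%:R)); last by rewrite ler_ln ?posrE ?ltr0n ?expn_gt0 // ler_nat.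
have l4 : 1 <= ln 4 :> R.
  have -> : 4 = 2 * 2 :> R by ring.
  by rewrite lnM ?posrE //; have := ln2_ge_half R; lra.
by rewrite natrX lnXn // -[leRHS]mulr_natr ler_peMl.
Qed.
Let tl_s : s <= 4 ^+ tl.+1.
Proof.
by have /andP[_ /ltnW h] := trunc_log_bounds (isT : 1 < 4)%N s0; rewrite -natrX ler_nat.
Qed.

Let F := dft R N.
Let F1 : forall k j, normc (F k j) = 1. Proof. exact: dft_norm. Qed.
Let Forth : forall i j, \sum_k (F k i)^*%C * F k j = (i == j)%:R * N%:R. Proof. exact: dft_orth. Qed.
Let gam : R := 1024^-1.
Let xe : R := excl N (m%:R / 8).

Let xe01 : 0 <= xe <= 1.
Proof. by apply: excl_in => //; rewrite divr_ge0. Qed.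

Lemma cert_fail (u : 'I_N -> R[i]) : (forall j, j \notin Delta -> u j = 0) ->
  (forall j, normc (u j) <= 1) ->
  PB xe (fun S => ~ exists w, is_cert F Delta m%:R gam u S w) <= expR (- (m%:R / (16384 * s))).
Proof.
move=> uD u1.
have mp : 0 < m%:R :> R by rewrite ltr0n.
have g0 : 0 < gam by rewrite invr_gt0.
have sp : 0 < s by rewrite ltr0n.
have ur : nrm u <= 4^-1 ^+ 0 * Num.sqrt s.
  rewrite mul1r ler_wsqrtr // /nrm2 -sum1_card natr_sum [leRHS]big_mkcond; apply: ler_sum => j _.
  have [jD|jD] := boolP (j \in Delta); first by rewrite exprn_ile1 ?normc_ge0.
  by rewrite uD // ComplexField.Normc.normc0 expr0n.
have st p : stime Delta (m%:R : R) p <= N%:R.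
  apply: (@le_trans _ _ m%:R); last by rewrite ler_nat.
  have h1 : m%:R / 64 * 2^-1 ^+ p <= m%:R / 64 :> R by rewrite ler_piMr ?half_exp_le1 // divr_ge0.
  have h2 : s * 2^-1 <= s * lam by rewrite ler_wpM2l // ltW.
  by rewrite /stime; have := ms; have := slam; lra.
have NE : 2 * N%:R * expR (- (m%:R / (64 * s) / 256)) <= 4^-1 :> R.
  have : N%:R * expR (- (m%:R / (64 * s) / 256)) <= 1 / 8 :> R.
    apply: mul_expRN_le; rewrite ?ltr0n // invr1 ln1 addr0.
    have -> : 8 = 2 ^+ 3 :> R by ring.
    apply: le_trans (ln_pow2M 3 N2R) _.
    rewrite -mulrA -invfM ler_pdivlMr ?mulr_gt0 //.
    have : ln N%:R * s <= lam * s by rewrite ler_wpM2r // ltW.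
    by have := ms; have := slam; lra.
  lra.
(* Five stages produce [gam = 4^-5]; the other [tl.+1] undo the initial norm [sqrt s]. *)
have gl : 4^-1 ^+ (0 + (5 + tl.+1)) * Num.sqrt s <= gam.
  rewrite add0n exprD (_ : 4^-1 ^+ 5 = gam); last by rewrite /gam; field.
  rewrite -mulrA ger_pMr // exprVn mulrC ler_pdivrMr ?exprn_gt0 // mul1r; apply: le_trans tl_s.
  rewrite -[leRHS](sqr_sqrtr (ltW sp)) expr2 ler_peMl ?sqrtr_ge0 //.
  by rewrite -[leLHS]sqrtr1 ler_wsqrtr // ler1n.
have T0 : 0 <= m%:R / 8 :> R by rewrite divr_ge0.
have := golfing_rec F1 Forth s0 N0 mp st NE uD ur gl T0.
rewrite -/xe => hg; apply: (@le_trans _ _ (PB xe (fun S => ~ cert F Delta m%:R gam 0 u S))).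
  apply: ler_PB => // S nc [w [w1 w2 w3 w4]]; apply: nc; exists w; split => //.
    by move=> j jD; have := w3 j jD; rewrite expr0 mul1r.
  by move: w4; rewrite expr0 mulr1.
apply: le_trans hg _; rewrite ler_expR ler_pdivrMr ?mulr_gt0 //.
(* The budget is at most [m / 16 + m / 32] out of the available time [m / 8]. The surplus [m / 32],
   divided by [512 s], is the exponent. *)
have := budget_le Delta mp 0 (5 + tl.+1); rewrite expr0 mulr1.
have -> : - (m%:R / (16384 * s)) * (512 * s) = - (m%:R / 32) by field; rewrite gt_eqF.
rewrite natrD -(natr1 tl).
have : s * tl%:R <= s * lam.
  by rewrite ler_wpM2l ?(ltW sp) // (le_trans tl_ln) // (le_trans lns_lnN).
have : s * 2^-1 <= s * lam by rewrite ler_wpM2l ?(ltW sp).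
have := ms; have := slam; move: (budget _ _ _ _) => bb; lra.
Qed.

(** [24 = 8 * 3]: the union over [t <= 3 m] levels is to fail with probability at most [eps / 8]. *)
Let kap : R := ln (24 * m%:R) + ln eps^-1.
Let c0 : R := 577 * ln (8 * m%:R) * ln (4 * N%:R + 1) + kap.
(** Enough levels for the truncation error [4^-t] to be at most [1 / s]. *)
Let t := tl.+1.
Let n : R := (1 - xe) * N%:R.
Definition iso_error : R := 4^-1 ^+ t + 4 * t%:R * (2 * c0 / n + m%:R^-1).

Lemma sample_size_ge : m%:R <= 16 * n.
Proof.
have h : m%:R / 8 / 2 <= n.
  apply: excl_half => //; rewrite divr_gt0 ?ltr0n //=.
  have : m%:R <= N%:R :> R by rewrite ler_nat.
  by have := m2; lra.
lra.
Qed.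

Lemma kap_ge0 : 0 <= kap.
Proof. by rewrite addr_ge0 // ln_ge0 //; have := m2; lra. Qed.

Lemma c0_ge0 : 0 <= c0.
Proof.
rewrite addr_ge0 ?kap_ge0 // !mulr_ge0 // ln_ge0 //; first by have := m2; lra.
by have := N2R; lra.
Qed.

(** [c0] is of order [ln m * lam] and [n] of order [m >= 10^6 s lam], so each level costs
    [ln m / s]: the sampling condition absorbs [ln N] and [ln (1 / eps)]. The number of levels is of
    order [ln s]. *)
Lemma iso_error_bounds : 0 <= iso_error <= 800 * (L ^+ 2 / s).
Proof.
have mp : 0 < m%:R :> R by rewrite ltr0n.
have sp : 0 < s by rewrite ltr0n.
have np : 0 < n by have := sample_size_ge; lra.
have ln8m : ln (8 * m%:R) <= 4 * ln m%:R :> R.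
  have -> : 8 = 2 ^+ 3 :> R by ring.
  exact: ln_pow2M.
have ln8m0 : 0 <= ln (8 * m%:R) :> R by rewrite ln_ge0 //; have := m2; lra.
have ln4N : ln (4 * N%:R + 1) <= 4 * ln N%:R :> R.
  apply: le_trans (ln_pow2M 3 N2R); rewrite ler_ln ?posrE ?mulr_gt0 ?exprn_gt0 ?ltr0n //; have :=
    N2R; lra.
have ln4N0 : 0 <= ln (4 * N%:R + 1) :> R by rewrite ln_ge0 //; have := N2R; lra.
have ln24m : ln (24 * m%:R) <= 6 * ln m%:R :> R.
  apply: le_trans (ln_pow2M 5 m2); rewrite ler_ln ?posrE ?mulr_gt0 ?exprn_gt0 //; have := m2; lra.
have c00 := c0_ge0.
have c0le : c0 <= 10000 * (ln m%:R * lam).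
  have h1 : ln (8 * m%:R) * ln (4 * N%:R + 1) <= (4 * ln m%:R) * (4 * lam).
    apply: ler_pM => //; apply: le_trans ln4N _; by rewrite ler_wpM2l.
  have h2 : ln m%:R * 2^-1 <= ln m%:R * lam by rewrite ler_wpM2l // (le_trans _ lnm1).
  have h3 : lam <= ln m%:R * lam by rewrite ler_peMl // (le_trans _ lam_half) // invr_ge0.
  rewrite /c0 /kap -mulrA; move: lam_lne ln24m; lra.
have LE : L ^+ 2 = ln m%:R * ln s ^+ 2.
  by rewrite /L /logfactor exprMn sqr_sqrtr // (le_trans _ lnm1).
have cn : 2 * c0 / n <= ln m%:R / s.
  rewrite ler_pdivrMr // mulrAC ler_pdivlMr //.
  have h1 : s * c0 <= s * (10000 * (ln m%:R * lam)) by rewrite ler_wpM2l // ltW.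
  have h2 : ln m%:R * (1000 * 1000 * (s * lam)) <= ln m%:R * m%:R by rewrite ler_wpM2l // (le_trans _ lnm1).
  have h3 : ln m%:R * m%:R <= ln m%:R * (16 * n) by rewrite ler_wpM2l ?sample_size_ge // (le_trans _ lnm1).
  have h4 : 0 <= ln m%:R * (s * lam).
    by rewrite mulr_ge0 ?(le_trans _ lnm1) ?(le_trans _ slam).
  lra.
have mi : m%:R^-1 <= ln m%:R / s.
  rewrite ler_pdivlMr // ler_pdivrMl //.
  have h2 : m%:R * 1 <= m%:R * ln m%:R :> R by rewrite ler_wpM2l.
  have : s * 2^-1 <= s * lam by rewrite ler_wpM2l ?(ltW sp).
  by have := ms; have := slam; lra.
have ti : 4^-1 ^+ t <= s^-1 by rewrite exprVn lef_pV2 ?posrE ?exprn_gt0.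
have tle : t%:R <= 3 * ln s by rewrite /t -natr1; have := tl_ln; have := lns; lra.
apply/andP; split.
  apply: addr_ge0; first by rewrite exprn_ge0 ?invr_ge0.
  apply: mulr_ge0; first by rewrite mulr_ge0.
  apply: addr_ge0; last by rewrite invr_ge0.
  by apply: divr_ge0; [rewrite mulr_ge0|exact: ltW].
have -> : 800 * (L ^+ 2 / s) = 800 * ln m%:R * ln s ^+ 2 * s^-1 by rewrite LE; ring.
have h1 : 4 * t%:R * (2 * c0 / n + m%:R^-1) <= 4 * (3 * ln s) * (2 * (ln m%:R / s)).
  apply: ler_pM.
  - by rewrite mulr_ge0.
  - apply: addr_ge0; last by rewrite invr_ge0.
    by apply: divr_ge0; [rewrite mulr_ge0|exact: ltW].
  - by rewrite ler_wpM2l.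
  - by have := cn; have := mi; lra.
have si : 0 <= s^-1 by rewrite invr_ge0 ltW.
have h2 : 1 <= 4 * (ln m%:R * ln s ^+ 2).
  have : 4^-1 <= ln s ^+ 2 by have := lns; nra.
  move: lnm1; move: (ln m%:R) (_ ^+ 2) => a b; nra.
have h3 : ln m%:R * ln s <= 2 * (ln m%:R * ln s ^+ 2).
  have : ln s <= 2 * ln s ^+ 2 by have := lns; nra.
  move: lnm1; move: (ln m%:R) (ln s) (_ ^+ 2) => a b c; nra.
rewrite /iso_error; apply: le_trans (lerD ti h1) _.
have -> : s^-1 + 4 * (3 * ln s) * (2 * (ln m%:R / s)) = (1 + 24 * (ln m%:R * ln s)) * s^-1 by ring.
rewrite ler_wpM2r //; move: h2 h3; rewrite -mulrA; move: (_ * _) (_ * _ ^+ 2) => a b; lra.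
Qed.

Lemma card_fail (T : R) : 0 <= T -> T <= m%:R / 4 ->
  PB (excl N T) (fun S : {set 'I_N} => (m < #|S|)%N) <= eps / 8.
Proof.
move=> T0 Tm; have hx : 0 <= excl N T <= 1 by exact: excl_in.
have Np : 0 < N%:R :> R by rewrite ltr0n.
apply: le_trans (PB_card_gt hx _) _.
  have := expR_ge1Dx (- (T / N%:R)); rewrite -/(excl N T) => h.
  apply: le_trans Tm; rewrite mulrC -ler_pdivlMr //; lra.
rewrite -[leLHS]mul1r; apply: mul_expRN_le => //.
have h8 : ln (8 * 1) <= 3%:R * ln N%:R :> R.
  have -> : 8 * 1 = 2 ^+ 2 * 2 :> R by ring.
  apply: le_trans (ln_pow2M 2 (lexx 2)) _; rewrite ler_wpM2l // ler_ln ?posrE //.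
have h1 : 2 * lam <= s * lam by rewrite ler_wpM2r // (le_trans _ lam_half) // invr_ge0.
move: h8 lam_lnN lam_lne ms h1; move: (ln _) (s * lam) => a b; lra.
Qed.

Lemma net_fail : t%:R * expR (- kap) <= eps / 8.
Proof.
have mp : 0 < m%:R :> R by rewrite ltr0n.
have tp : 0 < t%:R :> R by rewrite ltr0n.
apply: mul_expRN_le => //; rewrite /kap lerD2r ler_ln ?posrE ?mulr_gt0 //.
have t1 : t%:R <= 3 * ln s by rewrite /t -(natr1 tl); have := tl_ln; have := lns; lra.
have t2 : ln s <= s by rewrite ltW // ln_sublinear // ltr0n.
have h2 : s * 2^-1 <= s * lam by rewrite ler_wpM2l.
by have := ms; have := slam; lra.
Qed.

Lemma certs_fail (x : 'cV[R[i]]_N) : PB xe (fun S => ~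
   [/\ exists w, is_cert F Delta m%:R gam (sign_pattern Delta (fun j => grad x j ord0)) S w,
       forall k, exists w, is_cert F Delta m%:R gam (freq_pattern F Delta k) S w &
       forall l, exists w, is_cert F Delta m%:R gam (prefix_pattern R Delta l) S w]) <= eps / 8.
Proof.
set A := fun S => exists w, is_cert F Delta m%:R gam (sign_pattern Delta (fun j =>
  grad x j ord0)) S w.
set B := fun S k => exists w, is_cert F Delta m%:R gam (freq_pattern F Delta k) S w.
set C := fun S l => exists w, is_cert F Delta m%:R gam (prefix_pattern R Delta l) S w.
have b0 := bern_ge0 (N := N) xe01.
pose e := expR (- (m%:R / (16384 * s))).
have hA : PB xe (fun S => ~ A S) <= e.
  apply: cert_fail => j; rewrite /sign_pattern; first by move=> /negbTE->.
  case: ifP => _; last by rewrite ComplexField.Normc.normc0.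
  rewrite ComplexField.Normc.normcM normc_real ger0_norm ?invr_ge0 ?normc_ge0 //.
  have [->|d0] := eqVneq (normc (grad x j ord0)) 0; first by rewrite mulr0.
  by rewrite mulVf.
have hB k : PB xe (fun S => ~ B S k) <= e.
  apply: cert_fail => j; rewrite /freq_pattern; first by move=> /negbTE->.
  by case: ifP => _; rewrite ?normc_conj ?F1 // ComplexField.Normc.normc0.
have hC l : PB xe (fun S => ~ C S l) <= e.
  apply: cert_fail => j; rewrite /prefix_pattern; first by move=> /negbTE->.
  by case: ifP => _; rewrite ?ComplexField.Normc.normc1 // ComplexField.Normc.normc0.
apply: (@le_trans _ _ (PB xe (fun S => ~ A S \/ ((exists k, ~ B S k) \/ exists l, ~ C S l)))).
  apply: ler_PB => // S h; apply: contrapT => /not_orP[/contrapT hA' /not_orP[hB' hC']].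
  apply: h; split => // [k|l]; apply: contrapT => h'.
    by apply: hB'; exists k.
  by apply: hC'; exists l.
apply: (@le_trans _ _ (e + (N%:R * e + N%:R * e))).
  apply: le_trans (Pr_or b0 _ _) _; apply: lerD; first exact: hA.
  apply: le_trans (Pr_or b0 _ _) _; apply: lerD.
    apply: le_trans (Pr_exists b0 _) _; apply: (@le_trans _ _ (\sum_(k < N) e)).
      by apply: ler_sum => k _; exact: hB.
    by rewrite sumr_const card_ord mulr_natl.
  apply: le_trans (Pr_exists b0 _) _; apply: (@le_trans _ _ (\sum_(k < N) e)).
    by apply: ler_sum => k _; exact: hC.
  by rewrite sumr_const card_ord mulr_natl.
rewrite (_ : e + _ = (2 * N%:R + 1) * e); last by ring.
apply: mul_expRN_le => //; first by rewrite ltr_wpDl // mulr_ge0.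
have h5 : ln (8 * (2 * N%:R + 1)) <= 6%:R * ln N%:R :> R.
  apply: le_trans (ln_pow2M 5 N2R); rewrite ler_ln ?posrE ?mulr_gt0 ?exprn_gt0 ?ltr0n //.
    by have := N2R; lra.
  by rewrite ltr_wpDl // mulr_ge0.
have sp : 0 < s by rewrite ltr0n.
rewrite ler_pdivlMr ?mulr_gt0 //.
have h6 : (ln (8 * (2 * N%:R + 1)) + ln eps^-1) * (16384 * s) <= (6 * lam + 2 * lam) * (16384 * s).
  rewrite ler_wpM2r ?mulr_ge0 //; apply: lerD => //; apply: le_trans h5 _; by rewrite ler_wpM2l.
by have := ms; have := slam; lra.
Qed.

Lemma good_prob (x : 'cV[R[i]]_N) : 1 - eps < unif_prob R m (good Delta x m n iso_error).
Proof.
have mono (S S' : {set 'I_N}) : S \subset S' -> good Delta x m n iso_error S ->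
  good Delta x m n iso_error S'.
  exact: good_mono.
have T0 : 0 <= m%:R / 8 :> R by rewrite divr_ge0.
have xx01 : 0 <= xe * xe <= 1.
  by case/andP: xe01 => a b; rewrite mulr_ge0 // mulr_ile1.
have xxE : xe * xe = excl N (m%:R / 4) by rewrite /xe -exclD; congr excl; field.
have h := unif_prob_ge xx01 mN mono.
have hcard : PB (xe * xe) (fun S : {set 'I_N} => (m < #|S|)%N) <= eps / 8.
  by rewrite xxE; apply: card_fail => //; rewrite divr_ge0.
(* Failing certificates, an oversized second sample and a failing net cost [eps / 8] each. With
   [hcard] the total is [eps / 2], which leaves room for the strict inequality. *)
have hgood : PB (xe * xe) (fun S => ~ good Delta x m n iso_error S) <=
  1 * (eps / 8) + (eps / 8 + eps / 8).
  apply: le_trans (PB_union (c1 := 1) (c2 := eps / 8 + eps / 8) xe01 _ _ _ _) _; last first.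
  - by rewrite lerD2r ler_wpM2l //; exact: certs_fail x.
  - move=> S /contrapT[[w0 c0'] cF cP].
    have [wF wFP] := choice cF; have [wP wPP] := choice cP.
    apply: (@le_trans _ _ (PB xe (fun S' : {set 'I_N} => (m < #|S'|)%N \/
      ~ net_event (dual_mx F Delta wF) xe c0 m t S'))).
      apply: ler_PB => // S' ng; apply: contrapT => /not_orP[/negP + /contrapT net].
      rewrite -leqNgt => S'm; apply: ng.
      exists S, S', w0, wF, wP; split => //; first exact: subsetUl.
        exact: subsetUr.
      split => //; apply: lower_isometry_of_net => //.
      + exact: dual_mx_le1 wFP.
      + by have := sample_size_ge; rewrite -/n; have := m2; rewrite /n;
        have : 0 < N%:R :> R by [rewrite ltr0n]; nra.
      + exact: c0_ge0.
    apply: le_trans (Pr_or (bern_ge0 xe01) _ _) _; apply: lerD.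
      by apply: card_fail => //; lra.
    apply: le_trans net_fail; apply: PB_net_event => //.
    exact: kap_ge0.
  - by move=> S _; exact: PB_le1.
  - by rewrite addr_ge0 ?divr_ge0 ?ltW.
  - by [].
apply: lt_le_trans h; move: hgood hcard eps0; lra.
Qed.

(** From [s >= 2] and [ln m >= 1]. The signal estimate is obtained without a logarithm, so the
    factor in the claim has to be bounded below. *)
Lemma logfactor_ge_half : 2^-1 <= L.
Proof.
have h : 1 <= Num.sqrt (ln m%:R) :> R by rewrite -[leLHS]sqrtr1 ler_wsqrtr.
rewrite /L /logfactor; have := lns; move: h; move: (Num.sqrt _) (ln s) => a b; nra.
Qed.

Lemma sample_gt0 : (0 < m)%N.
Proof. exact: m0. Qed.

Lemma dim_gt1 : (1 < N)%N.
Proof. exact: N2. Qed.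

End SuccessProbability.

(** * Assembly of the two estimates *)

Lemma gradient_bound (R : realType) (s L sigma e H B eta : R) : 1 <= s -> 0 <= L -> 0 <= sigma ->
  0 <= e ->
  0 <= H -> 0 <= B -> B <= 5 * sigma + 210 * e -> H <= 8 * sigma + 430 * e ->
  eta <= 800 * (L ^+ 2 / s) -> H ^+ 2 <= (100 * (80 * e)) ^+ 2 + 9 * eta * B ^+ 2 ->
  H <= 300 * 100 * (e + L * (sigma / Num.sqrt s)).
Proof.
move=> s1 L0 sig0 e0 H0 B0 hB hH heta hH2.
have sp : 0 < s by apply: lt_le_trans s1.
have rp : 0 < Num.sqrt s by rewrite sqrtr_gt0.
set v := sigma / Num.sqrt s; have v0 : 0 <= v by rewrite divr_ge0 // ltW.
have sigE : sigma = Num.sqrt s * v by rewrite mulrC divfK // gt_eqF.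
(* If [L >= sqrt s] the crude bound [hH] already suffices. Otherwise [g <= 1], which lets
   [g * e ^+ 2] be absorbed into [e ^+ 2]. *)
have [sL|Ls] := leP (Num.sqrt s) L.
  have : Num.sqrt s * v <= L * v by rewrite ler_wpM2r.
  rewrite -sigE; move: hH; move: (L * v) => u; lra.
pose g := L ^+ 2 / s.
have g0 : 0 <= g by rewrite divr_ge0 ?sqr_ge0 // ltW.
have g1 : g <= 1.
  rewrite /g ler_pdivrMr // mul1r -[leRHS](sqr_sqrtr (ltW sp)).
  by rewrite lerXn2r ?nnegrE ?(ltW rp) ?(ltW Ls).
have gs : g * sigma ^+ 2 = (L * v) ^+ 2.
  by rewrite sigE !exprMn (sqr_sqrtr (ltW sp)) /g; field; rewrite !gt_eqF.
have u0 : 0 <= L * v by rewrite mulr_ge0.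
have B2 : B ^+ 2 <= (5 * sigma + 210 * e) ^+ 2 by rewrite lerXn2r ?nnegrE // (le_trans B0).
have h1 : eta * B ^+ 2 <= 800 * g * B ^+ 2 by rewrite ler_wpM2r ?sqr_ge0.
have h2 : g * B ^+ 2 <= g * (5 * sigma + 210 * e) ^+ 2 by rewrite ler_wpM2l.
have h3 : g * (5 * sigma + 210 * e) ^+ 2 <= 50 * (g * sigma ^+ 2) + 2 * 210 ^+ 2 * (g * e ^+ 2).
  have : 0 <= g * (5 * sigma - 210 * e) ^+ 2 by rewrite mulr_ge0 ?sqr_ge0.
  lra.
have h4 : g * e ^+ 2 <= e ^+ 2 by rewrite ler_piMl ?sqr_ge0.
rewrite -(@ler_pXn2r _ 2) ?nnegrE //; last by move: e0 u0; lra.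
rewrite gs in h3; apply: le_trans hH2 _.
have : 0 <= e * (L * v) by rewrite mulr_ge0.
have := sqr_ge0 (L * v); have := sqr_ge0 e; lra.
Qed.

Lemma signal_bound (R : realType) (L sigma e : R) : 2^-1 <= L -> 0 <= sigma -> 0 <= e ->
  16 * sigma + 862 * e <= 300 * 100 * (e + L * sigma).
Proof.
move=> hL sig0 e0; have : 2^-1 * sigma <= L * sigma by rewrite ler_wpM2r.
lra.
Qed.

Theorem theorem2p3 (R : realType) :
  exists C1 C2 : R, 0 < C1 /\ 0 < C2 /\
  forall (N : nat) (x : 'cV[R[i]]_N) (eps delta : R)
         (Delta : {set 'I_N}) (s m : nat),
    0 < eps < 1 -> 0 <= delta ->
    #|Delta| = s -> (2 <= s)%N ->
    (m <= N)%N ->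
    C1 * s%:R * (1 + ln eps^-1) * ln N%:R <= m%:R ->
    1 - eps <
    unif_prob R m (fun Omega' : {set 'I_N} =>
      let Omega := Omega' :|: freq0 N in
      forall eta : 'cV[R[i]]_N,
        lpnorm 2 eta <= Num.sqrt m%:R * delta ->
        let y := proj Omega (dft R N *m x) + eta in
        forall xh : 'cV[R[i]]_N,
          tv_minimizer Omega y (Num.sqrt m%:R * delta) xh ->
          lpnorm 2 (grad x - grad xh)
            <= C2 * (delta * Num.sqrt s%:R
                     + logfactor R m s
                       * (lpnorm 1 (proj_perp Delta (grad x))
                          / Num.sqrt s%:R))
          /\
          lpnorm 2 (x - xh) / Num.sqrt N%:R
            <= C2 * (delta * Num.sqrt s%:R
                     + logfactor R m s
                       * lpnorm 1 (proj_perp Delta (grad x)))).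
Proof.
exists (1000 * 1000), (300 * 100); split; first by rewrite mulr_gt0.
split; first by rewrite mulr_gt0.
move=> N x eps delta Delta s m eps01 delta0 sE s2 mN m_large; subst s.
(* The favourable event is fixed before [eta] and the minimiser are introduced, so both may depend
   on the sample. *)
apply: lt_le_trans (good_prob s2 mN eps01 m_large x) _; apply: ler_unif_prob => S gS /=.
move=> eta eta_le xh xh_min.
have N1 := dim_gt1 s2; have N0 := ltnW N1.
have m0 := sample_gt0 s2 eps01 m_large.
have s0 := ltnW s2.
have [tail [_ err]] := tail_and_error_le N0 m0 delta0 gS eta_le xh_min.
have sig := signal_le N0 m0 mN s0 delta0 gS eta_le xh_min N1.
have n16 := sample_size_ge s2 mN eps01 m_large.
have mp : 0 < m%:R :> R by rewrite ltr0n.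
have [iso0 iso1] := andP (iso_error_bounds s2 mN eps01 m_large).
have sqr := gradient_sqr_le N0 m0 s0 delta0 gS eta_le xh_min _ n16 iso0.
have L2 := logfactor_ge_half s2 eps01 m_large.
have sigmaE : lpnorm 1 (proj_perp Delta (grad x)) = \sum_(j | j \notin Delta) normc (grad x j ord0).
  rewrite lpnorm1E [RHS]big_mkcond; apply: eq_bigr => j _; rewrite /proj_perp colB on_set_proj /on_set.
  by case: ifP => _ /=; rewrite ?subrr ?subr0 ?ComplexField.Normc.normc0.
have gradE : lpnorm 2 (grad x - grad xh) = nrm (fun j => grad (xh - x) j ord0).
  rewrite lpnorm2E -nrmN; apply: eq_nrm => j; rewrite colB !mxE; ring.
have sg0 : 0 <= \sum_(j | j \notin Delta) normc (grad x j ord0) by apply: sumr_ge0 => j _; exact: normc_ge0.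
have e0 : 0 <= Num.sqrt #|Delta|%:R * delta by rewrite mulr_ge0 ?sqrtr_ge0.
rewrite sigmaE gradE [delta * _]mulrC; split.
  apply: gradient_bound tail err iso1 (sqr _) => //.
  - by rewrite ler1n.
  - by apply: le_trans L2; rewrite invr_ge0.
  - exact: nrm_ge0.
  - by apply: sumr_ge0 => j _; exact: normc_ge0.
  by rewrite -(@pmulr_rgt0 _ 16) // (lt_le_trans mp n16).
apply: le_trans sig _.
exact: signal_bound.
Qed.
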